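(* Let $m\geq 1$ be an integer, let $A$ be an algebra over $\mathbb{C}$, and let $\mathcal{F}=(\pi,H,F)$ and $\mathcal{G}=(\pi,H,G)$ be two $m$-summable Fredholm modules over $A$ (with the same Hilbert space $H$, the same homomorphism $\pi$ and, when $m-1$ is even, the same grading operator $\gamma$). Assume that the difference $G-F\in\mathcal{L}^m(H)$ lies in the $m^{\text{th}}$ Schatten ideal. Then the Chern characters of $\mathcal{F}$ and $\mathcal{G}$ coincide in cyclic cohomology: $$\mathrm{Ch}(\mathcal{F})=\mathrm{Ch}(\mathcal{G})\in HC^{m-1}(A).$$
   Context: **Fredholm modules.** $\mathcal{L}^m(H)$ is the $m^{\text{th}}$ Schatten ideal of a Hilbert space $H$ and $\mathcal{L}(H)$ the algebra of bounded operators. An $m$-summable Fredholm module $\mathcal{F}=(\pi,H,F)$ over a (not necessarily unital) $\mathbb{C}$-algebra $A$ consists of a separable Hilbert space $H$, an algebra homomorphism $\pi:A\to\mathcal{L}(H)$ and $F\in\mathcal{L}(H)$ with $F^2=1$, $F=F^*$ and $[F,\pi(a)]\in\mathcal{L}^m(H)$ for all $a\in A$. When $m-1$ is even one also requires a $\mathbb{Z}/2\mathbb{Z}$-grading operator $\gamma\in\mathcal{L}(H)$ (a selfadjoint unitary) which anticommutes with $F$ and commutes with $\pi(A)$. When $m-1$ is odd put $\gamma=\mathrm{Id}$. **Cyclic cohomology.** For a unital $\mathbb{C}$-algebra $B$ let $C^n(B)=\mathrm{Hom}_{\mathbb{C}}(B^{\otimes(n+1)},\mathbb{C})$, with Hochschild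 coboundary $b:C^n(B)\to C^{n+1}(B)$ and Connes coboundary $B:C^n(B)\to C^{n-1}(B)$ (the usual operators, satisfying $b^2=0$, $B^2=0$, $bB=-Bb$). Let $\mathcal{B}^n(B)=\bigoplus_{0\le k\le n/2}C^{n-2k}(B)$ with coboundary $b+B$; cochains are written $(\varphi^n,\varphi^{n-2},\ldots)$. For a general algebra $A$ let $\widetilde{A}=A\oplus\mathbb{C}$ be the unitalization (a unit is adjoined even if $A$ has one), let $i:\mathbb{C}\to\widetilde{A}$ be the unital inclusion, and let $\mathcal{B}^*(A)$ be the kernel of the restriction $i^*:\mathcal{B}^*(\widetilde{A})\to\mathcal{B}^*(\mathbb{C})$. Then $HC^*(A)=H^*(\mathcal{B}^*(A))$. **Chern character.** Extend $\pi$ unitally to $\widetilde{A}$ and write $x$ for the operator $\pi(x)$, $x\in\widetilde{A}$. The index cocycle of $\mathcal{F}$ is the cyclic cocycle $(\tau_{\mathcal{F}},0,0,\ldots)\in\mathcal{B}^{m-1}(A)$ with $$\tau_{\mathcal{F}}(x_0,\ldots,x_{m-1})=\tfrac12\mathrm{Tr}\big(\gamma^mF[F,x_0]\cdots[F,x_{m-1}]\big),\qquad x_0,\ldots,x_{m-1}\in\widetilde{A},$$ and $\mathrm{Ch}(\mathcal{F})=[\tau_{\mathcal{F}}]\in HC^{m-1}(A)$. *)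

(* Defs.v *)
From HB Require Import structures.
From mathcomp Require Import all_boot all_order all_algebra.
From mathcomp Require Import sesquilinear ring_quotient generic_quotient.
From mathcomp Require Import complex.
From mathcomp Require Import all_classical all_reals all_analysis.

Set Implicit Arguments.
Unset Strict Implicit.
Unset Printing Implicit Defensive.

Import Order.TTheory GRing.Theory Num.Theory.
Import numFieldNormedType.Exports.

Local Open Scope classical_set_scope.
Local Open Scope ring_scope.

HB.mixin Record Lmodule_isNonUnitalAlgebra (K : fieldType) A
    of GRing.Lmodule K A := {
  numul : A -> A -> A;
  numulA : associative numul;
  numul_linearl : forall b, linear (numul^~ b);
  numul_linearr : forall a, linear (numul a)
}.

#[short(type="nonUnitalAlgType")]
HB.structure Definition NonUnitalAlgebra (K : fieldType) :=
  { A of GRing.Lmodule K A & Lmodule_isNonUnitalAlgebra K A }.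

(* A unit is adjoined even if A already has one. *)
Record unitalization (K : fieldType) (A : nonUnitalAlgType K) : Type :=
  Unitalization { algebra_part : A; scalar_part : K }.
Arguments Unitalization {K A}.

Section Unitalization.
Context (K : fieldType) (A : nonUnitalAlgType K).
Local Notation tA := (unitalization A).
Implicit Types x y z : tA.

Let to_pair x := (algebra_part x, scalar_part x).
Let of_pair (p : A * K) : tA := Unitalization p.1 p.2.
Let to_pairK : cancel to_pair of_pair. Proof. by case. Qed.
HB.instance Definition _ := Equality.copy tA (can_type to_pairK).
HB.instance Definition _ := Choice.copy tA (can_type to_pairK).

Definition unit_zero : tA := Unitalization 0 0.
Definition unit_opp x := Unitalization (- algebra_part x) (- scalar_part x).
Definition unit_add x y :=
  Unitalization (algebra_part x + algebra_part y) (scalar_part x + scalar_part y).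
Definition unit_scale (k : K) x :=
  Unitalization (k *: algebra_part x) (k * scalar_part x).
Definition unit_one : tA := Unitalization 0 1.
Definition unit_mul x y : tA :=
  Unitalization
    (numul (algebra_part x) (algebra_part y) + scalar_part x *: algebra_part y
       + scalar_part y *: algebra_part x)
    (scalar_part x * scalar_part y).

Let unit_addA : associative unit_add.
Proof. by move=> [a k] [b l] [c p]; congr Unitalization; exact: addrA. Qed.
Let unit_addC : commutative unit_add.
Proof. by move=> [a k] [b l]; congr Unitalization; exact: addrC. Qed.
Let unit_add0 : left_id unit_zero unit_add.
Proof. by move=> [a k]; congr Unitalization; exact: add0r. Qed.
Let unit_addN : left_inverse unit_zero unit_opp unit_add.
Proof. by move=> [a k]; congr Unitalization; exact: addNr. Qed.
HB.instance Definition _ :=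
  GRing.isZmodule.Build tA unit_addA unit_addC unit_add0 unit_addN.

Let unit_scaleA k l x : unit_scale k (unit_scale l x) = unit_scale (k * l) x.
Proof. by case: x => a p; congr Unitalization; [exact: scalerA|exact: mulrA]. Qed.
Let unit_scale1 : left_id 1 unit_scale.
Proof. by case=> a p; congr Unitalization; [exact: scale1r|exact: mul1r]. Qed.
Let unit_scaleDr : right_distributive unit_scale +%R.
Proof.
by move=> k [a p] [b q]; congr Unitalization; [exact: scalerDr|exact: mulrDr].
Qed.
Let unit_scaleDl x : {morph unit_scale^~ x : k l / k + l}.
Proof.
by case: x => a p k l; congr Unitalization; [exact: scalerDl|exact: mulrDl].
Qed.
HB.instance Definition _ := GRing.Zmodule_isLmodule.Build K tA
  unit_scaleA unit_scale1 unit_scaleDr unit_scaleDl.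

Let numulDl (a b c : A) : numul (a + b) c = numul a c + numul b c.
Proof. by have := numul_linearl c 1 a b; rewrite !scale1r. Qed.
Let numulDr (a b c : A) : numul a (b + c) = numul a b + numul a c.
Proof. by have := numul_linearr a 1 b c; rewrite !scale1r. Qed.
Let numul0l (a : A) : numul 0 a = 0.
Proof. by apply: (addrI (numul 0 a)); rewrite -numulDl !addr0. Qed.
Let numul0r (a : A) : numul a 0 = 0.
Proof. by apply: (addrI (numul a 0)); rewrite -numulDr !addr0. Qed.
Let numulZl k (a b : A) : numul (k *: a) b = k *: numul a b.
Proof. by have := numul_linearl b k a 0; rewrite !addr0 numul0l addr0. Qed.
Let numulZr k (a b : A) : numul a (k *: b) = k *: numul a b.
Proof. by have := numul_linearr a k b 0; rewrite !addr0 numul0r addr0. Qed.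

Let unit_mulA : associative unit_mul.
Proof.
move=> [a k] [b l] [c p]; congr Unitalization; last exact: mulrA.
rewrite /= !numulDl !numulDr !numulZl !numulZr numulA !scalerDr !scalerA.
by rewrite [p * k]mulrC [p * l]mulrC !addrA [LHS](ACl (1*4*2*5*3*6*7)).
Qed.
Let unit_mul1l : left_id unit_one unit_mul.
Proof.
case=> a k; congr Unitalization; rewrite /= ?mul1r//.
by rewrite numul0l scale1r scaler0 add0r addr0.
Qed.
Let unit_mul1r : right_id unit_one unit_mul.
Proof.
case=> a k; congr Unitalization; rewrite /= ?mulr1//.
by rewrite numul0r scale1r scaler0 !add0r.
Qed.
Let unit_mulDl : left_distributive unit_mul +%R.
Proof.
move=> [a k] [b l] [c p]; congr Unitalization; last exact: mulrDl.
by rewrite /= numulDl scalerDl scalerDr (AC (2*2*2) ((1*3*5)*(2*4*6))).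
Qed.
Let unit_mulDr : right_distributive unit_mul +%R.
Proof.
move=> [a k] [b l] [c p]; congr Unitalization; last exact: mulrDr.
by rewrite /= numulDr scalerDl scalerDr (AC (2*2*2) ((1*3*5)*(2*4*6))).
Qed.
Let unit_one_neq0 : unit_one != 0.
Proof. by apply/eqP => -[] /eqP; rewrite oner_eq0. Qed.
HB.instance Definition _ := GRing.Zmodule_isNzRing.Build tA
  unit_mulA unit_mul1l unit_mul1r unit_mulDl unit_mulDr unit_one_neq0.

Let unit_scaleAl (k : K) x y : k *: (x * y) = k *: x * y.
Proof.
case: x y => [a p] [b q]; congr Unitalization; last exact: mulrA.
by rewrite /= !scalerDr numulZl !scalerA [q * k]mulrC.
Qed.
HB.instance Definition _ := GRing.Lmodule_isLalgebra.Build K tA unit_scaleAl.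

Let unit_scaleAr (k : K) x y : k *: (x * y) = x * (k *: y).
Proof.
case: x y => [a p] [b q]; congr Unitalization; last exact: mulrCA.
by rewrite /= !scalerDr numulZr !scalerA [k * p]mulrC.
Qed.
HB.instance Definition _ := GRing.Lalgebra_isAlgebra.Build K tA unit_scaleAr.

End Unitalization.

Section Cochains.
Context (K : fieldType) (B : algType K).

(* A linear form on the tensor power of order n+1 is encoded as a multilinear *)
(* form in n+1 variables.                                                     *)
Definition multilinear n (phi : ('I_n.+1 -> B) -> K) :=
  forall (a : 'I_n.+1 -> B) (i : 'I_n.+1),
    scalar (fun x : B => phi (fun j => if j == i then x else a j)).

(* The tuple (a_0, ..., a_i a_{i+1}, ..., a_{n+1}). *)
Definition merge_at n (i : nat) (a : 'I_n.+2 -> B) : 'I_n.+1 -> B :=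
  fun j => if (j < i)%N then a (inord j)
           else if j == i :> nat then a (inord j) * a (inord j.+1)
           else a (inord j.+1).

(* The tuple (a_{n+1} a_0, a_1, ..., a_n). *)
Definition merge_cyclic n (a : 'I_n.+2 -> B) : 'I_n.+1 -> B :=
  fun j => if j == ord0 then a ord_max * a ord0 else a (inord j).

Definition hochschild n (phi : ('I_n.+1 -> B) -> K) (a : 'I_n.+2 -> B) : K :=
  \sum_(i < n.+1) (-1) ^+ i * phi (merge_at i a)
  + (-1) ^+ n.+1 * phi (merge_cyclic a).

Definition insert1_first n (a : 'I_n.+1 -> B) : 'I_n.+2 -> B :=
  fun j => if unlift ord0 j is Some k then a k else 1.

Definition insert1_last n (a : 'I_n.+1 -> B) : 'I_n.+2 -> B :=
  fun j => if unlift ord_max j is Some k then a k else 1.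

(* The tuple (a_j, ..., a_n, a_0, ..., a_{j-1}). *)
Definition rotate n (j : nat) (a : 'I_n.+1 -> B) : 'I_n.+1 -> B :=
  fun k => a (inord ((k + j) %% n.+1)).

(* Connes' operator A B_0 on a cochain phi of degree n+1, where               *)
(* B_0 phi (a) = phi (1, a) - (-1)^{n+1} phi (a, 1) and A is the signed sum   *)
(* over cyclic permutations.                                                  *)
Definition connes_B0 n (phi : ('I_n.+2 -> B) -> K) (a : 'I_n.+1 -> B) : K :=
  phi (insert1_first a) - (-1) ^+ n.+1 * phi (insert1_last a).

Definition connes n (phi : ('I_n.+2 -> B) -> K) (a : 'I_n.+1 -> B) : K :=
  \sum_(j < n.+1) (-1) ^+ (n * j) * connes_B0 phi (rotate j a).

(* A family with one component in each degree. *)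
Definition graded_cochain := forall n, ('I_n.+1 -> B) -> K.

HB.instance Definition _ := gen_eqMixin graded_cochain.
HB.instance Definition _ := gen_choiceMixin graded_cochain.

Definition cochain_zero : graded_cochain := fun _ _ => 0.
Definition cochain_opp (phi : graded_cochain) : graded_cochain :=
  fun n a => - phi n a.
Definition cochain_add (phi psi : graded_cochain) : graded_cochain :=
  fun n a => phi n a + psi n a.

Let cochainP (phi psi : graded_cochain) :
  (forall n a, phi n a = psi n a) -> phi = psi.
Proof.
by move=> h; apply: functional_extensionality_dep => n; apply/funext => a.
Qed.
Let cochain_addA : associative cochain_add.
Proof. by move=> *; apply: cochainP => n a; exact: addrA. Qed.
Let cochain_addC : commutative cochain_add.
Proof. by move=> *; apply: cochainP => n a; exact: addrC. Qed.
Let cochain_add0 : left_id cochain_zero cochain_add.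
Proof. by move=> *; apply: cochainP => n a; exact: add0r. Qed.
Let cochain_addN : left_inverse cochain_zero cochain_opp cochain_add.
Proof. by move=> *; apply: cochainP => n a; exact: addNr. Qed.
HB.instance Definition _ := GRing.isZmodule.Build graded_cochain
  cochain_addA cochain_addC cochain_add0 cochain_addN.

Lemma graded_cochainP (phi psi : graded_cochain) :
  (forall n a, phi n a = psi n a) -> phi = psi.
Proof. exact: cochainP. Qed.

Definition coboundary (phi : graded_cochain) : graded_cochain := fun n a =>
  match n return ('I_n.+1 -> B) -> K with
  | 0 => fun=> 0
  | p.+1 => hochschild (phi p)
  end a + connes (phi n.+1) a.

(* The space whose elements are the tuples (phi^n, phi^{n-2}, ...). *)
Definition mixed_cochain (n : nat) (phi : graded_cochain) :=
  (forall p, multilinear (phi p)) /\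
  (forall p, ~~ ((p <= n)%N && (odd p == odd n)) -> phi p = fun=> 0).

Lemma coboundaryB phi psi :
  coboundary (phi - psi) = coboundary phi - coboundary psi.
Proof.
have hB n (f g : ('I_n.+1 -> B) -> K) (a : 'I_n.+2 -> B) :
    hochschild (fun x => f x - g x) a = hochschild f a - hochschild g a.
  rewrite /hochschild opprD addrACA -mulrBr -sumrB; congr (_ + _).
  by apply: eq_bigr => i _; rewrite mulrBr.
have cB n (f g : ('I_n.+2 -> B) -> K) (a : 'I_n.+1 -> B) :
    connes (fun x => f x - g x) a = connes f a - connes g a.
  rewrite /connes -sumrB; apply: eq_bigr => i _; rewrite -mulrBr.
  by congr (_ * _); rewrite /connes_B0 mulrBr !opprB (AC (2*2) ((1*4)*(3*2))).
apply: graded_cochainP => -[|n] a.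
  by rewrite [LHS](_ : _ = 0 + connes (fun x => phi 1 x - psi 1 x) a)// cB
    [RHS](_ : _ = (0 + connes (phi 1) a) - (0 + connes (psi 1) a))// !add0r.
rewrite [LHS](_ : _ = hochschild (fun x => phi n x - psi n x) a
    + connes (fun x => phi n.+2 x - psi n.+2 x) a)//.
by rewrite hB cB addrACA -opprD.
Qed.

Lemma mixed_cochain0 n : mixed_cochain n 0.
Proof.
by split=> // p a i k x y; rewrite [LHS](_ : _ = 0)// mulr0 addr0.
Qed.

Lemma mixed_cochainB n phi psi :
  mixed_cochain n phi -> mixed_cochain n psi -> mixed_cochain n (phi - psi).
Proof.
move=> [lphi sphi] [lpsi spsi]; split=> [p a i k x y|p pn].
  have := lphi p a i k x y; have := lpsi p a i k x y => /= e1 e2.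
  by rewrite [LHS](_ : _ = phi p (fun j => if j == i then k *: x + y else a j)
    - psi p (fun j => if j == i then k *: x + y else a j))// e1 e2 opprD addrACA
    -mulrBr.
apply/funext => a.
by rewrite [LHS](_ : _ = phi p a - psi p a)// sphi// spsi// subr0.
Qed.

End Cochains.


Section CyclicCohomology.
Context (K : fieldType) (A : nonUnitalAlgType K).
Local Notation tA := (unitalization A).

(* The pullback along the unital inclusion of K into the unitalization. *)
Definition restrict_scalars (phi : graded_cochain tA) : graded_cochain K^o :=
  fun n a => phi n (fun i => (a i)%:A).

Definition reduced_cochain (n : nat) (phi : graded_cochain tA) :=
  mixed_cochain n phi /\ restrict_scalars phi = 0.

Definition cocycle (n : nat) : {pred graded_cochain tA} :=
  fun phi => `[< reduced_cochain n phi /\ coboundary phi = 0 >].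

Let restrict_scalarsB phi psi :
  restrict_scalars (phi - psi) = restrict_scalars phi - restrict_scalars psi.
Proof. by []. Qed.

Lemma reduced_cochain0 n : reduced_cochain n 0.
Proof. by split; first exact: mixed_cochain0. Qed.

Lemma reduced_cochainB n phi psi :
  reduced_cochain n phi -> reduced_cochain n psi ->
  reduced_cochain n (phi - psi).
Proof.
move=> [mphi rphi] [mpsi rpsi]; split; first exact: mixed_cochainB.
by rewrite restrict_scalarsB rphi rpsi subr0.
Qed.

Let coboundary0 : coboundary (0 : graded_cochain tA) = 0.
Proof. by rewrite -{1}[0](subrr 0) coboundaryB subrr. Qed.

Let cocycle_zmod_closed n : zmod_closed (cocycle n).
Proof.
split=> [|phi psi]; first by apply/asboolP; split; first exact: reduced_cochain0.
move=> /asboolP[rphi dphi] /asboolP[rpsi dpsi]; apply/asboolP; split.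
  exact: reduced_cochainB.
by rewrite coboundaryB dphi dpsi subrr.
Qed.
HB.instance Definition _ n :=
  GRing.isZmodClosed.Build (graded_cochain tA) (cocycle n)
    (cocycle_zmod_closed n).

Record cocycles (n : nat) :=
  Cocycle { cochain_of :> graded_cochain tA; _ : cochain_of \in cocycle n }.
HB.instance Definition _ n := [isSub for @cochain_of n].
HB.instance Definition _ n := [Choice of cocycles n by <:].
HB.instance Definition _ n := [SubChoice_isSubZmodule of cocycles n by <:].

(* In degree 0 there is no incoming coboundary. *)
Definition exact_cocycle (n : nat) : {pred cocycles n} := fun phi =>
  `[< if n is p.+1 then
        exists2 psi, reduced_cochain p psi & coboundary psi = phi
      else phi = 0 >].

Let exact_zmod_closed n : zmod_closed (@exact_cocycle n).
Proof.
case: n => [|n]; split=> [|phi psi]; first exact/asboolP.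
- by move=> /asboolP-> /asboolP->; apply/asboolP; rewrite subr0.
- by apply/asboolP; exists 0; [exact: reduced_cochain0|exact: coboundary0].
- move=> /asboolP[f rf df] /asboolP[g rg dg]; apply/asboolP; exists (f - g).
    exact: reduced_cochainB.
  by rewrite coboundaryB df dg.
Qed.
HB.instance Definition _ n :=
  GRing.isZmodClosed.Build (cocycles n) (@exact_cocycle n)
    (exact_zmod_closed n).

Definition cyclic_cohomology (n : nat) := {ideal_quot @exact_cocycle n}.

Definition cohomology_class (n : nat) (phi : cocycles n) :
  cyclic_cohomology n := \pi_(cyclic_cohomology n)%qT phi.

End CyclicCohomology.

HB.mixin Record CompleteNormedModule_isSeparableHilbert (R : realType) H
    of CompleteNormedModule R[i] H := {
  inner : {dot H for @Num.conj R[i]};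
  inner_normE : forall x : H, inner x x = `|x| ^+ 2;
  separable : exists2 D : set H, countable D & dense D
}.

#[short(type="separableHilbertType")]
HB.structure Definition SeparableHilbert (R : realType) :=
  { H of CompleteNormedModule R[i] H
       & CompleteNormedModule_isSeparableHilbert R H }.

Local Notation "'[ x , y ]" := (inner x y) : ring_scope.

Record bounded_operator (R : realType) (H : separableHilbertType R) :=
  BoundedOperator {
    operator_fun :> H -> H;
    operator_linear : linear operator_fun;
    operator_bounded : exists M : R[i], forall x, `|operator_fun x| <= M * `|x|
  }.

Section BoundedOperators.
Context (R : realType) (H : separableHilbertType R).
Local Notation C := R[i].
Local Notation L := (bounded_operator H).
Implicit Types S T U : L.

Lemma operatorP S T : S =1 T -> S = T.
Proof.
case: S T => [S lS bS] [T lT bT] /= /funext ST; move: lS bS lT bT.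
by rewrite ST => *; congr BoundedOperator; exact: Prop_irrelevance.
Qed.

HB.instance Definition _ T :=
  GRing.isLinear.Build C H H *:%R T (operator_linear T).

HB.instance Definition _ := gen_eqMixin L.
HB.instance Definition _ := gen_choiceMixin L.

Let zero_linear : linear (fun _ : H => 0 : H).
Proof. by move=> k x y; rewrite scaler0 addr0. Qed.
Let zero_bounded : exists M : C, forall x : H, `|0 : H| <= M * `|x|.
Proof. by exists 0 => x; rewrite normr0 mul0r. Qed.
Definition operator_zero : L := BoundedOperator zero_linear zero_bounded.

Let opp_linear T : linear (fun x => - T x).
Proof. by move=> k x y; rewrite linearP opprD scalerN. Qed.
Let opp_bounded T : exists M : C, forall x, `|- T x| <= M * `|x|.
Proof. by have [M TM] := operator_bounded T; exists M => x; rewrite normrN. Qed.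
Definition operator_opp T : L := BoundedOperator (opp_linear T) (opp_bounded T).

Let add_linear S T : linear (fun x => S x + T x).
Proof. by move=> k x y; rewrite !linearP scalerDr addrACA. Qed.
Let add_bounded S T : exists M : C, forall x, `|S x + T x| <= M * `|x|.
Proof.
have [[M SM] [N TN]] := (operator_bounded S, operator_bounded T).
by exists (M + N) => x; rewrite mulrDl (le_trans (ler_normD _ _))// lerD.
Qed.
Definition operator_add S T : L :=
  BoundedOperator (add_linear S T) (add_bounded S T).

Let scale_linear (k : C) T : linear (fun x => k *: T x).
Proof. by move=> l x y; rewrite linearP scalerDr !scalerA mulrC. Qed.
Let scale_bounded (k : C) T : exists M : C, forall x, `|k *: T x| <= M * `|x|.
Proof.
have [M TM] := operator_bounded T.
by exists (`|k| * M) => x; rewrite normrZ -mulrA ler_wpM2l.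
Qed.
Definition operator_scale (k : C) T : L :=
  BoundedOperator (scale_linear k T) (scale_bounded k T).

Let id_linear : linear (fun x : H => x). Proof. by []. Qed.
Let id_bounded : exists M : C, forall x : H, `|x| <= M * `|x|.
Proof. by exists 1 => x; rewrite mul1r. Qed.
Definition operator_id : L := BoundedOperator id_linear id_bounded.

Let comp_linear S T : linear (fun x => S (T x)).
Proof. by move=> k x y; rewrite !linearP. Qed.
Let comp_bounded S T : exists M : C, forall x, `|S (T x)| <= M * `|x|.
Proof.
have [[M SM] [N TN]] := (operator_bounded S, operator_bounded T).
exists (`|M| * `|N|) => x; apply: le_trans (SM _) _.
have [->|x0] := eqVneq x 0; first by rewrite !linear0 !normr0 !mulr0.
have N0 : 0 <= N.
  have x_gt0 : 0 < `|x| by rewrite normr_gt0.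
  by rewrite -(pmulr_lge0 _ x_gt0) (le_trans _ (TN x)).
have [->|Tx0] := eqVneq (T x) 0; first by rewrite normr0 mulr0 !mulr_ge0.
have M0 : 0 <= M.
  have Tx_gt0 : 0 < `|T x| by rewrite normr_gt0.
  by rewrite -(pmulr_lge0 _ Tx_gt0) (le_trans _ (SM (T x))).
by rewrite (ger0_norm M0) (ger0_norm N0) -mulrA ler_wpM2l.
Qed.
Definition operator_comp S T : L :=
  BoundedOperator (comp_linear S T) (comp_bounded S T).

Let op_addA : associative operator_add.
Proof. by move=> S T U; apply: operatorP => x; exact: addrA. Qed.
Let op_addC : commutative operator_add.
Proof. by move=> S T; apply: operatorP => x; exact: addrC. Qed.
Let op_add0 : left_id operator_zero operator_add.
Proof. by move=> T; apply: operatorP => x; exact: add0r. Qed.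
Let op_addN : left_inverse operator_zero operator_opp operator_add.
Proof. by move=> T; apply: operatorP => x; exact: addNr. Qed.
HB.instance Definition _ :=
  GRing.isZmodule.Build L op_addA op_addC op_add0 op_addN.

Let op_compA : associative operator_comp.
Proof. by move=> S T U; apply: operatorP. Qed.
Let op_comp1l : left_id operator_id operator_comp.
Proof. by move=> T; apply: operatorP. Qed.
Let op_comp1r : right_id operator_id operator_comp.
Proof. by move=> T; apply: operatorP. Qed.
Let op_compDl : left_distributive operator_comp +%R.
Proof. by move=> S T U; apply: operatorP. Qed.
Let op_compDr : right_distributive operator_comp +%R.
Proof. by move=> S T U; apply: operatorP => x; exact: linearD. Qed.
(* Not a nontrivial ring: [H] may be the zero space. *)
HB.instance Definition _ := GRing.Zmodule_isPzRing.Build L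
  op_compA op_comp1l op_comp1r op_compDl op_compDr.

Let op_scaleA (k l : C) T :
  operator_scale k (operator_scale l T) = operator_scale (k * l) T.
Proof. by apply: operatorP => x; exact: scalerA. Qed.
Let op_scale1 : left_id 1 operator_scale.
Proof. by move=> T; apply: operatorP => x; exact: scale1r. Qed.
Let op_scaleDr : right_distributive operator_scale +%R.
Proof. by move=> k S T; apply: operatorP => x; exact: scalerDr. Qed.
Let op_scaleDl T : {morph operator_scale^~ T : k l / k + l}.
Proof. by move=> k l; apply: operatorP => x; exact: scalerDl. Qed.
HB.instance Definition _ := GRing.Zmodule_isLmodule.Build C L
  op_scaleA op_scale1 op_scaleDr op_scaleDl.

Definition commutator S T : L := S * T - T * S.

Definition adjoint_of T S := forall x y, '[T x, y] = '[x, S y].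
Definition selfadjoint T := adjoint_of T T.
Definition positive_operator T := forall x, 0 <= '[T x, x].

(* The basis consists of the nonzero [e n]: padding with zero vectors covers  *)
(* finite-dimensional spaces, and adds nothing to the sums below.             *)
Definition orthonormal_basis (e : nat -> H) :=
  [/\ forall n, e n = 0 \/ '[e n, e n] = 1,
      forall n p, n <> p -> '[e n, e p] = 0 &
      forall x, (forall n, '[x, e n] = 0) -> x = 0].

(* The trace of a trace class operator does not depend on the chosen basis. *)
Definition chosen_basis : nat -> H := xget (fun=> 0) orthonormal_basis.

Definition trace_series T : nat -> C^o :=
  series (fun n => '[T (chosen_basis n), chosen_basis n] : C^o).

Definition trace T : C := limn (trace_series T).

(* [P] is the absolute value [(T^* T)^(1/2)] of [T]. *)
Definition absolute_value T P :=
  positive_operator P /\ exists2 Tadj, adjoint_of T Tadj & P ^+ 2 = Tadj * T.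

(* Tr(|T|^m) < oo; the terms of the series are nonnegative reals. *)
Definition schatten (m : nat) T :=
  exists2 P, absolute_value T P & cvgn (trace_series (P ^+ m)).

End BoundedOperators.

Record fredholm_module (R : realType) (A : nonUnitalAlgType R[i])
    (H : separableHilbertType R) (m : nat) := FredholmModule {
  fm_rep : {linear A -> bounded_operator H};
  fm_repM : forall a b, fm_rep (numul a b) = fm_rep a * fm_rep b;
  fm_sym : bounded_operator H;
  fm_symK : fm_sym ^+ 2 = 1;
  fm_sym_selfadjoint : selfadjoint fm_sym;
  fm_summable : forall a, schatten m (commutator fm_sym (fm_rep a));
  fm_grading : bounded_operator H;
  fm_grading_even : ~~ odd m.-1 ->
    [/\ selfadjoint fm_grading, fm_grading ^+ 2 = 1,
        fm_grading * fm_sym = - (fm_sym * fm_grading) &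
        forall a, fm_grading * fm_rep a = fm_rep a * fm_grading];
  fm_grading_odd : odd m.-1 -> fm_grading = 1
}.

Section ChernCharacter.
Context (R : realType) (A : nonUnitalAlgType R[i]).
Context (H : separableHilbertType R) (m : nat) (F : fredholm_module A H m).
Local Notation C := R[i].

Definition unital_rep (x : unitalization A) : bounded_operator H :=
  fm_rep F (algebra_part x) + scalar_part x *: (1 : bounded_operator H).

(* Concentrated in degree n = m - 1, where the product has m factors. *)
Definition index_cochain : graded_cochain (unitalization A) := fun n x =>
  if n == m.-1 then
    2^-1 * trace (fm_grading F ^+ m * fm_sym F
                  * \prod_(i < n.+1) commutator (fm_sym F) (unital_rep (x i)))
  else 0 : C.

Definition chern_character (cF : index_cochain \in cocycle m.-1) :
  cyclic_cohomology A m.-1 := cohomology_class (Cocycle cF).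

End ChernCharacter.

(* Main.v *)
From HB Require Import structures.
Require Import Defs.
From mathcomp Require Import all_boot all_order all_algebra.
From mathcomp Require Import sesquilinear ring_quotient generic_quotient complex.
From mathcomp Require Import all_classical all_reals all_analysis.
From mathcomp Require Import ring lra zify.
From Stdlib Require Ncring Ncring_tac.
Import -(notations) Ncring Ncring_tac.

Set Implicit Arguments.
Unset Strict Implicit.
Unset Printing Implicit Defensive.

Import Order.TTheory GRing.Theory Num.Theory.
Import numFieldNormedType.Exports.

Local Open Scope ring_scope.

Definition bar (A : Type) (S : pzRingType) := seq A -> S.

Section BarRing.
Context (A : Type) (S : pzRingType).
Local Notation bar := (bar A S).
Implicit Types (f g h : bar) (s : seq A).

HB.instance Definition _ := gen_eqMixin bar.
HB.instance Definition _ := gen_choiceMixin bar.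

Definition bar_zero : bar := fun=> 0.
Definition bar_opp f : bar := fun s => - f s.
Definition bar_add f g : bar := fun s => f s + g s.
Definition bar_one : bar := fun s => if s is [::] then 1 else 0.
Definition bar_mul f g : bar := fun s =>
  \sum_(i < (size s).+1) f (take i s) * g (drop i s).

Let addA : associative bar_add.
Proof. by move=> f g h; apply/funext => s; exact: addrA. Qed.
Let addC : commutative bar_add.
Proof. by move=> f g; apply/funext => s; exact: addrC. Qed.
Let add0 : left_id bar_zero bar_add.
Proof. by move=> f; apply/funext => s; exact: add0r. Qed.
Let addN : left_inverse bar_zero bar_opp bar_add.
Proof. by move=> f; apply/funext => s; exact: addNr. Qed.
HB.instance Definition _ := GRing.isZmodule.Build bar addA addC add0 addN.

Let mul_nil f g : bar_mul f g [::] = f [::] * g [::].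
Proof. by rewrite /bar_mul big_ord_recl big_ord0 addr0. Qed.

Let mul_cons f g a s : bar_mul f g (a :: s) =
  f [::] * g (a :: s) + bar_mul (fun t => f (a :: t)) g s.
Proof. by rewrite /bar_mul big_ord_recl. Qed.

Let mulDl : left_distributive bar_mul +%R.
Proof.
move=> f g h; apply/funext => s; rewrite [RHS]/GRing.add /= /bar_add -big_split.
by apply: eq_bigr => i _; exact: mulrDl.
Qed.
Let mulDr : right_distributive bar_mul +%R.
Proof.
move=> f g h; apply/funext => s; rewrite [RHS]/GRing.add /= /bar_add -big_split.
by apply: eq_bigr => i _; exact: mulrDr.
Qed.
Let mulZ (c : S) f g s : bar_mul (fun t => c * f t) g s = c * bar_mul f g s.
Proof.
by rewrite [RHS]mulr_sumr; apply: eq_bigr => i _; rewrite mulrA.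
Qed.
Let mulA : associative bar_mul.
Proof.
move=> f g h; apply/funext => s.
elim: s f g h => [|a s IHs] f g h; first by rewrite !mul_nil mulrA.
rewrite !mul_cons mul_nil mulrDr -!mulrA -addrA; congr (_ + _).
have -> : (fun t => bar_mul f g (a :: t)) =
    bar_add (fun t => f [::] * g (a :: t)) (bar_mul (fun t => f (a :: t)) g).
  by apply/funext => t; exact: mul_cons.
have -> := mulDl (fun t => f [::] * g (a :: t)) (bar_mul (fun t => f (a :: t)) g) h.
by rewrite IHs -mulZ.
Qed.
Let mul1l : left_id bar_one bar_mul.
Proof.
move=> f; apply/funext => -[|a s]; first by rewrite mul_nil mul1r.
rewrite mul_cons mul1r /bar_mul big1 ?addr0// => i _.
exact: mul0r.
Qed.
Let mul1r' : right_id bar_one bar_mul.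
Proof.
move=> f; apply/funext => s; elim: s f => [|a s IHs] f.
  by rewrite mul_nil mulr1.
by rewrite mul_cons mulr0 add0r IHs.
Qed.
HB.instance Definition _ := GRing.Zmodule_isPzRing.Build bar
  mulA mul1l mul1r' mulDl mulDr.

Definition shift a f : bar := fun s => f (a :: s).

Lemma barD f g s : (f + g) s = f s + g s. Proof. by []. Qed.
Lemma barN f s : (- f) s = - f s. Proof. by []. Qed.
Lemma barB f g s : (f - g) s = f s - g s. Proof. by []. Qed.
Lemma bar_sum I (r : seq I) (P : pred I) (f : I -> bar) s :
  (\sum_(i <- r | P i) f i) s = \sum_(i <- r | P i) f i s.
Proof. by elim/big_rec2: _ => // i x y _ <-. Qed.
Lemma barM f g s :
  (f * g) s = \sum_(i < (size s).+1) f (take i s) * g (drop i s).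
Proof. by []. Qed.
Lemma barM_nil f g : (f * g) [::] = f [::] * g [::].
Proof. exact: mul_nil. Qed.
Lemma barM_cons f g a s : (f * g) (a :: s) =
  f [::] * g (a :: s) + (shift a f * g) s.
Proof. exact: mul_cons. Qed.

Definition bar_const (c : S) : bar := fun s => if s is [::] then c else 0.
Definition bar_form (h : A -> S) : bar := fun s => if s is [:: x] then h x else 0.

Lemma bar_const_is_zmod_morphism : zmod_morphism bar_const.
Proof. by move=> x y; apply/funext => -[|a s]; rewrite barB//= subr0. Qed.
Lemma bar_const_is_monoid_morphism : monoid_morphism bar_const.
Proof.
split=> // x y; apply/funext => -[|a s]; first by rewrite barM_nil.
rewrite barM_cons /= mulr0 add0r barM big1// => i _; exact: mul0r.
Qed.
HB.instance Definition _ :=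
  GRing.isZmodMorphism.Build S bar bar_const bar_const_is_zmod_morphism.
HB.instance Definition _ :=
  GRing.isMonoidMorphism.Build S bar bar_const bar_const_is_monoid_morphism.

Lemma bar_constM c f s : (bar_const c * f) s = c * f s.
Proof.
case: s => [|a s]; first by rewrite barM_nil.
by rewrite barM_cons /= barM big1 ?addr0// => i _; exact: mul0r.
Qed.

Definition flip f : bar := fun s => (-1) ^+ size s * f s.

Lemma flip_is_zmod_morphism : zmod_morphism flip.
Proof. by move=> f g; apply/funext => s; rewrite barB /flip mulrBr. Qed.
Lemma flip_is_monoid_morphism : monoid_morphism flip.
Proof.
split=> [|f g]; apply/funext => s.
  by case: s => [|a s]; rewrite /flip ?mulr0// mul1r.
rewrite /flip !barM mulr_sumr; apply: eq_bigr => -[i /= isz] _.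
rewrite -[s in size s](cat_take_drop i) size_cat exprD -!mulrA; congr (_ * _).
by rewrite !mulrA -commr_sign.
Qed.
HB.instance Definition _ :=
  GRing.isZmodMorphism.Build bar bar flip flip_is_zmod_morphism.
HB.instance Definition _ :=
  GRing.isMonoidMorphism.Build bar bar flip flip_is_monoid_morphism.

Lemma flipK : involutive flip.
Proof. by move=> f; apply/funext => s; exact: signrMK. Qed.
Lemma flip_const c : flip (bar_const c) = bar_const c.
Proof. by apply/funext => -[|a s]; rewrite /flip ?mulr0// mul1r. Qed.
Lemma flip_form (h : A -> S) : flip (bar_form h) = - bar_form h.
Proof.
by apply/funext => -[|a [|b s]]; rewrite barN /flip /= ?mulr0 ?oppr0// mulN1r.
Qed.

End BarRing.

Arguments flip {A S} f.
Arguments bar_const {A S} c.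
Arguments bar_form {A S} h.

Section BarDifferential.
Context (A : pzRingType) (S : pzRingType).
Local Notation bar := (bar A S).
Implicit Types (f g h : bar) (s : seq A).

Fixpoint merge_seq (i : nat) (s : seq A) : seq A :=
  match i, s with
  | 0, x :: y :: t => x * y :: t
  | i.+1, x :: t => x :: merge_seq i t
  | _, _ => s
  end.

Definition bar_diff (V : pzRingType) (f : seq A -> V) (s : seq A) : V :=
  \sum_(i < (size s).-1) (-1) ^+ i * f (merge_seq i s).

Definition bar_d f : bar := bar_diff f.

Lemma bar_diff_cons2 (V : pzRingType) (f : seq A -> V) a b s :
  bar_diff f (a :: b :: s) =
  f (a * b :: s) - bar_diff (fun t => f (a :: t)) (b :: s).
Proof.
rewrite /bar_diff big_ord_recl /= expr0 mul1r; congr (_ + _).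
rewrite -sumrN; apply: eq_bigr => i _.
by rewrite exprS mulN1r mulNr.
Qed.
Lemma bar_diff_nil (V : pzRingType) (f : seq A -> V) : bar_diff f [::] = 0.
Proof. exact: big_ord0. Qed.
Lemma bar_diff1 (V : pzRingType) (f : seq A -> V) a : bar_diff f [:: a] = 0.
Proof. exact: big_ord0. Qed.

Lemma bar_d_is_zmod_morphism : zmod_morphism bar_d.
Proof.
move=> f g; apply/funext => s; rewrite barB /bar_d /bar_diff -sumrB.
by apply: eq_bigr => i _; rewrite barB mulrBr.
Qed.
HB.instance Definition _ :=
  GRing.isZmodMorphism.Build bar bar bar_d bar_d_is_zmod_morphism.

Lemma bar_dD : {morph bar_d : f g / f + g}. Proof. exact: raddfD. Qed.

Lemma bar_d_const c : bar_d (bar_const c) = 0.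
Proof.
apply/funext => -[|a [|b s]]; rewrite /bar_d ?bar_diff_nil ?bar_diff1//.
by rewrite /bar_diff big1// => -[[|i] lt_i] _; rewrite mulr0.
Qed.

Lemma bar_dM f g : bar_d (f * g) = bar_d f * g + flip f * bar_d g.
Proof.
apply/funext => s; rewrite barD.
elim: s f g => [|a [|b s] IHs] f g.
- by rewrite !barM_nil /bar_d !bar_diff_nil mulr0 mul0r addr0.
- rewrite !barM_cons !barM_nil /shift /bar_d !bar_diff_nil !bar_diff1.
  by rewrite !(mulr0, mul0r, addr0).
rewrite {1}/bar_d bar_diff_cons2 [(f * g) _]barM_cons [(bar_d f * g) _]barM_cons.
rewrite [(flip f * _) _]barM_cons.
rewrite [bar_d f [::]]bar_diff_nil mul0r add0r.
rewrite [bar_d g _]bar_diff_cons2.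
set fa := shift a f; set ga := shift a g.
have E1 : shift a (f * g) = bar_const (f [::]) * ga + fa * g.
  by apply/funext => t; rewrite [LHS]barM_cons barD bar_constM.
have -> : shift a (bar_d f) =
    ((fun t => if t is c :: u then f (a * c :: u) else 0) : bar) - bar_d fa.
  apply/funext => -[|c u]; rewrite barB /bar_d.
    by rewrite /shift bar_diff1 bar_diff_nil subr0.
  by rewrite /shift bar_diff_cons2.
have -> : shift a (flip f) = - flip fa.
  by apply/funext => t; rewrite barN /flip /shift /= exprS mulN1r mulNr.
rewrite -[bar_diff _ _]/(bar_d (shift a (f * g)) (b :: s)) E1.
rewrite bar_dD barD !IHs bar_d_const flip_const mul0r add0r bar_constM.
rewrite mulrBl mulNr !barB barN [X in _ = X - _ + _]barM_cons mul0r add0r.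
rewrite [flip f [::]]mul1r mulrBr -[shift b _]/(shift (a * b) f).
by rewrite !opprD !addrA [LHS](ACl (2*4*1*3*5)).
Qed.

End BarDifferential.

Section CyclicSum.
Context (A V : pzRingType).
Implicit Types (phi : seq A -> V) (s : seq A).

Lemma eq_sign n p : odd n = odd p -> (-1) ^+ n = (-1) ^+ p :> V.
Proof. by move=> e; rewrite -signr_odd e signr_odd. Qed.

Definition cyc phi s : V :=
  \sum_(0 <= k < size s) (-1) ^+ (k * (size s).-1) * phi (rot k s).

Lemma cyc_rot phi i s : (i <= size s)%N ->
  cyc phi (rot i s) = (-1) ^+ (i * (size s).-1) * cyc phi s.
Proof.
elim: i => [|i IHi] lt_i; first by rewrite rot0 mul1r.
have step t : cyc phi (rot 1 t) = (-1) ^+ (size t).-1 * cyc phi t.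
  case: (posnP (size t)) => [/size0nil-> //|t_gt0]; first by rewrite /cyc big_geq// mulr0.
  rewrite /cyc size_rot -[in RHS](prednK t_gt0) big_nat_recl// rot0 mul0n mul1r.
  rewrite -[in LHS](prednK t_gt0) big_nat_recr//= mulrDr addrC; congr (_ + _).
    congr (_ * _); first by apply: eq_sign; rewrite oddM andbb.
    by rewrite -rotD addn1 prednK// rot_size.
  rewrite mulr_sumr; apply: eq_big_nat => k /andP[_ lt_k].
  rewrite mulrA -exprD; congr (_ * _).
    by apply: eq_sign; rewrite oddD !oddM /= addbC; do 2!case: (odd _).
  by rewrite -rotD ?addn1// -(prednK t_gt0) ltnS ltnW.
rewrite rotS// step size_rot IHi ?(ltnW lt_i)//.
by rewrite mulrA -exprD mulSn.
Qed.

Lemma cyc_shift phi i s : (i <= size s)%N ->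
  cyc (fun t => phi (rot i t)) s = (-1) ^+ (i * (size s).-1) * cyc phi s.
Proof.
move=> le_i; rewrite -cyc_rot//; apply/esym; rewrite /cyc size_rot.
by apply: eq_big_nat => k _; rewrite rot_rot.
Qed.

Lemma merge_cat_l i (u v : seq A) : (i.+1 < size u)%N ->
  merge_seq i (u ++ v) = merge_seq i u ++ v :> seq A.
Proof.
elim: i u => [|i IHi] [|x [|y u]]//= lt_i.
by rewrite -[y :: u ++ v]/((y :: u) ++ v) IHi.
Qed.
Lemma merge_cat_r i (u v : seq A) : merge_seq (size u + i) (u ++ v) = u ++ merge_seq i v :> seq A.
Proof. by elim: u => //= x u ->. Qed.
Lemma size_merge i s : (i.+1 < size s)%N -> size (merge_seq i s) = (size s).-1.
Proof.
elim: i s => [|i IHi] [|x [|y s]]//= lt_i.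
by rewrite IHi.
Qed.

Definition merge_ends s : seq A := merge_seq 0 (rotr 1 s).

Definition hoch phi s : V :=
  bar_diff phi s + (-1) ^+ (size s).-1 * phi (merge_ends s).

Lemma merge_rot_lt i (u v : seq A) : (i.+1 < size v)%N ->
  merge_seq i (rot (size u) (u ++ v)) =
  rot (size u) (merge_seq (size u + i) (u ++ v)).
Proof. by move=> lt_i; rewrite merge_cat_r !rot_size_cat merge_cat_l. Qed.

Lemma merge_rot_gt i (u v : seq A) : (i.+1 < size u)%N ->
  merge_seq (size v + i) (rot (size u) (u ++ v)) =
  rot (size u).-1 (merge_seq i (u ++ v)).
Proof.
move=> lt_i; rewrite rot_size_cat merge_cat_r merge_cat_l//.
by rewrite -(size_merge lt_i) rot_size_cat.
Qed.

Lemma merge_rot_eq (x : A) u v y :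
  merge_seq (size v) (rot (size u).+1 ((x :: u) ++ rcons v y)) =
  rot (size u).+1 (merge_ends ((x :: u) ++ rcons v y)).
Proof.
rewrite -{1}[(size u).+1]/(size (x :: u)) rot_size_cat /merge_ends -rcons_cat.
rewrite rotr1_rcons -[(size u).+1]/(size (y * x :: u)).
rewrite -[merge_seq 0 _]/((y * x :: u) ++ v) rot_size_cat.
by rewrite cat_rcons -[size v]addn0 merge_cat_r.
Qed.

Lemma size_merge_ends s : (1 < size s)%N -> size (merge_ends s) = (size s).-1.
Proof.
case/lastP: s => [|s y]; rewrite /merge_ends ?rotr1_rcons ?size_rcons//.
by case: s.
Qed.

Lemma cyc_diff phi s : (1 < size s)%N -> cyc (bar_diff phi) s = hoch (cyc phi) s.
Proof.
case def_n: (size s) => [//|q] q_gt0; rewrite ltnS in q_gt0.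
pose B k j := (-1) ^+ (j + k * q.+1) * phi (rot k (merge_seq j s)).
pose E k := (-1) ^+ (q + k * q.+1) * phi (rot k (merge_ends s)).
have hochE : hoch (cyc phi) s =
    \sum_(0 <= k < q) \sum_(0 <= j < q) B k j + \sum_(0 <= k < q) E k.
  rewrite /hoch def_n /= /bar_diff def_n /= exchange_big; congr (_ + _).
    rewrite -(big_mkord xpredT (fun j => (-1) ^+ j * cyc phi (merge_seq j s))).
    apply: eq_big_nat => j /andP[_ lt_j].
    rewrite /cyc size_merge ?def_n ?ltnS// mulr_sumr; apply: eq_big_nat => k _.
    rewrite /= mulrA -exprD; congr (_ * _); apply: eq_sign.
    rewrite !oddD !oddM /=; case: (q) q_gt0 => //= p _.
    by rewrite negbK.
  rewrite /cyc size_merge_ends def_n// mulr_sumr; apply: eq_big_nat => k _.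
  rewrite /= mulrA -exprD; congr (_ * _); apply: eq_sign.
  rewrite !oddD !oddM /=; case: (q) q_gt0 => //= p _.
  by rewrite negbK.
have rowE k : (k < q.+1)%N -> (-1) ^+ (k * q) * bar_diff phi (rot k s) =
    \sum_(k <= j < q) B k j +
    (if k is l.+1 then E k + \sum_(0 <= j < l) B l j else 0).
  move=> lt_k; rewrite /bar_diff size_rot def_n /= mulr_sumr.
  rewrite -(big_mkord xpredT (fun i => (-1) ^+ (k * q) *
    ((-1) ^+ i * phi (merge_seq i (rot k s))))).
  pose u := take k s; pose v := drop k s.
  have def_s : s = u ++ v by rewrite cat_take_drop.
  have sz_u : size u = k by rewrite size_takel// def_n ltnW.
  have sz_v : size v = (q - k).+1 by rewrite size_drop def_n subSn.
  rewrite (big_cat_nat (n := q - k)) ?leq_subr//=; congr (_ + _).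
    have := big_addn 0 q k xpredT (B k); rewrite add0n => ->; apply: eq_big_nat => i /andP[_ lt_i].
    rewrite mulrA -exprD /B; congr (_ * phi _).
      by apply: eq_sign; rewrite !oddD !oddM /=; do 3!case: (odd _).
    by rewrite addnC def_s -sz_u merge_rot_lt// sz_v ltnS.
  case: k => [|l] in lt_k u v def_s sz_u sz_v *; first by rewrite subn0 big_geq.
  rewrite big_ltn; last by rewrite ltn_subLR// addSn ltnS leq_addl.
  congr (_ + _).
    case: u v sz_u sz_v def_s => [//|x u] v [sz_u]; case/lastP: v => [//|v y].
    rewrite size_rcons => -[sz_v] def_s.
    rewrite mulrA -exprD /E; congr (_ * phi _).
      have eq_q : q = (size v + l.+1)%N by rewrite sz_v subnK.
      apply: eq_sign; rewrite -sz_v {1 2 3}eq_q !oddD !oddM /= !oddD /=.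
      by do 2!case: (odd _).
    by rewrite -sz_v def_s -sz_u merge_rot_eq.
  set F := BIG_F; have := big_addn 0 q (q - l.+1).+1 xpredT F.
  rewrite add0n => ->; rewrite {}/F.
  have -> : (q - (q - l.+1).+1 = l)%N by rewrite subnSK ?subKn// ltnW.
  apply: eq_big_nat => i /andP[_ lt_i].
  rewrite mulrA -exprD /B; congr (_ * phi _).
    have eq_q : q = (size v + l)%N by rewrite sz_v addSnnS subnK.
    apply: eq_sign; rewrite -sz_v eq_q !oddD !oddM /= !oddD /=.
    by do 3!case: (odd _).
  by rewrite addnC -sz_v def_s -{1}sz_u merge_rot_gt ?sz_u.
rewrite hochE /cyc def_n /=.
rewrite (eq_big_nat _ _ (F2 := fun k => \sum_(k <= j < q) B k j +
    (if k is l.+1 then E k + \sum_(0 <= j < l) B l j else 0))); last first.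
  by move=> k /andP[_]; exact: rowE.
rewrite big_split /= big_nat_recr//= [X in _ + X + _]big_geq// addr0.
rewrite [X in _ + X]big_nat_recl//= add0r big_split /= addrCA addrC.
rewrite -big_split /=; congr (_ + _).
  apply: eq_big_nat => k /andP[_ lt_k].
  by rewrite addrC -(big_cat_nat (n := k))//= ltnW.
case: q q_gt0 def_n @E @B {hochE rowE} => // p _ def_n E B.
rewrite [RHS]big_nat_recl// [LHS]big_nat_recr//= addrC; congr (_ + _).
rewrite /E rot0 mul0n addn0 rot_oversize ?size_merge_ends ?def_n//.
by congr (_ * _); apply: eq_sign; rewrite !oddD !oddM /=; do 2!case: (odd _).
Qed.

End CyclicSum.

Record summable_trace (S V : pzRingType) (m : nat) := SummableTrace {
  ideal : bool -> nat -> S -> Prop;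
  idealB : forall p d x y, ideal p d x -> ideal p d y -> ideal p d (x - y);
  idealM : forall p q d e x y,
    ideal p d x -> ideal q e y -> ideal (p (+) q) (d + e) (x * y);
  ideal_le : forall p d e x, (d <= e)%N -> ideal p e x -> ideal p d x;
  ideal0 : forall p d, ideal p d 0;
  ideal1 : ideal false 0 1;
  functional : S -> V;
  functionalB : forall x y, ideal (~~ odd m) m x -> ideal (~~ odd m) m y ->
    functional (x - y) = functional x - functional y;
  functional_swap : forall p q d e x y, p (+) q = ~~ odd m -> (m <= d + e)%N ->
    ideal p d x -> ideal q e y ->
    functional (x * y) = (-1) ^+ (p && q) * functional (y * x)
}.

Section TraceTheory.
Context (S V : pzRingType) (m : nat) (t : summable_trace S V m).
Local Notation ideal := (ideal t).
Local Notation T := (functional t).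

Lemma idealN p d x : ideal p d x -> ideal p d (- x).
Proof. by move=> ix; rewrite -[- x]add0r; apply: idealB => //; exact: ideal0. Qed.
Lemma idealD p d x y : ideal p d x -> ideal p d y -> ideal p d (x + y).
Proof. by move=> ix iy; rewrite -[y]opprK; apply: idealB => //; exact: idealN. Qed.
Lemma ideal_sum p d I (r : seq I) (P : pred I) (F : I -> S) :
  (forall i, P i -> ideal p d (F i)) -> ideal p d (\sum_(i <- r | P i) F i).
Proof. by move=> iF; elim/big_ind: _ => //; [exact: ideal0|exact: idealD]. Qed.
Lemma ideal_sign p d n x : ideal p d x -> ideal p d ((-1) ^+ n * x).
Proof.
by move=> ix; rewrite -signr_odd mulr_sign; case: odd => //; exact: idealN.
Qed.

Local Notation tc := (ideal (~~ odd m) m).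

Lemma functional0 : T 0 = 0.
Proof. by rewrite -(subrr 0) functionalB ?subrr//; exact: ideal0. Qed.
Lemma functionalN x : tc x -> T (- x) = - T x.
Proof.
move=> tx; rewrite -[- x]add0r functionalB ?functional0 ?add0r//.
exact: ideal0.
Qed.
Lemma functionalD x y : tc x -> tc y -> T (x + y) = T x + T y.
Proof.
move=> tx ty; rewrite -{1}[y]opprK functionalB//; last exact: idealN.
by rewrite functionalN// opprK.
Qed.
Lemma functional_sum I (r : seq I) (P : pred I) (F : I -> S) :
  (forall i, P i -> tc (F i)) ->
  T (\sum_(i <- r | P i) F i) = \sum_(i <- r | P i) T (F i).
Proof.
move=> tF; elim: r => [|i r IHr]; first by rewrite !big_nil functional0.
rewrite !big_cons; case: ifP => // Pi; rewrite functionalD ?IHr//; first exact: tF.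
exact: ideal_sum.
Qed.
Lemma functional_sign n x : tc x -> T ((-1) ^+ n * x) = (-1) ^+ n * T x.
Proof.
move=> tx; rewrite -signr_odd -[in RHS]signr_odd !mulr_sign.
by case: odd => //; exact: functionalN.
Qed.

Context (A : pzRingType).
Local Notation bar := (bar A S).
Implicit Types (f g h : bar) (s : seq A).

Definition of_class (p : bool) (d : nat) f :=
  forall s, ideal (p (+) odd (size s)) (d - size s) (f s).

Lemma of_classB p d f g : of_class p d f -> of_class p d g -> of_class p d (f - g).
Proof. by move=> cf cg s; exact: idealB. Qed.
Lemma of_classN p d f : of_class p d f -> of_class p d (- f).
Proof. by move=> cf s; exact: idealN. Qed.
Lemma of_classD p d f g : of_class p d f -> of_class p d g -> of_class p d (f + g).
Proof. by move=> cf cg s; exact: idealD. Qed.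
Lemma of_class_sum p d I (r : seq I) (P : pred I) (F : I -> bar) :
  (forall i, P i -> of_class p d (F i)) -> of_class p d (\sum_(i <- r | P i) F i).
Proof.
move=> iF; elim/big_ind: _ => //; last exact: of_classD.
by move=> s; exact: ideal0.
Qed.
Lemma of_class_le p d e f : (d <= e)%N -> of_class p e f -> of_class p d f.
Proof. by move=> de cf s; apply: ideal_le (cf s); exact: leq_sub2r. Qed.
Lemma of_class_flip p d f : of_class p d f -> of_class p d (flip f).
Proof. by move=> cf s; exact: ideal_sign. Qed.
Lemma of_classM p q d e f g : of_class p d f -> of_class q e g ->
  of_class (p (+) q) (d + e) (f * g).
Proof.
move=> cf cg s; rewrite barM; apply: ideal_sum => -[i /= isz] _.
rewrite ltnS in isz; have := idealM (cf (take i s)) (cg (drop i s)).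
rewrite size_takel// size_drop => /ideal_le iM; have {iM}:= iM (d + e - size s)%N.
rewrite [_ (+) _ (+) _](_ : _ = p (+) q (+) odd (size s)); first apply.
  by clear -isz; lia.
rewrite -{2}(subnKC isz) oddD.
by case: p q {cf cg} => [] []; do 2!case: odd.
Qed.
Lemma of_class1 : of_class false 0 1.
Proof. by move=> [|a s]; [exact: ideal1|exact: ideal0]. Qed.
Lemma of_classX d f n : of_class false d f -> of_class false (n * d) (f ^+ n).
Proof.
move=> cf; elim: n => [|n IHn]; first exact: of_class1.
by rewrite exprS mulSn; exact: (@of_classM false false).
Qed.
Lemma of_class_const p d c : ideal p d c -> of_class p d (bar_const c).
Proof.
move=> ic [|a s]; last exact: ideal0.
by rewrite addbF subn0.
Qed.
Lemma of_class_form p d (h : A -> S) : (forall x, ideal p d (h x)) ->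
  of_class (~~ p) d.+1 (bar_form h).
Proof.
move=> ih [|a [|b s]]; [exact: ideal0| |exact: ideal0].
by rewrite /= subSS subn0 addNb addbT negbK.
Qed.

Definition tr f s : V := cyc (fun u => T (f u)) s.

Definition summable_at n f := forall s, size s = n -> tc (f s).

Lemma of_class_summable p d n f : of_class p d f -> p (+) odd n = ~~ odd m ->
  (m + n <= d)%N -> summable_at n f.
Proof.
move=> cf pn mn s sz; rewrite -pn -sz; apply: ideal_le (cf s).
by rewrite sz; clear -mn; lia.
Qed.

Lemma eq_cyc (phi psi : seq A -> V) s :
  (forall u, size u = size s -> phi u = psi u) -> cyc phi s = cyc psi s.
Proof.
by move=> e; apply: eq_big_nat => k _; rewrite e// size_rot.
Qed.

Lemma trB f g s : summable_at (size s) f -> summable_at (size s) g ->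
  tr (f - g) s = tr f s - tr g s.
Proof.
move=> tf tg; rewrite /tr /cyc -sumrB; apply: eq_bigr => k _.
by rewrite -mulrBr barB functionalB//; [apply: tf|apply: tg]; rewrite size_rot.
Qed.
Lemma tr0 s : tr 0 s = 0.
Proof. by rewrite /tr /cyc big1// => k _; rewrite functional0 mulr0. Qed.
Lemma summable0 n : summable_at n 0. Proof. by move=> s _; exact: ideal0. Qed.
Lemma trN f s : summable_at (size s) f -> tr (- f) s = - tr f s.
Proof. by move=> tf; rewrite -[- f]add0r trB// ?tr0 ?add0r//; exact: summable0. Qed.
Lemma summableN n f : summable_at n f -> summable_at n (- f).
Proof. by move=> tf s sz; apply: idealN; exact: tf. Qed.
Lemma summableD n f g : summable_at n f -> summable_at n g -> summable_at n (f + g).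
Proof. by move=> tf tg s sz; apply: idealD; [exact: tf|exact: tg]. Qed.
Lemma summableB n f g : summable_at n f -> summable_at n g -> summable_at n (f - g).
Proof. by move=> tf tg s sz; apply: idealB; [exact: tf|exact: tg]. Qed.
Lemma trD f g s : summable_at (size s) f -> summable_at (size s) g ->
  tr (f + g) s = tr f s + tr g s.
Proof.
move=> tf tg; rewrite -{1}[g]opprK trB//; last exact: summableN.
by rewrite trN// opprK.
Qed.
Lemma summable_sum n I (r : seq I) (P : pred I) (F : I -> bar) :
  (forall i, P i -> summable_at n (F i)) -> summable_at n (\sum_(i <- r | P i) F i).
Proof. by move=> tF; elim/big_ind: _ => //; [exact: summable0|exact: summableD]. Qed.
Lemma tr_sum I (r : seq I) (P : pred I) (F : I -> bar) s :
  (forall i, P i -> summable_at (size s) (F i)) ->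
  tr (\sum_(i <- r | P i) F i) s = \sum_(i <- r | P i) tr (F i) s.
Proof.
move=> tF; elim: r => [|i r IHr]; first by rewrite !big_nil tr0.
rewrite !big_cons; case: ifP => // Pi; rewrite trD ?IHr//; first exact: tF.
exact: summable_sum.
Qed.

Lemma cyc_sign n (phi : seq A -> V) s :
  cyc (fun u => (-1) ^+ n * phi u) s = (-1) ^+ n * cyc phi s.
Proof.
rewrite /cyc mulr_sumr; apply: eq_bigr => k _.
by rewrite mulrA commr_sign mulrA.
Qed.

Lemma iter_flipE (b : bool) g s : iter b flip g s = (-1) ^+ (b && odd (size s)) * g s.
Proof. by case: b => //=; [rewrite signr_odd|rewrite mul1r]. Qed.

Lemma tr_swap p d q e f g s : of_class p d f -> of_class q e g ->
  p (+) q (+) odd (size s) = ~~ odd m -> (m + size s <= d + e)%N ->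
  tr (f * g) s = (-1) ^+ (p && q) *
    tr (iter p flip g * iter q flip f) s.
Proof.
move=> cf cg par deg; set n := size s.
have summand p' d' q' e' f' g' u i : of_class p' d' f' -> of_class q' e' g' ->
    p' (+) q' = p (+) q -> (d' + e' = d + e)%N -> size u = n -> (i <= n)%N ->
    tc (f' (take i u) * g' (drop i u)).
  move=> cf' cg' e1 e2 sz le_i.
  have := idealM (cf' (take i u)) (cg' (drop i u)).
  rewrite size_takel ?sz// size_drop sz => iM.
  have -> : ~~ odd m = p' (+) odd i (+) (q' (+) odd (n - i)).
    rewrite -par -e1 -/n -(subnKC le_i) oddD subnKC//.
    by case: p' q' {cf' cg' e1 iM} => [] []; do 2!case: odd.
  by apply: ideal_le iM; clear -deg e2 le_i; lia.
have trM p' d' q' e' f' g' : of_class p' d' f' -> of_class q' e' g' ->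
    p' (+) q' = p (+) q -> (d' + e' = d + e)%N ->
    tr (f' * g') s =
    \sum_(i < n.+1) cyc (fun u => T (f' (take i u) * g' (drop i u))) s.
  move=> cf' cg' e1 e2; rewrite /tr /cyc exchange_big; apply: eq_bigr => k _.
  rewrite -mulr_sumr barM size_rot functional_sum// => -[i /= lt_i] _.
  by apply: (summand p' d' q' e'); rewrite ?size_rot.
rewrite (trM p d q e)// (trM q e p d) 1?addbC 1?addnC//; first last.
- by case: q {par summand trM} cg => //= cg; exact: of_class_flip.
- by case: p {par summand trM} cf => //= cf; exact: of_class_flip.
rewrite [X in _ = _ * X](reindex_inj rev_ord_inj) /= mulr_sumr.
apply: eq_bigr => -[i /= le_i] _; rewrite ltnS in le_i; rewrite subSS.
set phi := fun u => _; set psi := fun u => _.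
have phiE u : size u = size s ->
    phi u = (-1) ^+ ((p && q) (+) odd (i * n.-1)) * psi (rot i u).
  move=> sz_u; have le_iu : (i <= size u)%N by rewrite sz_u.
  rewrite /phi /psi /rot take_size_cat ?drop_size_cat ?size_drop ?sz_u//.
  rewrite !iter_flipE size_drop size_takel// sz_u -/n.
  have cfi := cf (take i u); have cgi := cg (drop i u).
  rewrite size_takel// in cfi; rewrite size_drop sz_u -/n in cgi.
  have parE : p (+) odd i (+) (q (+) odd (n - i)) = ~~ odd m.
    rewrite -par -/n -(subnKC le_i) oddD subnKC//.
    by case: (p) (q) => [] []; do 2!case: odd.
  have degE : (m <= d - i + (e - (n - i)))%N by clear -deg le_i; lia.
  have par' : q (+) odd (n - i) (+) (p (+) odd i) = ~~ odd m by rewrite addbC.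
  have degE' : (m <= e - (n - i) + (d - i))%N by rewrite addnC.
  rewrite mulr_signM.
  have tgf : tc (g (drop i u) * f (take i u)).
    by have := idealM cgi cfi; rewrite par'; exact: ideal_le.
  rewrite functional_sign// (functional_swap parE degE)// !mulrA -!signr_addb.
  congr (_ ^+ _ * _).
  have -> : odd (i * n.-1) = odd i && odd (n - i).
    rewrite oddM; case: (i) le_i => //= j lt_j.
    by rewrite -subn1 oddB ?(leq_trans _ lt_j)// oddB//=; do 2!case: odd.
  by clear; case: (p) (q) => [] []; do 2!case: odd.
by rewrite (eq_cyc phiE) cyc_sign cyc_shift// -[(-1) ^+ (i * _)]signr_odd mulrA -signr_addb addbK.
Qed.

Lemma tr_d f s : summable_at (size s).-1 f -> (1 < size s)%N ->
  tr (bar_d f) s = hoch (tr f) s.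
Proof.
move=> tf s_gt1; rewrite /tr -cyc_diff//; apply: eq_cyc => u sz_u.
have tF (i : 'I_(size u).-1) : tc (f (merge_seq i u)).
  by apply: tf; rewrite size_merge ?sz_u// -ltn_predRL.
rewrite /bar_d /bar_diff functional_sum => [|i _]; last exact: ideal_sign.
by apply: eq_bigr => i _; rewrite functional_sign.
Qed.

Lemma tr_d1 f x : tr (bar_d f) [:: x] = 0.
Proof. by rewrite /tr /cyc big_nat1 rot0 /bar_d bar_diff1 functional0 mulr0. Qed.

End TraceTheory.

Section NoncommutativeRing.
Context (R : pzRingType).
#[global] Instance pzRing_ops : @Ring_ops R 0 1 +%R *%R (fun x y => x - y) -%R eq := {}.
#[global] Instance pzRing_Ring :
  @Ring R 0 1 +%R *%R (fun x y => x - y) -%R eq pzRing_ops.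
Proof.
split; try typeclasses eauto.
- exact: (@add0r R).
- exact: (@addrC R).
- exact: (@addrA R).
- exact: (@mul1r R).
- exact: (@mulr1 R).
- exact: (@mulrA R).
- exact: (@mulrDl R).
- by move=> x y z; exact: (@mulrDr R).
- by [].
- exact: (@subrr R).
Qed.
End NoncommutativeRing.

Lemma bianchi_identity (R : pzRingType) (F th u : R) :
  F * u = u * F -> th * u = u * th ->
  u * (F * (th * th) - th * th * F) =
  (F + u * th) * (F * F - 1 + u * (F * th - th * F) + (u - u * u) * (th * th))
  - (F * F - 1 - u * (F * th - th * F) + (u - u * u) * (th * th)) * (F + u * th).
Proof.
move=> Fu thu.
have Fu' x : x * F * u = x * u * F by rewrite -!mulrA Fu.
have thu' x : x * th * u = x * u * th by rewrite -!mulrA thu.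
rewrite !(mulrDl, mulrDr, mulrBl, mulrBr, mulrN, mulNr, mulrA, mul1r, mulr1).
rewrite !(Fu, thu, Fu', thu').
by non_commutative_ring.
Qed.

Section Connection.
Context (A S : pzRingType) (lam : bar A S).
Local Notation bar := (bar A S).
Implicit Types f g k X : bar.

Lemma bar_d_flip f : bar_d (flip f) = - flip (bar_d f).
Proof.
apply/funext => -[|a s]; first by rewrite barN /bar_d /flip !bar_diff_nil mulr0 oppr0.
rewrite barN /flip /bar_d /bar_diff /= mulr_sumr -sumrN; apply: eq_bigr => i _.
rewrite size_merge ?ltnS//= exprS mulN1r mulNr opprK !mulrA.
by congr (_ * _); exact: commr_sign.
Qed.

Definition rel_d f : bar := bar_d f - (lam * f - flip f * lam).

Lemma rel_d_is_zmod_morphism : zmod_morphism rel_d.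
Proof. by move=> f g; rewrite /rel_d !raddfB /=; non_commutative_ring. Qed.
HB.instance Definition _ :=
  GRing.isZmodMorphism.Build bar bar rel_d rel_d_is_zmod_morphism.

Lemma rel_dB f g : rel_d (f - g) = rel_d f - rel_d g.
Proof. exact: raddfB. Qed.

Hypothesis lam_flip : flip lam = - lam.

Lemma rel_dM f g : rel_d (f * g) = rel_d f * g + flip f * rel_d g.
Proof. by rewrite /rel_d bar_dM rmorphM /=; non_commutative_ring. Qed.

Lemma rel_d_flip f : rel_d (flip f) = - flip (rel_d f).
Proof.
rewrite /rel_d bar_d_flip !rmorphB !rmorphM /= lam_flip flipK.
by non_commutative_ring.
Qed.

Definition covariantly_constant X k := rel_d k = X * k - flip k * X.
Definition nabla X f := - rel_d f - flip X * f - flip f * X.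

Lemma covariantly_constantX X k n :
  covariantly_constant X k -> covariantly_constant X (k ^+ n).
Proof.
move=> kX; elim: n => [|n IHn].
  have d1 : bar_d (1 : bar) = 0 := bar_d_const A 1.
  by rewrite /covariantly_constant /rel_d expr0 d1 rmorph1; non_commutative_ring.
rewrite /covariantly_constant exprS rel_dM kX IHn !rmorphM /=.
by non_commutative_ring.
Qed.

Lemma nablaMr X f k : covariantly_constant X k -> nabla X (f * k) = nabla X f * k.
Proof.
by move=> kX; rewrite /nabla rel_dM kX !rmorphM /=; non_commutative_ring.
Qed.

Lemma rel_d_nabla X f g :
  rel_d (flip f * g) - (X * (flip f * g) - flip (flip f * g) * X) =
  flip (nabla X f) * g - f * nabla X g.
Proof.
rewrite /nabla rel_dM rel_d_flip; move: (rel_d f) => df.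
rewrite !rmorphM !rmorphB !rmorphN !rmorphM /= !flipK.
by non_commutative_ring.
Qed.

End Connection.


Section Forms.
Context (A S : pzRingType).
Local Notation bar := (bar A S).
Implicit Types (f g : bar) (h k : A -> S).

Lemma bar_formM h g s :
  (bar_form h * g) s = if s is a :: u then h a * g u else 0.
Proof.
case: s => [|a s]; first by rewrite barM_nil mul0r.
by rewrite barM_cons mul0r add0r -bar_constM.
Qed.
Lemma bar_const_form c h : bar_const c * bar_form h = bar_form (fun x => c * h x).
Proof. by apply/funext => -[|a [|b s]]; rewrite bar_constM /= ?mulr0. Qed.
Lemma bar_form_const h c : bar_form h * bar_const c = bar_form (fun x => h x * c).
Proof. by apply/funext => -[|a [|b s]]; rewrite bar_formM /= ?mulr0. Qed.
Lemma eq_bar_form h k : h =1 k -> bar_form h = bar_form k.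
Proof. by move=> /funext ->. Qed.

Lemma bar_form0 : bar_form (fun=> 0) = 0 :> bar.
Proof. by apply/funext => -[|a [|b s]]. Qed.

Lemma bar_d_form h l : (forall x y, h (x * y) = h x * h y + l x * h y + h x * l y) ->
  bar_d (bar_form h) = bar_form h * bar_form h + bar_form l * bar_form h
    + bar_form h * bar_form l.
Proof.
move=> hM; apply/funext => s; rewrite !barD !bar_formM.
case: s => [|x [|y [|z s]]]; rewrite /= ?mulr0 ?addr0//.
- by rewrite /bar_d bar_diff_nil.
- by rewrite /bar_d bar_diff1.
- by rewrite /bar_d bar_diff_cons2 bar_diff1 subr0 /= hM.
by rewrite /bar_d /bar_diff big1// => -[[|[|i]] lt_i] _; rewrite /= mulr0.
Qed.
End Forms.

Section ClassDifferential.
Context (S V : pzRingType) (m : nat) (t : summable_trace S V m) (A : pzRingType).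

Lemma of_class_d p d (f : bar A S) :
  of_class t p d f -> of_class t (~~ p) d.+1 (bar_d f).
Proof.
move=> cf [|x s]; first by rewrite /bar_d bar_diff_nil; exact: ideal0.
apply: ideal_sum => -[i /= lt_i] _; apply: ideal_sign.
have := cf (merge_seq i (x :: s)); rewrite size_merge//=.
by rewrite subSS addNb addbN negbK.
Qed.

Lemma of_class_commutator (lam f : bar A S) p d :
  of_class t true 1 lam -> of_class t p d f ->
  of_class t (~~ p) d.+1 (lam * f - flip f * lam).
Proof.
move=> cl cf; apply: of_classB; first exact: (of_classM cl cf).
by rewrite -addn1 -addbT; apply: of_classM => //; exact: of_class_flip.
Qed.

Lemma tr_commutator (X f : bar A S) d e s :
  of_class t true d X -> of_class t false e f ->
  odd (size s) = odd m -> (m + size s <= d + e)%N ->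
  tr t (X * f - flip f * X) s = 0.
Proof.
move=> cX cf par deg; have nn : true (+) odd (size s) = ~~ odd m by rewrite par.
rewrite trB.
- by rewrite (tr_swap cX cf)// mul1r subrr.
- by apply: of_class_summable (of_classM cX cf) _ _; rewrite ?addbF.
apply: of_class_summable (of_classM (of_class_flip cf) cX) _ _ => //.
by rewrite addnC [(e + d)%N]addnC in deg *.
Qed.

Lemma tr_rel_d (lam f : bar A S) d s :
  of_class t true 1 lam -> of_class t false d f ->
  odd (size s) = odd m -> (m + size s <= d.+1)%N ->
  tr t (rel_d lam f) s = tr t (bar_d f) s.
Proof.
move=> cl cf par deg; have nn : true (+) odd (size s) = ~~ odd m by rewrite par.
rewrite /rel_d trB ?(tr_commutator cl cf)// ?subr0//.
  exact: of_class_summable (of_class_d cf) _ _.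
exact: of_class_summable (of_class_commutator cl cf) _ _.
Qed.
End ClassDifferential.

Section CurvatureHomotopy.
Context (S V : pzRingType) (m : nat) (t : summable_trace S V m) (A : pzRingType).
Context (h l : A -> S) (D F u : S).
Hypothesis m_gt0 : (0 < m)%N.
Hypothesis hM : forall x y, h (x * y) = h x * h y + l x * h y + h x * l y.
Hypothesis h_ideal : forall x, ideal t false 0 (h x).
Hypothesis l_ideal : forall x, ideal t false 0 (l x).
Hypothesis l_central : forall x c, l x * c = c * l x.
Hypothesis uC : forall c, u * c = c * u.
Hypothesis u_ideal : ideal t false 0 u.
Hypothesis F_ideal : ideal t true 0 F.
Hypothesis D_ideal : ideal t true 1 D.
Hypothesis Fh_ideal : forall x, ideal t true 1 (F * h x - h x * F).
Hypothesis FF_ideal : ideal t false 2 (F * F - 1).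

Local Notation bar := (bar A S).
Let theta : bar := bar_form h.
Let lam : bar := bar_form l.
Let cF : bar := bar_const F.
Let cD : bar := bar_const D.
Let cu : bar := bar_const u.
Let omega : bar := cF * theta - theta * cF.
Let omega_t : bar := cD * theta - theta * cD.
Let N : bar := cF * cF - 1.

Definition curvature : bar := N + cu * omega + (cu - cu * cu) * (theta * theta).
Local Notation K := curvature.
Definition curvature_t : bar := cF * cD + cD * cF + cu * omega_t.
Definition curvature_u : bar := omega + (1 - cu - cu) * (theta * theta).
Let X : bar := cF + cu * theta.

Lemma curvatureE : curvature = bar_const F * bar_const F - 1
  + bar_const u * (bar_const F * bar_form h - bar_form h * bar_const F)
  + (bar_const u - bar_const u * bar_const u) * (bar_form h * bar_form h).
Proof. by []. Qed.
Lemma curvature_tE : curvature_t = bar_const F * bar_const D + bar_const D * bar_const F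
  + bar_const u * (bar_const D * bar_form h - bar_form h * bar_const D).
Proof. by []. Qed.
Lemma curvature_uE : curvature_u =
  (bar_const F * bar_form h - bar_form h * bar_const F)
  + (1 - bar_const u - bar_const u) * (bar_form h * bar_form h).
Proof. by []. Qed.

Let lam_flip : flip lam = - lam. Proof. exact: flip_form. Qed.
Let theta_flip : flip theta = - theta. Proof. exact: flip_form. Qed.
Let F_flip : flip cF = cF. Proof. exact: flip_const. Qed.
Let D_flip : flip cD = cD. Proof. exact: flip_const. Qed.
Let u_flip : flip cu = cu. Proof. exact: flip_const. Qed.
Let rel_const c : rel_d lam (bar_const c) = 0.
Proof.
rewrite /rel_d bar_d_const flip_const bar_form_const bar_const_form.
by rewrite (eq_bar_form (fun x => l_central x c)) subrr subr0.
Qed.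
Let rel_theta : rel_d lam theta = theta * theta.
Proof.
rewrite /rel_d (bar_d_form hM) -/theta -/lam theta_flip.
by non_commutative_ring.
Qed.
Let relB f g : rel_d lam (f - g) = rel_d lam f - rel_d lam g.
Proof. rewrite /rel_d !raddfB /=; non_commutative_ring. Qed.
Let relN f : rel_d lam (- f) = - rel_d lam f.
Proof. rewrite /rel_d !raddfN /=; non_commutative_ring. Qed.
Let relD f g : rel_d lam (f + g) = rel_d lam f + rel_d lam g.
Proof. rewrite /rel_d !raddfD /=; non_commutative_ring. Qed.
Let cuC c : cu * c = c * cu.
Proof.
apply/funext => s; rewrite bar_constM barM big_ord_recr /=.
rewrite drop_size take_size uC big1 ?add0r// => i _.
case E: (drop i s) => [|y v]; last by rewrite mulr0.
have := congr1 size E; rewrite size_drop /= => /eqP; rewrite subn_eq0.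
by rewrite leqNgt ltn_ord.
Qed.

Let cuE f : (f * cu = cu * f) * (forall g, g * f * cu = g * cu * f).
Proof. by split=> [|g]; rewrite ?cuC// -!mulrA cuC. Qed.

Let bianchi : covariantly_constant lam X K.
Proof.
have d_theta2 : rel_d lam (theta * theta) = 0.
  by rewrite rel_dM// rel_theta theta_flip mulNr mulrA subrr.
have d_omega : rel_d lam omega = cF * (theta * theta) - theta * theta * cF.
  rewrite /omega relB !rel_dM// !rel_const rel_theta F_flip.
  by rewrite mul0r mulr0 add0r addr0.
have d_K : rel_d lam K = cu * (cF * (theta * theta) - theta * theta * cF).
  rewrite /K /N !relD [rel_d lam (cu * omega)]rel_dM//.
  rewrite [rel_d lam (_ * (theta * theta))]rel_dM// d_theta2 d_omega.
  rewrite relN (rel_const 1 : rel_d lam 1 = 0) [rel_d lam (cF * cF)]rel_dM//.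
  have -> : cu - cu * cu = bar_const (u - u * u) by rewrite rmorphB rmorphM.
  by rewrite !rel_const u_flip; non_commutative_ring.
rewrite /covariantly_constant d_K bianchi_identity -?cuC//; congr (_ - _ * _).
rewrite /K /N /omega !(rmorphD, rmorphB, rmorphM, rmorphN, rmorph1) /= u_flip F_flip.
by rewrite theta_flip; non_commutative_ring.
Qed.

Let nabla_D : nabla lam X cD = - curvature_t.
Proof.
rewrite /nabla rel_const /curvature_t /X /omega_t.
rewrite !(rmorphD, rmorphM) /= u_flip F_flip D_flip theta_flip.
rewrite !(mulrDl, mulrDr, mulrBl, mulrBr, mulrN, mulNr, mulrA).
rewrite !(cuE cD).
non_commutative_ring.
Qed.

Let nabla_theta : nabla lam X theta = - curvature_u.
Proof.
rewrite /nabla rel_theta /curvature_u /X /omega.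
rewrite !(rmorphD, rmorphM) /= u_flip F_flip theta_flip.
rewrite !(mulrDl, mulrDr, mulrBl, mulrBr, mulrN, mulNr, mulrA, mul1r).
rewrite !(cuE theta).
non_commutative_ring.
Qed.

Definition curvature_transgression : bar :=
  \sum_(i < m) flip (theta * K ^+ i) * (cD * K ^+ (m.-1 - i)).

Hypothesis Dh_ideal : forall x, ideal t true 1 (D * h x - h x * D).
Hypothesis FD_ideal : ideal t false 1 (F * D + D * F).

Let theta_class : of_class t true 1 theta.
Proof. exact: (of_class_form (p := false)). Qed.
Let lam_class : of_class t true 1 lam.
Proof. exact: (of_class_form (p := false)). Qed.
Let D_class : of_class t true 1 cD. Proof. exact: of_class_const. Qed.
Let F_class : of_class t true 0 cF. Proof. exact: of_class_const. Qed.
Let u_class : of_class t false 0 cu. Proof. exact: of_class_const. Qed.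
Let omega_class : of_class t false 2 omega.
Proof.
rewrite /omega bar_const_form bar_form_const (_ : _ - _ = bar_form (fun x => F * h x - h x * F)).
  exact: (of_class_form (p := true)).
by apply/funext => -[|a [|b s]]; rewrite barB /= ?subrr.
Qed.
Let omega_t_class : of_class t false 2 omega_t.
Proof.
rewrite /omega_t bar_const_form bar_form_const (_ : _ - _ = bar_form (fun x => D * h x - h x * D)).
  exact: (of_class_form (p := true)).
by apply/funext => -[|a [|b s]]; rewrite barB /= ?subrr.
Qed.
Let theta2_class : of_class t false 2 (theta * theta).
Proof. exact: (of_classM theta_class theta_class). Qed.
Lemma curvature_class : of_class t false 2 K.
Proof.
apply: of_classD; last first.
  apply: (of_classM (p := false) (q := false) (d := 0)) => //.
  by apply: of_classB => //; exact: (of_classM u_class u_class).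
apply: of_classD; last exact: (of_classM u_class omega_class).
rewrite /N -[1]/(bar_const 1 : bar).
rewrite (_ : _ - _ = bar_const (F * F - 1)); first exact: of_class_const.
by rewrite !rmorphB !rmorphM.
Qed.
Let K_t_class : of_class t false 1 curvature_t.
Proof.
apply: of_classD; last first.
  by apply: of_class_le (of_classM u_class omega_t_class).
rewrite (_ : _ + _ = bar_const (F * D + D * F)); first exact: of_class_const.
by rewrite !rmorphD !rmorphM.
Qed.
Let K_u_class : of_class t false 1 curvature_u.
Proof.
apply: (of_class_le (e := 2)) => //; apply: of_classD => //.
apply: (of_classM (p := false) (q := false) (d := 0)) => //.
by do 2!(apply: of_classB => //); exact: of_class1.
Qed.
Let X_class : of_class t true 0 X.
Proof.
by apply: of_classD => //; apply: of_class_le (of_classM u_class theta_class).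
Qed.
Let KX_class n : of_class t false (n * 2) (K ^+ n).
Proof. apply: of_classX; exact: curvature_class. Qed.

Let summand_class (i : 'I_m) :
  of_class t false (2 * m) (flip (theta * K ^+ i) * (cD * K ^+ (m.-1 - i))).
Proof.
have := of_classM (of_class_flip (of_classM theta_class (KX_class i)))
  (of_classM D_class (KX_class (m.-1 - i))).
by congr (of_class t _ _ _); case: i => /= i; lia.
Qed.

Lemma curvature_transgression_class : of_class t false (2 * m) curvature_transgression.
Proof. by apply: of_class_sum => i _; exact: summand_class. Qed.

Lemma curvature_transgressionP (s : seq A) : size s = m ->
  tr t (bar_d curvature_transgression) s =
  tr t (theta * \sum_(i < m) K ^+ i * curvature_t * K ^+ (m.-1 - i)) s -
  tr t (cD * \sum_(i < m) K ^+ i * curvature_u * K ^+ (m.-1 - i)) s.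
Proof.
move=> sz_s.
pose E (i : 'I_m) := flip (theta * K ^+ i) * (cD * K ^+ (m.-1 - i)).
have E_class i : of_class t false (2 * m) (E i) := summand_class i.
have par : odd (size s) = odd m by rewrite sz_s.
have deg : (m + size s <= 2 * m)%N by rewrite sz_s mul2n addnn.
have nn : true (+) odd (size s) = ~~ odd m by rewrite par.
rewrite -(tr_rel_d lam_class curvature_transgression_class)//; last exact: leqW.
have XE_class i : of_class t true (2 * m) (X * E i).
  exact: (of_classM X_class (E_class i)).
have EX_class i : of_class t true (2 * m) (flip (E i) * X).
  by rewrite -[(2 * m)%N]addn0; exact: (of_classM (of_class_flip (E_class i))).
have summ f : of_class t true (2 * m) f -> summable_at t (size s) f.
  by move=> cf; exact: of_class_summable cf _ _.
have dE_class i : of_class t true (2 * m) (rel_d lam (E i)).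
  apply: of_classB; first exact: of_class_le (of_class_d (E_class i)).
  exact: of_class_le (of_class_commutator lam_class (E_class i)).
have KtK_class (i : 'I_m) :
    of_class t true (2 * m) (theta * (K ^+ i * curvature_t * K ^+ (m.-1 - i))).
  have := of_classM theta_class (of_classM (of_classM (KX_class i) K_t_class)
    (KX_class (m.-1 - i))).
  by congr (of_class t _ _ _); case: i => /= i; lia.
have KuK_class (i : 'I_m) :
    of_class t true (2 * m) (cD * (K ^+ i * curvature_u * K ^+ (m.-1 - i))).
  have := of_classM D_class (of_classM (of_classM (KX_class i) K_u_class)
    (KX_class (m.-1 - i))).
  by congr (of_class t _ _ _); case: i => /= i; lia.
rewrite {1}/curvature_transgression raddf_sum tr_sum => [|i _]; last exact/summ/dE_class.
rewrite !mulr_sumr !tr_sum => [|i _|i _]; last 2 first.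
- exact/summ/KuK_class.
- exact/summ/KtK_class.
rewrite [X in _ - X](reindex_inj rev_ord_inj) -sumrB; apply: eq_bigr => i _ /=.
have -> : tr t (rel_d lam (E i)) s =
    tr t (rel_d lam (E i) - (X * E i - flip (E i) * X)) s.
  rewrite trB ?(tr_commutator X_class (E_class i))// ?subr0//; first exact/summ/dE_class.
  by apply: summ; apply: of_classB.
rewrite rel_d_nabla// !nablaMr//; first last.
- by apply: covariantly_constantX; last exact: bianchi.
- by apply: covariantly_constantX; last exact: bianchi.
rewrite nabla_D nabla_theta.
rewrite !(mulNr, mulrN) rmorphN /= opprK mulNr addrC -!mulrA.
have uK_class j : of_class t false (j * 2).+1 (curvature_u * K ^+ j).
  exact: (of_classM K_u_class (KX_class _)).
have DKX_class j : of_class t true (j * 2).+1 (cD * K ^+ j).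
  exact: (of_classM D_class (KX_class _)).
have -> : (m - i.+1 = m.-1 - i)%N by clear; case: i => i /=; lia.
rewrite subKn; last by rewrite -ltnS prednK.
have deg_i : ((i * 2).+1 + ((m.-1 - i) * 2).+1 = 2 * m)%N.
  by clear; case: i => i /=; lia.
rewrite trB; first last.
- apply: summ; rewrite -deg_i.
  exact: (of_classM (of_class_flip (uK_class i)) (DKX_class (m.-1 - i)%N)).
- by apply: summ; rewrite [K ^+ _ * (_ * _)]mulrA; exact: KtK_class.
congr (_ - _).
rewrite mulrA (tr_swap (DKX_class _) (uK_class _))//.
  by rewrite mul1r.
by rewrite [X in (_ <= X)%N]addnC deg_i.
Qed.
End CurvatureHomotopy.

Section IndexCochain.
Context (S : pzRingType) (V : idomainType) (m : nat) (t : summable_trace S V m).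
Context (A : pzRingType) (H : A -> S) (D F : S).
Hypothesis HM : forall x y, H (x * y) = H x * H y.
Hypothesis H_ideal : forall x, ideal t false 0 (H x).
Hypothesis F_ideal : ideal t true 0 F.
Hypothesis FH_ideal : forall x, ideal t true 1 (F * H x - H x * F).

Local Notation bar := (bar A S).
Let theta : bar := bar_form H.
Let cF : bar := bar_const F.
Definition bar_comm (c : S) : bar := bar_form (fun x => c * H x - H x * c).
Local Notation omega := (bar_comm F).
Local Notation dH := (rel_d theta).

Let theta_flip : flip theta = - theta. Proof. exact: flip_form. Qed.
Let F_flip : flip cF = cF. Proof. exact: flip_const. Qed.
Let theta_class : of_class t true 1 theta.
Proof. exact: (of_class_form (p := false)). Qed.
Let F_class : of_class t true 0 cF. Proof. exact: of_class_const. Qed.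
Let omega_class : of_class t false 2 omega.
Proof. exact: (of_class_form (p := true)). Qed.

Lemma bar_commE c : bar_comm c = bar_const c * theta - theta * bar_const c.
Proof.
rewrite bar_const_form bar_form_const.
by apply/funext => -[|a [|b s]]; rewrite barB /= ?subrr.
Qed.

Let d_const c : dH (bar_const c) = bar_comm c.
Proof. by rewrite /rel_d bar_d_const flip_const sub0r opprB bar_commE. Qed.
Let d_theta : dH theta = - (theta * theta).
Proof.
have -> : dH theta = bar_d theta - (theta * theta + theta * theta).
  by rewrite /rel_d theta_flip mulNr opprK.
rewrite (@bar_d_form _ _ H (fun=> 0)) => [|x y]; last by rewrite mul0r mulr0 !addr0 HM.
have -> : bar_form (fun=> 0) = 0 :> bar by apply/funext => -[|a [|b s]].
by rewrite mul0r mulr0 !addr0 -/theta; non_commutative_ring.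
Qed.
Let d_omega : dH omega = 0.
Proof.
rewrite bar_commE rel_dB !rel_dM// d_theta d_const theta_flip F_flip bar_commE.
by non_commutative_ring.
Qed.
Let d_omegaX n : dH (omega ^+ n) = 0.
Proof.
have := @covariantly_constantX _ _ theta 0 omega n.
by rewrite /covariantly_constant !(mul0r, mulr0, subrr); apply; exact: d_omega.
Qed.
Let omega_flip n : flip (omega ^+ n) = (-1) ^+ n * omega ^+ n.
Proof. by rewrite rmorphXn /= [flip omega]flip_form [LHS]exprNn. Qed.
Let omegaX_class n : of_class t false (n * 2) (omega ^+ n).
Proof. exact: of_classX. Qed.

Lemma tr_sign n (f : bar) s : summable_at t (size s) f ->
  tr t ((-1) ^+ n * f) s = (-1) ^+ n * tr t f s.
Proof.
by move=> tf; rewrite -signr_odd -[in RHS]signr_odd !mulr_sign; case: odd => //; rewrite trN.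
Qed.

Lemma bar_comm_prod n c (s : seq A) : size s = n ->
  (bar_comm c ^+ n : bar) s = \prod_(x <- s) (c * H x - H x * c).
Proof.
elim: n s => [|n IHn] [|x s]//=; first by rewrite big_nil.
by move=> [sz_s]; rewrite exprS bar_formM IHn// big_cons.
Qed.

Section Perturbation.
Hypothesis D_ideal : ideal t true 1 D.
Hypothesis DH_ideal : forall x, ideal t true 1 (D * H x - H x * D).
Hypothesis m_gt0 : (0 < m)%N.
Let cD : bar := bar_const D.
Local Notation omega_t := (bar_comm D).
Let D_flip : flip cD = cD. Proof. exact: flip_const. Qed.
Let D_class : of_class t true 1 cD. Proof. exact: of_class_const. Qed.
Let omega_t_class : of_class t false 2 omega_t.
Proof. exact: (of_class_form (p := true)). Qed.

Definition index_transgression : bar :=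
  \sum_(i < m) (-1) ^+ i * (cF * omega ^+ i * (cD * omega ^+ (m.-1 - i))).

Let summand_class (i : 'I_m) :
  of_class t false (2 * m).-1 (cF * omega ^+ i * (cD * omega ^+ (m.-1 - i))).
Proof.
have := of_classM (of_classM F_class (omegaX_class i))
  (of_classM D_class (omegaX_class (m.-1 - i))).
by congr (of_class t _ _ _); case: i => /= i; lia.
Qed.

Lemma index_transgression_class : of_class t false (2 * m).-1 index_transgression.
Proof.
apply: of_class_sum => i _; rewrite -signr_odd mulr_sign.
by case: odd; [apply: of_classN|]; exact: summand_class.
Qed.

Lemma index_transgressionP (s : seq A) : size s = m ->
  tr t (bar_d index_transgression) s =
  tr t (cF * \sum_(i < m) omega ^+ i * omega_t * omega ^+ (m.-1 - i)) s
  - tr t (cD * omega ^+ m) s *+ m.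
Proof.
move=> sz_s.
pose E (i : 'I_m) := cF * omega ^+ i * (cD * omega ^+ (m.-1 - i)).
have E_class i : of_class t false (2 * m).-1 (E i) := summand_class i.
have signE_class (i : 'I_m) : of_class t false (2 * m).-1 ((-1) ^+ i * E i).
  by rewrite -signr_odd mulr_sign; case: odd => //; exact: of_classN.
have par : odd (size s) = odd m by rewrite sz_s.
have nn : true (+) odd (size s) = ~~ odd m by rewrite par.
have deg : (m + size s <= 2 * m)%N by rewrite sz_s mul2n addnn.
have summ f : of_class t true (2 * m) f -> summable_at t (size s) f.
  by move=> cf; exact: of_class_summable cf _ _.
have predK : (2 * m).-1.+1 = (2 * m)%N by rewrite prednK// muln_gt0.
have dE_class (i : 'I_m) : of_class t true (2 * m) (dH ((-1) ^+ i * E i)).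
  rewrite -predK; apply: of_classB; first exact: (of_class_d (p := false)).
  exact: (of_class_commutator (p := false)).
have wDw_class i j : (i + j)%N = m ->
    of_class t true (2 * m) (omega ^+ i * (cD * omega ^+ j)).
  move=> ij; apply: (of_class_le (e := (i * 2 + (1 + j * 2))%N)); first lia.
  exact: (of_classM (omegaX_class i) (of_classM D_class (omegaX_class j))).
have FwDw_class (i : 'I_m) : of_class t true (2 * m)
    (cF * (omega ^+ i * omega_t * omega ^+ (m.-1 - i))).
  have := of_classM F_class (of_classM (of_classM (omegaX_class i) omega_t_class)
    (omegaX_class (m.-1 - i))).
  by congr (of_class t _ _ _); case: i => /= i; lia.
rewrite -(tr_rel_d (d := (2 * m).-1) theta_class)//; first last.
- by rewrite predK.
- exact: index_transgression_class.
rewrite /index_transgression raddf_sum tr_sum => [|i _]; last exact/summ/dE_class.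
rewrite mulr_sumr tr_sum => [|i _]; last exact/summ/FwDw_class.
have -> : tr t (cD * omega ^+ m) s *+ m = \sum_(i < m) tr t (cD * omega ^+ m) s.
  by rewrite sumr_const card_ord.
rewrite -sumrB; apply: eq_bigr => i _ /=.
have sum_i : (i.+1 + (m.-1 - i) = m)%N by clear -m_gt0; case: i => /= i; lia.
have -> : dH ((-1) ^+ i * E i) =
    cF * (omega ^+ i * omega_t * omega ^+ (m.-1 - i))
    + (-1) ^+ i * (omega ^+ i.+1 * (cD * omega ^+ (m.-1 - i))).
  rewrite raddfMsign /= /E rel_dM// [dH (cF * _)]rel_dM// [dH (cD * _)]rel_dM//.
  rewrite !d_omegaX !mulr0 !addr0 !d_const rmorphM /= omega_flip F_flip.
  rewrite addrC mulrDr; congr (_ + _); last by rewrite exprS !mulrA.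
  by rewrite [cF * ((-1) ^+ _ * _)]mulrA [cF * (-1) ^+ _]commr_sign -!mulrA signrMK.
rewrite trD; first last.
- move=> u sz_u; rewrite -signr_odd mulr_sign.
  by case: ifP => _; [rewrite barN; apply: idealN|]; apply: summ sz_u; exact: wDw_class.
- exact/summ/FwDw_class.
congr (_ + _); rewrite tr_sign; last exact/summ/wDw_class.
have := @tr_swap _ _ _ t _ true (1 + (m.-1 - i) * 2) false (i.+1 * 2)
  (cD * omega ^+ (m.-1 - i)) (omega ^+ i.+1) s
  (of_classM D_class (omegaX_class _)) (omegaX_class _).
rewrite addbF => /(_ nn) /=.
rewrite -mulrA -exprD [(_ - _ + _)%N]addnC sum_i => ->; last first.
  by rewrite sz_s; move: sum_i; clear; lia.
rewrite mul1r omega_flip -mulrA tr_sign; last exact/summ/wDw_class.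
by rewrite [(-1) ^+ i.+1]exprS mulN1r mulNr opprK.
Qed.
End Perturbation.

Section Involution.
Hypothesis FF : F * F = 1.
Hypothesis two_neq0 : (2%:R : V) != 0.

Let F_omega n : omega ^+ n * cF = (-1) ^+ n * (cF * omega ^+ n).
Proof.
have cFF : cF * cF = 1 by rewrite -rmorphM FF rmorph1.
have anti : omega * cF = - (cF * omega).
  rewrite bar_commE mulrBl mulrBr -!mulrA cFF mulr1 !mulrA cFF mul1r opprB.
  by [].
elim: n => [|n IHn]; first by rewrite !mul1r mulr1.
rewrite [omega ^+ _]exprS -mulrA IHn [omega * (_ * _)]mulrA [omega * (-1) ^+ _]commr_sign -mulrA.
rewrite [omega * (cF * _)]mulrA anti [(-1) ^+ n.+1]exprS mulN1r !mulNr mulrN.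
by rewrite -mulrA.
Qed.

Lemma tr_index_cocycle (s : seq A) : size s = m.+1 ->
  tr t (bar_d (cF * omega ^+ m)) s = 0.
Proof.
move=> sz_s.
have P_class : of_class t true (2 * m) (cF * omega ^+ m).
  by rewrite mulnC; exact: (of_classM F_class (omegaX_class m)).
have par : odd (size s) = ~~ odd m by rewrite sz_s.
have deg : (m + size s <= (2 * m).+1)%N by rewrite sz_s addnS ltnS mul2n addnn.
have summ f : of_class t false (2 * m).+1 f -> summable_at t (size s) f.
  by move=> cf; exact: of_class_summable cf _ _.
have w_class : of_class t false (2 * m).+1 (omega ^+ m.+1).
  by apply: of_class_le (omegaX_class _); rewrite mulnC.
have dP : bar_d (cF * omega ^+ m) = omega ^+ m.+1 +
    (theta * (cF * omega ^+ m) - flip (cF * omega ^+ m) * theta).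
  have : dH (cF * omega ^+ m) = omega ^+ m.+1.
    by rewrite rel_dM// d_omegaX d_const mulr0 addr0 exprS.
  by rewrite /rel_d => <-; rewrite subrK.
have thP_class : of_class t false (2 * m).+1 (theta * (cF * omega ^+ m)).
  exact: (of_classM theta_class P_class).
have Pth_class : of_class t false (2 * m).+1 (flip (cF * omega ^+ m) * theta).
  by rewrite -addn1; exact: (of_classM (of_class_flip P_class) theta_class).
rewrite dP trD; [|exact: summ|by apply: summ; exact: of_classB].
rewrite trB; [|exact: summ|exact: summ].
rewrite (tr_swap theta_class P_class)/=; [|by rewrite par|by []].
rewrite theta_flip mulrN trN ?expr1 ?mulN1r ?opprK ?subrr ?addr0; last exact: summ.
have cFF : cF * cF = 1 by rewrite -rmorphM FF rmorph1.
have e : tr t (omega ^+ m.+1) s = - tr t (omega ^+ m.+1) s.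
  rewrite -{1}[omega ^+ _]mul1r -cFF -mulrA.
  rewrite (tr_swap F_class (of_classM F_class (omegaX_class m.+1)))/=; first last.
  - by rewrite sz_s; clear; lia.
  - by rewrite par.
  rewrite F_flip rmorphM /= F_flip omega_flip expr1 mulN1r.
  by rewrite -mulrA -mulrA F_omega signrMK mulrA cFF mul1r.
have : 2%:R * tr t (omega ^+ m.+1) s == 0 by rewrite mulr_natl mulr2n {1}e addNr.
by rewrite mulf_eq0 (negbTE two_neq0) => /eqP.
Qed.

Lemma tr_index (s : seq A) : size s = m -> (0 < m)%N ->
  tr t (cF * omega ^+ m) s =
  functional t (F * \prod_(x <- s) (F * H x - H x * F)) *+ m.
Proof.
move=> sz_s m_gt0; set P := fun u : seq A => \prod_(x <- u) (F * H x - H x * F).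
have P_ideal u : ideal t (odd (size u)) (size u) (P u).
  elim: u => [|x u IHu]; rewrite /P ?big_nil ?big_cons; first exact: ideal1.
  exact: (idealM (FH_ideal x) IHu).
have FP u : P u * F = (-1) ^+ size u * (F * P u).
  elim: u => [|x u IHu]; first by rewrite /P big_nil mulr1 !mul1r.
  rewrite /P big_cons -/(P u); set c := _ - _.
  have anti : c * F = - (F * c).
    by rewrite mulrBl mulrBr -!mulrA FF mulr1 !mulrA FF mul1r opprB.
  rewrite -mulrA IHu [c * (_ * _)]mulrA commr_sign -mulrA [c * (F * _)]mulrA anti.
  by rewrite [(-1) ^+ size (x :: u)]exprS mulN1r !mulNr mulrN -mulrA.
rewrite /tr /cyc sz_s -[RHS]mulr_natl.
have -> : m%:R = \sum_(0 <= k < m) 1 :> V by rewrite sumr_const_nat subn0.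
rewrite mulr_suml.
apply: eq_big_nat => k /andP[_ lt_k]; rewrite mul1r bar_constM.
rewrite bar_comm_prod ?size_rot// -/(P _).
set u := take k s; set v := drop k s.
have sz_u : size u = k by rewrite size_takel// sz_s ltnW.
have sz_v : size v = (m - k)%N by rewrite size_drop sz_s.
have PD w z : P (w ++ z) = P w * P z by rewrite /P big_cat.
rewrite /rot -/u -/v -[in RHS](cat_take_drop k s) -/u -/v !PD mulrA.
rewrite (functional_swap _ _ (idealM F_ideal (P_ideal v)) (P_ideal u)); first last.
- by rewrite sz_u sz_v add0n subnK// ltnW.
- by rewrite sz_u sz_v oddB ?(ltnW lt_k)//; case: (odd m) (odd k) => [] [].
rewrite [P u * _]mulrA FP -!mulrA functional_sign; last first.
  have := idealM F_ideal (idealM (P_ideal u) (P_ideal v)).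
  by rewrite sz_u sz_v subnKC 1?ltnW// oddB 1?ltnW//; case: (odd m) (odd k) => [] [].
rewrite mulrA -!exprD mulrA -exprD sz_u sz_v -signr_odd !oddD oddM oddB 1?ltnW//.
have -> : odd m.-1 = ~~ odd m by rewrite -[in RHS](prednK m_gt0) /= negbK.
by rewrite -/(P (u ++ v)) PD; case: (odd m) (odd k) => [] []; rewrite mul1r.
Qed.
End Involution.
End IndexCochain.

Section BarMap.
Context (A : Type) (S S' : pzRingType).
Implicit Types (f g : bar A S).

Definition bar_map (e : S -> S') f : bar A S' := fun s => e (f s).

Lemma bar_mapM (e : {rmorphism S -> S'}) f g :
  bar_map e (f * g) = bar_map e f * bar_map e g.
Proof.
apply/funext => s; rewrite /bar_map !barM rmorph_sum; apply: eq_bigr => i _.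
by rewrite rmorphM.
Qed.
Lemma bar_map_const (e : {rmorphism S -> S'}) c :
  bar_map e (bar_const c) = bar_const (e c).
Proof. by apply/funext => -[|a s] //; rewrite /bar_map /= rmorph0. Qed.
Lemma bar_map_form (e : {rmorphism S -> S'}) h :
  bar_map e (bar_form h) = bar_form (fun x : A => e (h x)).
Proof. by apply/funext => -[|a [|b s]] //; rewrite /bar_map /= rmorph0. Qed.
Lemma bar_mapD (e : {additive S -> S'}) f g :
  bar_map e (f + g) = bar_map e f + bar_map e g.
Proof. by apply/funext => s; rewrite /bar_map !barD raddfD. Qed.
Lemma bar_mapB (e : {additive S -> S'}) f g :
  bar_map e (f - g) = bar_map e f - bar_map e g.
Proof. by apply/funext => s; rewrite /bar_map !barB raddfB. Qed.
Lemma bar_mapN (e : {additive S -> S'}) f : bar_map e (- f) = - bar_map e f.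
Proof. by apply/funext => s; rewrite /bar_map !barN raddfN. Qed.
Lemma bar_map1 (e : {rmorphism S -> S'}) : bar_map e 1 = 1.
Proof. by rewrite -[1]/(bar_const 1 : bar A S) bar_map_const rmorph1. Qed.
Lemma bar_mapX (e : {rmorphism S -> S'}) f n : bar_map e (f ^+ n) = bar_map e f ^+ n.
Proof.
elim: n => [|n IHn]; first exact: bar_map1.
by rewrite !exprS bar_mapM IHn.
Qed.
End BarMap.

Section BarDerivation.
Context (A : Type) (S : pzRingType) (e : {additive S -> S}).
Hypothesis eM : forall x y, e (x * y) = e x * y + x * e y.
Implicit Types (f g : bar A S).

Lemma bar_deriveM f g : bar_map e (f * g) = bar_map e f * g + f * bar_map e g.
Proof.
apply/funext => s; rewrite barD /bar_map !barM raddf_sum -big_split.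
by apply: eq_bigr => i _; exact: eM.
Qed.
Lemma bar_deriveX f n : bar_map e (f ^+ n) =
  \sum_(i < n) f ^+ i * bar_map e f * f ^+ (n.-1 - i).
Proof.
have e1 : e 1 = 0.
  have /eqP := eM 1 1; rewrite !(mulr1, mul1r) -{1}[e 1]addr0 (inj_eq (addrI _)).
  by rewrite eq_sym => /eqP.
elim: n => [|n IHn].
  by rewrite big_ord0; apply/funext => -[|a s]; rewrite /bar_map /= ?e1 ?raddf0.
rewrite exprSr bar_deriveM IHn big_ord_recr /= subnn mulr1; congr (_ + _).
rewrite mulr_suml; apply: eq_bigr => -[i /= lt_i] _.
by rewrite -mulrA -exprSr; congr (_ * _ ^+ _); lia.
Qed.
Lemma bar_derive_const c : bar_map e (bar_const c) = bar_const (e c) :> bar A S.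
Proof. by apply/funext => -[|a s] //; rewrite /bar_map /= raddf0. Qed.
Lemma bar_derive_form h : bar_map e (bar_form h) = bar_form (fun x : A => e (h x)).
Proof. by apply/funext => -[|a [|b s]] //; rewrite /bar_map /= raddf0. Qed.
End BarDerivation.

Section PolynomialTrace.
Context (S : nzRingType) (V : numFieldType) (m : nat) (t : summable_trace S V m).
Local Notation T := (functional t).
Implicit Types P Q : {poly S}.

Definition poly_ideal p d P := forall i, ideal t p d P`_i.
Definition poly_functional P : V := \sum_(i < size P) T P`_i / i.+1%:R.

Lemma poly_functional_widen n P : (size P <= n)%N ->
  poly_functional P = \sum_(i < n) T P`_i / i.+1%:R.
Proof.
move=> le_n; rewrite /poly_functional -(big_mkord xpredT (fun i => T P`_i / i.+1%:R)).
rewrite -[RHS](big_mkord xpredT (fun i => T P`_i / i.+1%:R)).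
rewrite [RHS](big_cat_nat (n := size P))//= [X in _ + X]big_nat_cond.
rewrite [X in _ + X]big1 ?addr0// => i /andP[/andP[le_i _] _].
by rewrite nth_default// functional0 mul0r.
Qed.

Let piB p d P Q : poly_ideal p d P -> poly_ideal p d Q -> poly_ideal p d (P - Q).
Proof. by move=> iP iQ i; rewrite coefB; exact: idealB. Qed.
Let piM p q d e P Q :
  poly_ideal p d P -> poly_ideal q e Q -> poly_ideal (p (+) q) (d + e) (P * Q).
Proof. by move=> iP iQ i; rewrite coefM; apply: ideal_sum => j _; exact: idealM. Qed.
Let pi_le p d e P : (d <= e)%N -> poly_ideal p e P -> poly_ideal p d P.
Proof. by move=> de iP i; exact: ideal_le (iP i). Qed.
Let pi0 p d : poly_ideal p d 0.
Proof. by move=> i; rewrite coef0; exact: ideal0. Qed.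
Let pi1 : poly_ideal false 0 1.
Proof. by move=> i; rewrite coef1; case: eqP => _; [exact: ideal1|exact: ideal0]. Qed.
Let pfB P Q : poly_ideal (~~ odd m) m P -> poly_ideal (~~ odd m) m Q ->
  poly_functional (P - Q) = poly_functional P - poly_functional Q.
Proof.
move=> iP iQ; pose n := maxn (size P) (size Q).
have sizeB : (size (P - Q)%R <= n)%N.
  by rewrite (leq_trans (size_polyD _ _))// size_polyN.
rewrite !(poly_functional_widen sizeB, poly_functional_widen (leq_maxl (size P) (size Q))).
rewrite (poly_functional_widen (leq_maxr (size P) (size Q))).
rewrite -sumrB; apply: eq_bigr => i _.
by rewrite coefB functionalB// mulrBl.
Qed.
Let pf_swap p q d e P Q : p (+) q = ~~ odd m -> (m <= d + e)%N ->
  poly_ideal p d P -> poly_ideal q e Q ->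
  poly_functional (P * Q) = (-1) ^+ (p && q) * poly_functional (Q * P).
Proof.
move=> par deg iP iQ; pose n := maxn (size (P * Q)) (size (Q * P)).
rewrite (poly_functional_widen (leq_maxl _ _ : size (P * Q)%R <= n)%N).
rewrite (poly_functional_widen (leq_maxr _ _ : size (Q * P)%R <= n)%N).
rewrite mulr_sumr; apply: eq_bigr => i _; rewrite mulrA; congr (_ / _).
rewrite coefM coefMr !functional_sum => [|j _|j _]; first last.
- by rewrite -par; apply: ideal_le deg _; exact: idealM.
- by rewrite -par addbC; rewrite addnC in deg; apply: ideal_le deg _; exact: idealM.
rewrite mulr_sumr; apply: eq_bigr => j _; exact: (functional_swap par deg (iP _) (iQ _)).
Qed.

Definition poly_trace : summable_trace {poly S} V m :=
  SummableTrace piB piM pi_le pi0 pi1 pfB pf_swap.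

Lemma poly_idealC p d c : ideal t p d c -> poly_ideal p d c%:P.
Proof. by move=> ic i; rewrite coefC; case: eqP => _ //; exact: ideal0. Qed.
Lemma poly_idealX : poly_ideal false 0 'X.
Proof. by move=> i; rewrite coefX; case: eqP => _; [exact: ideal1|exact: ideal0]. Qed.

Lemma functional_natmul n x : ideal t (~~ odd m) m x -> T (x *+ n) = T x *+ n.
Proof.
move=> tx; elim: n => [|n IHn]; first by rewrite !mulr0n functional0.
rewrite !mulrS functionalD ?IHn//.
by elim: n {IHn} => [|n IHn]; rewrite ?mulr0n ?mulrS; [exact: ideal0|exact: idealD].
Qed.

Lemma poly_functional_deriv P : poly_ideal (~~ odd m) m P ->
  poly_functional P^`() = T P.[1] - T P.[0].
Proof.
move=> iP; rewrite (@poly_functional_widen (size P)); last first.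
  by rewrite (leq_trans (size_poly _ _))// leq_pred.
have -> : P.[0] = P`_0 by rewrite horner_coef0.
have -> : P.[1] = \sum_(i < (size P).+1) P`_i.
  rewrite (@horner_coef_wide _ (size P).+1)//.
  by apply: eq_bigr => i _; rewrite expr1n mulr1.
rewrite functional_sum// big_ord_recl addrAC subrr add0r; apply: eq_bigr => i _.
by rewrite coef_deriv functional_natmul// -[T _ *+ _]mulr_natr mulfK ?pnatr_eq0.
Qed.
End PolynomialTrace.

Section Normalized.
Context (V : numFieldType) (A : algType V) (S : pzRingType) (iota : V -> S).
Hypothesis iotaC : forall k c, iota k * c = c * iota k.
Implicit Types f g : bar A S.

Definition normalized_at f s1 s2 :=
  (forall k x y, f (s1 ++ k *: x + y :: s2) =
     iota k * f (s1 ++ x :: s2) + f (s1 ++ y :: s2)) /\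
  f (s1 ++ 1 :: s2) = 0.
Definition normalized f := forall s1 s2, normalized_at f s1 s2.

Lemma normalized_const c : normalized (bar_const c).
Proof. by case=> [|a s1] s2; split=> // k x y; rewrite mulr0 addr0. Qed.
Lemma normalizedB f g : normalized f -> normalized g -> normalized (f - g).
Proof.
move=> nf ng s1 s2; have [lf f1] := nf s1 s2; have [lg g1] := ng s1 s2.
split=> [k x y|]; last by rewrite barB f1 g1 subr0.
by rewrite !barB lf lg mulrBr opprD addrACA.
Qed.
Lemma normalizedN f : normalized f -> normalized (- f).
Proof.
move=> nf; rewrite -sub0r; apply: normalizedB => //.
by rewrite -[0](rmorph0 (bar_const (A := A))); exact: normalized_const.
Qed.
Lemma normalizedD f g : normalized f -> normalized g -> normalized (f + g).
Proof. by move=> nf ng; rewrite -[g]opprK; apply/normalizedB/normalizedN. Qed.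
Lemma normalized_sum I (r : seq I) (P : pred I) (F : I -> bar A S) :
  (forall i, P i -> normalized (F i)) -> normalized (\sum_(i <- r | P i) F i).
Proof.
move=> nF; elim/big_ind: _ => //; last exact: normalizedD.
by rewrite -[0](rmorph0 (bar_const (A := A))); exact: normalized_const.
Qed.
Lemma normalized_flip f : normalized f -> normalized (flip f).
Proof.
move=> nf s1 s2; have [lf f1] := nf s1 s2; rewrite /normalized_at /flip !size_cat /=.
split=> [k x y|]; last by rewrite f1 mulr0.
by rewrite size_cat /= lf mulrDr !mulrA iotaC !size_cat.
Qed.
Lemma normalized_form (h : A -> S) :
  (forall k x y, h (k *: x + y) = iota k * h x + h y) -> h 1 = 0 ->
  normalized (bar_form h).
Proof.
move=> lh h1 [|a [|b s1]] [|c s2]; split=> // *; by rewrite /= ?mulr0 ?addr0.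
Qed.
Lemma normalizedM f g : normalized f -> normalized g -> normalized (f * g).
Proof.
move=> nf ng s1; elim: s1 f nf => [|a s1 IHs1] f nf s2.
  have [lg g1] := ng [::] s2; split=> [k x y|]; rewrite /= !barM_cons; last first.
    rewrite g1 mulr0 add0r (_ : shift 1 f = 0) ?mul0r//.
    by apply/funext => s; have [] := nf [::] s.
  rewrite lg mulrDr mulrA -[f [::] * iota k]iotaC -mulrA.
  have -> : shift (k *: x + y) f = bar_const (iota k) * shift x f + shift y f.
    by apply/funext => s; rewrite barD bar_constM; have [+ _] := nf [::] s; exact.
  by rewrite mulrDl -mulrA barD bar_constM [in RHS]mulrDr addrACA.
have [lg g1] := ng (a :: s1) s2.
have nsf : normalized (shift a f) by move=> u1 u2; exact: (nf (a :: u1) u2).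
have [lfg fg1] := IHs1 _ nsf s2.
split=> [k x y|]; rewrite !cat_cons !barM_cons; last by rewrite g1 mulr0 fg1 addr0.
rewrite -!cat_cons lg lfg mulrDr mulrA -[f [::] * iota k]iotaC -mulrA.
by rewrite [in RHS]mulrDr addrACA.
Qed.
Lemma normalizedX f n : normalized f -> normalized (f ^+ n).
Proof.
move=> nf; elim: n => [|n IHn]; first exact: (normalized_const 1).
by rewrite exprS; exact: normalizedM.
Qed.

Lemma rot_insert k (s1 s2 : seq A) :
  exists u1 u2, forall x, rot k (s1 ++ x :: s2) = u1 ++ x :: u2.
Proof.
have [le_k|lt_k] := leqP k (size s1).
  exists (drop k s1), (s2 ++ take k s1) => x.
  rewrite /rot drop_cat take_cat; case: ltnP => [_|ge_k]; first by rewrite -catA.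
  have -> : k = size s1 by apply/eqP; rewrite eqn_leq le_k.
  by rewrite subnn drop0 take0 cats0 drop_size take_size.
exists (drop (k - (size s1).+1) s2 ++ s1), (take (k - (size s1).+1) s2) => x.
rewrite /rot drop_cat take_cat ltnNge (ltnW lt_k) /=.
have -> : (k - size s1 = (k - (size s1).+1).+1)%N by lia.
by rewrite /= catA.
Qed.

Context (m : nat) (t : summable_trace S V m).
Hypothesis iota_ideal : forall k, ideal t false 0 (iota k).
Hypothesis functionalZ : forall k x, ideal t (~~ odd m) m x ->
  functional t (iota k * x) = k * functional t x.

Lemma tr_normalized f n s1 s2 : normalized f -> summable_at t n f ->
  size (s1 ++ 1 :: s2) = n ->
  (forall k x y, tr t f (s1 ++ k *: x + y :: s2) =
     k * tr t f (s1 ++ x :: s2) + tr t f (s1 ++ y :: s2)) /\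
  tr t f (s1 ++ 1 :: s2) = 0.
Proof.
move=> nf sf sz_n.
have sz x : size (s1 ++ x :: s2) = n by rewrite -sz_n !size_cat.
have sz_rot j x : size (rot j (s1 ++ x :: s2)) = n by rewrite size_rot.
split=> [k x y|].
  rewrite /tr /cyc !sz mulr_sumr -big_split; apply: eq_bigr => j _ /=.
  have tfx := sf _ (sz_rot j x); have tfy := sf _ (sz_rot j y).
  have [u1 [u2 rotE]] := rot_insert j s1 s2; rewrite !rotE in tfx tfy *.
  have [-> _] := nf u1 u2; rewrite functionalD//; last first.
    by have := idealM (iota_ideal k) tfx; rewrite add0n.
  by rewrite functionalZ// mulrDr mulrCA.
rewrite /tr /cyc big1// => j _; have [u1 [u2 rotE]] := rot_insert j s1 s2.
by rewrite rotE; have [_ ->] := nf u1 u2; rewrite functional0 mulr0.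
Qed.
End Normalized.

Section PolynomialPath.
Context (S : nzRingType).

Definition eval1 (P : {poly S}) : S := P.[1].
Lemma eval1_is_zmod_morphism : zmod_morphism eval1.
Proof. by move=> P Q; rewrite /eval1 hornerD hornerN. Qed.
Lemma eval1_is_monoid_morphism : monoid_morphism eval1.
Proof.
split=> [|P Q]; first by rewrite /eval1 hornerE.
by rewrite /eval1 hornerM_comm// /comm_poly mul1r mulr1.
Qed.
HB.instance Definition _ :=
  GRing.isZmodMorphism.Build {poly S} S eval1 eval1_is_zmod_morphism.
HB.instance Definition _ :=
  GRing.isMonoidMorphism.Build {poly S} S eval1 eval1_is_monoid_morphism.

Definition eval0 (P : {poly S}) : S := P.[0].
Lemma eval0_is_zmod_morphism : zmod_morphism eval0.
Proof. by move=> P Q; rewrite /eval0 hornerD hornerN. Qed.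
Lemma eval0_is_monoid_morphism : monoid_morphism eval0.
Proof.
split=> [|P Q]; first by rewrite /eval0 hornerE.
by rewrite /eval0 hornerM_comm// /comm_poly mul0r mulr0.
Qed.
HB.instance Definition _ :=
  GRing.isZmodMorphism.Build {poly S} S eval0 eval0_is_zmod_morphism.
HB.instance Definition _ :=
  GRing.isMonoidMorphism.Build {poly S} S eval0 eval0_is_monoid_morphism.

Lemma eval1C c : eval1 c%:P = c. Proof. exact: hornerC. Qed.
Lemma eval0C c : eval0 c%:P = c. Proof. exact: hornerC. Qed.
Lemma eval1X : eval1 'X = 1. Proof. exact: hornerX. Qed.
Lemma eval0X : eval0 'X = 0. Proof. exact: hornerX. Qed.

Definition inner_deriv (P : {poly {poly S}}) := map_poly (deriv (R := S)) P.
Lemma coef_inner_deriv P i : (inner_deriv P)`_i = (P`_i)^`().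
Proof. by rewrite coef_map_id0 ?deriv0. Qed.
Lemma inner_derivC c : inner_deriv c%:P = (c^`())%:P.
Proof. by rewrite /inner_deriv map_polyC. Qed.
Lemma inner_deriv_is_zmod_morphism : zmod_morphism inner_deriv.
Proof.
by move=> P Q; apply/polyP => i; rewrite coefB !coef_inner_deriv coefB derivB.
Qed.
HB.instance Definition _ := GRing.isZmodMorphism.Build {poly {poly S}} {poly {poly S}}
  inner_deriv inner_deriv_is_zmod_morphism.
Lemma inner_derivM P Q :
  inner_deriv (P * Q) = inner_deriv P * Q + P * inner_deriv Q.
Proof.
apply/polyP => i; rewrite coefD coef_inner_deriv !coefM raddf_sum -big_split.
by apply: eq_bigr => j _; rewrite /= derivM !coef_inner_deriv.
Qed.

Context (V : numFieldType) (m : nat) (t : summable_trace S V m).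
Lemma poly_functional_inner_deriv P : ideal (poly_trace (poly_trace t)) (~~ odd m) m P ->
  map_poly eval1 P = 0 -> map_poly eval0 P = 0 ->
  functional (poly_trace (poly_trace t)) (inner_deriv P) = 0.
Proof.
move=> iP P1 P0; rewrite /= (@poly_functional_widen _ _ _ _ (size P)); last exact: size_poly.
rewrite big1// => i _; rewrite coef_inner_deriv [functional _ _]poly_functional_deriv; last exact: iP.
rewrite -/(eval1 _) -/(eval0 _).
rewrite -[eval1 _](coef_map eval1) -[eval0 _](coef_map eval0).
by rewrite P1 P0 !coef0 subrr mul0r.
Qed.

Lemma poly_functionalZ (iota : V -> S) :
  (forall k x, ideal t (~~ odd m) m x ->
     functional t (iota k * x) = k * functional t x) ->
  forall k P, ideal (poly_trace t) (~~ odd m) m P ->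
    functional (poly_trace t) ((iota k)%:P * P) = k * functional (poly_trace t) P.
Proof.
move=> fZ k P iP; rewrite /= (@poly_functional_widen _ _ _ _ (size P)); last first.
  by rewrite mul_polyC size_scale_leq.
by rewrite mulr_sumr; apply: eq_bigr => i _; rewrite coefCM fZ// mulrA.
Qed.
End PolynomialPath.

Lemma tr_bar_map_deriv (S : nzRingType) (V : numFieldType) m
    (t : summable_trace S V m) (A : pzRingType) (f : bar A {poly S}) s :
  summable_at (poly_trace t) (size s) f ->
  tr (poly_trace t) (bar_map (deriv (R := S)) f) s =
  tr t (bar_map (@eval1 S) f) s - tr t (bar_map (@eval0 S) f) s.
Proof.
move=> sf; rewrite /tr /cyc -sumrB; apply: eq_bigr => k _; rewrite -mulrBr.
by rewrite [functional _ _]poly_functional_deriv//; apply: sf; rewrite size_rot.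
Qed.

Section Orders.
Context (A : pzRingType) (S : pzRingType).
Implicit Types f g : bar A S.

Definition vanishes_below n f := forall s, (size s < n)%N -> f s = 0.
Lemma vanishes_belowM a b f g : vanishes_below a f -> vanishes_below b g ->
  vanishes_below (a + b) (f * g).
Proof.
move=> vf vg s lt_s; rewrite barM big1// => -[i /= le_i] _; rewrite ltnS in le_i.
have [lt_ia|le_ai] := ltnP i a.
  by rewrite vf ?mul0r// size_takel.
by rewrite vg ?mulr0// size_drop; lia.
Qed.
Lemma vanishes_belowX f n : vanishes_below 1 f -> vanishes_below n (f ^+ n).
Proof.
move=> vf; elim: n => [|n IHn] //; rewrite exprS -add1n; exact: vanishes_belowM.
Qed.

Lemma bar_const_formX (c : S) (k : A -> S) n s :
  ((size s = n -> ((bar_const c + bar_form k) ^+ n : bar A S) s = (bar_form k ^+ n : bar A S) s) *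
   ((n < size s)%N -> ((bar_const c + bar_form k) ^+ n : bar A S) s = 0))%type.
Proof.
elim: n s => [|n IHn] [|x s]; split=> //.
- move=> [sz_s]; rewrite !exprS mulrDl barD bar_constM !bar_formM.
  by rewrite (IHn (x :: s)).2 ?mulr0 ?add0r ?(IHn s).1 //= sz_s.
- move=> lt_s; rewrite exprS mulrDl barD bar_constM bar_formM.
  by rewrite (IHn (x :: s)).2 ?mulr0 ?add0r ?(IHn s).2 ?mulr0//= ltnW.
Qed.
End Orders.

Section Invariance.
Context (V : numFieldType) (A : algType V) (S : nzRingType) (m : nat).
Context (t : summable_trace S V m) (iota : V -> S) (h l : A -> S) (F G : S).
Hypothesis m_gt0 : (0 < m)%N.
Hypothesis iotaC : forall k c, iota k * c = c * iota k.
Hypothesis iota_ideal : forall k, ideal t false 0 (iota k).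
Hypothesis functionalZ : forall k x, ideal t (~~ odd m) m x ->
  functional t (iota k * x) = k * functional t x.
Hypothesis h_linear : forall k x y, h (k *: x + y) = iota k * h x + h y.
Hypothesis h1 : h 1 = 0.
Hypothesis hM : forall x y, h (x * y) = h x * h y + l x * h y + h x * l y.
Hypothesis lM : forall x y, l (x * y) = l x * l y.
Hypothesis l_central : forall x c, l x * c = c * l x.
Hypothesis h_ideal : forall x, ideal t false 0 (h x).
Hypothesis l_ideal : forall x, ideal t false 0 (l x).
Hypothesis F_ideal : ideal t true 0 F.
Hypothesis Fh_ideal : forall x, ideal t true 1 (F * h x - h x * F).
Hypothesis FF : F * F = 1.
Hypothesis GG : G * G = 1.
Hypothesis D_ideal : ideal t true 1 (G - F).

Let D := G - F.
Let H x := h x + l x.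
Let t1 := poly_trace t.
Let t2 := poly_trace t1.
Let D1 : {poly S} := D%:P.
Let F1 : {poly S} := F%:P + 'X * D%:P.
Let h1P x : {poly S} := (h x)%:P.
Let l1P x : {poly S} := (l x)%:P.
Let H1 x : {poly S} := h1P x + l1P x.
Let D2 : {poly {poly S}} := D1%:P.
Let F2 : {poly {poly S}} := F1%:P.
Let h2 x : {poly {poly S}} := (h1P x)%:P.
Let l2 x : {poly {poly S}} := (l1P x)%:P.

Let FD : F * D + D * F = - (D * D).
Proof.
have e : F * D + D * F + D * D = G * G - F * F by rewrite /D; non_commutative_ring.
by apply/eqP; rewrite -addr_eq0 e FF GG subrr.
Qed.

Let HM x y : H (x * y) = H x * H y.
Proof. by rewrite /H hM lM; non_commutative_ring. Qed.
Let H_ideal x : ideal t false 0 (H x).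
Proof. exact: idealD. Qed.
Let commH c x : c * H x - H x * c = c * h x - h x * c.
Proof. by rewrite /H mulrDr mulrDl l_central; non_commutative_ring. Qed.
Let Dh_ideal x : ideal t true 1 (D * h x - h x * D).
Proof.
apply: idealB; first exact: (idealM D_ideal (h_ideal x)).
exact: (idealM (h_ideal x) D_ideal).
Qed.
Let D1_ideal : ideal t1 true 1 D1. Proof. exact: poly_idealC. Qed.
Let XC (P : {poly S}) : 'X * P = P * 'X. Proof. exact/esym/commr_polyX. Qed.
Let X_ideal : ideal t1 false 0 'X. Proof. exact: poly_idealX. Qed.
Let F1_ideal : ideal t1 true 0 F1.
Proof.
apply: idealD; first exact: poly_idealC.
by apply: ideal_le (idealM X_ideal D1_ideal).
Qed.
Let comm_polyC (P Q : S) : P%:P * Q%:P - Q%:P * P%:P = (P * Q - Q * P)%:P.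
Proof. by rewrite polyCB !polyCM. Qed.
Let D1h_ideal x : ideal t1 true 1 (D1 * h1P x - h1P x * D1).
Proof. by rewrite comm_polyC; exact: poly_idealC. Qed.
Let F1h x : F1 * h1P x - h1P x * F1 =
  (F * h x - h x * F)%:P + 'X * (D1 * h1P x - h1P x * D1).
Proof.
have e : h1P x * ('X * D1) = 'X * (h1P x * D1) by rewrite mulrA -XC mulrA.
by rewrite -comm_polyC mulrDr mulrDl e -/(h1P x) -/D1; non_commutative_ring.
Qed.
Let F1h_ideal x : ideal t1 true 1 (F1 * h1P x - h1P x * F1).
Proof.
rewrite F1h; apply: idealD; first exact: poly_idealC.
exact: (idealM X_ideal).
Qed.
Let F1F1 : F1 * F1 - 1 = ('X * 'X - 'X) * (D * D)%:P.
Proof.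
have e : F1 * F1 = (F * F)%:P + 'X * (F * D + D * F)%:P + 'X * 'X * (D * D)%:P.
  have e1 : F%:P * ('X * D1) = 'X * (F%:P * D1) by rewrite mulrA -XC mulrA.
  have e2 : 'X * D1 * ('X * D1) = 'X * 'X * (D1 * D1).
    by rewrite -!mulrA [D1 * (_ * _)]mulrA -XC -mulrA.
  by rewrite !polyCD !polyCM mulrDl !mulrDr e1 e2; non_commutative_ring.
by rewrite e FF FD polyCN; non_commutative_ring.
Qed.
Let DD_ideal : ideal t1 false 2 (D * D)%:P.
Proof. by apply: poly_idealC; exact: (idealM D_ideal D_ideal). Qed.
Let F1F1_ideal : ideal t1 false 2 (F1 * F1 - 1).
Proof.
rewrite F1F1; apply: (@idealM _ _ _ t1 false false 0) => //; apply: idealB => //.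
exact: (idealM X_ideal X_ideal).
Qed.
Let F1D1 : F1 * D1 + D1 * F1 = ('X + 'X - 1) * (D * D)%:P.
Proof.
have e : F1 * D1 + D1 * F1 = (F * D + D * F)%:P + ('X + 'X) * (D * D)%:P.
  have e1 : D1 * ('X * D1) = 'X * (D1 * D1) by rewrite mulrA -XC mulrA.
  by rewrite !polyCD !polyCM mulrDl mulrDr e1; non_commutative_ring.
by rewrite e FD polyCN; non_commutative_ring.
Qed.
Let F1D1_ideal : ideal t1 false 1 (F1 * D1 + D1 * F1).
Proof.
rewrite F1D1; apply: (@ideal_le _ _ _ t1 _ _ 2) => //.
apply: (@idealM _ _ _ t1 false false 0) => //; apply: idealB; last exact: ideal1.
exact: idealD.
Qed.

Let comm1 c x : c * H1 x - H1 x * c = c * h1P x - h1P x * c.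
Proof.
rewrite /H1 mulrDr mulrDl; have -> : l1P x * c = c * l1P x.
  by apply/polyP => i; rewrite coefCM coefMC; exact: l_central.
by non_commutative_ring.
Qed.

Let w1 := bar_comm H1 F1.
Let w1E : w1 = bar_form (fun x => F1 * h1P x - h1P x * F1).
Proof. by apply: eq_bar_form => x; exact: comm1. Qed.
Let w1_class : of_class t1 false 2 w1.
Proof. by rewrite w1E; exact: (of_class_form (p := true)). Qed.

Let H1M x y : H1 (x * y) = H1 x * H1 y.
Proof. by rewrite -![H1 _]polyCD -polyCM -HM. Qed.
Let H1_ideal x : ideal t1 false 0 (H1 x).
Proof. by apply: idealD; exact: poly_idealC. Qed.
Let F1H1 x : ideal t1 true 1 (F1 * H1 x - H1 x * F1).
Proof. by rewrite comm1. Qed.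
Let D1H1 x : ideal t1 true 1 (D1 * H1 x - H1 x * D1).
Proof. by rewrite comm1. Qed.

Let tr_path s : size s = m ->
  tr t1 (bar_d (index_transgression m H1 D1 F1)) s =
  (functional t (G * \prod_(x <- s) (G * H x - H x * G))
   - functional t (F * \prod_(x <- s) (F * H x - H x * F))) *+ m
  - tr t1 (bar_const D1 * w1 ^+ m) s *+ m.+1.
Proof.
move=> sz_s.
rewrite (index_transgressionP H1M H1_ideal F1_ideal F1H1 D1_ideal D1H1)// -/w1.
set T := bar_const F1 * _; set Dw := bar_const D1 * _.
have dF1 : F1^`() = D1 by rewrite /F1 derivD derivM !derivC derivX; non_commutative_ring.
have dFw : bar_map (@deriv S) (bar_const F1 * w1 ^+ m) = Dw + T.
  rewrite bar_deriveM; last exact: derivM.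
  rewrite bar_deriveX; last exact: derivM.
  rewrite bar_derive_const bar_derive_form /= dF1; congr (_ + _ * _).
  apply: eq_bigr => i _; congr (_ * _ * _); apply: eq_bar_form => x.
  by rewrite derivB !derivM dF1 derivD !derivC; non_commutative_ring.
have deg : (m + size s <= 2 * m)%N by rewrite sz_s mul2n addnn.
have summ f : of_class t1 true (2 * m) f -> summable_at t1 (size s) f.
  move=> cf; apply: of_class_summable cf _ deg.
  by rewrite sz_s; case: odd.
have wX_class n : of_class t1 false (n * 2) (w1 ^+ n) by exact: of_classX.
have w_t_class : of_class t1 false 2 (bar_comm H1 D1).
  exact: (of_class_form (p := true)).
have Dw_class : of_class t1 true (2 * m) Dw.
  by apply: of_class_le (of_classM (of_class_const D1_ideal) (wX_class m)); lia.
have T_class : of_class t1 true (2 * m) T.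
  apply: (@of_classM _ _ _ t1 _ true false 0 (2 * m)); first exact: of_class_const.
  apply: of_class_sum => i _.
  have := of_classM (of_classM (wX_class i) w_t_class) (wX_class (m.-1 - i)%N).
  by congr (of_class t1 _ _ _); case: i => /= i; lia.
have -> : tr t1 T s = tr t1 (Dw + T) s - tr t1 Dw s.
  by rewrite trD; [rewrite addrC addKr|exact: summ|exact: summ].
rewrite -dFw tr_bar_map_deriv; last first.
  apply: summ; apply: (@of_classM _ _ _ t1 _ true false 0 (2 * m)); first exact: of_class_const.
  by rewrite mulnC; exact: wX_class.
rewrite !bar_mapM !bar_mapX !bar_map_const !bar_map_form /=.
have eF0 : eval0 F1 = F by rewrite /F1 rmorphD rmorphM /= eval0X !eval0C mul0r addr0.
have eF1 : eval1 F1 = G.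
  by rewrite /F1 rmorphD rmorphM /= eval1X !eval1C mul1r addrC subrK.
rewrite eF0 eF1.
have evalw (e : {rmorphism {poly S} -> S}) c : (forall x, e x%:P = x) -> e F1 = c ->
    bar_form (fun x : A => e (F1 * H1 x - H1 x * F1)) = bar_comm H c.
  move=> eC eF; apply: eq_bar_form => x.
  by rewrite rmorphB !rmorphM /= eF [e (H1 x)]rmorphD !eC.
rewrite (evalw _ _ (@eval1C S) eF1) (evalw _ _ (@eval0C S) eF0).
have FH_ideal x : ideal t true 1 (F * H x - H x * F) by rewrite commH.
have G_ideal : ideal t true 0 G.
  by rewrite -(subrK F G); apply: idealD => //; exact: ideal_le D_ideal.
have GH_ideal x : ideal t true 1 (G * H x - H x * G).
  rewrite commH -(subrK F G) -/D (_ : _ - _ = (D * h x - h x * D) + (F * h x - h x * F)).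
    exact: idealD.
  by non_commutative_ring.
rewrite (tr_index G_ideal GH_ideal)// (tr_index F_ideal FH_ideal)//.
by rewrite mulrS mulrnBl !opprD !addrA.
Qed.

Let u2 : {poly {poly S}} := 'X.
Let K2 : bar A {poly {poly S}} := curvature h2 F2 u2.

Let u2_ideal : ideal t2 false 0 u2. Proof. exact: poly_idealX. Qed.
Let F2_ideal : ideal t2 true 0 F2. Proof. exact: poly_idealC. Qed.
Let D2_ideal : ideal t2 true 1 D2. Proof. exact: poly_idealC. Qed.
Let h2_ideal x : ideal t2 false 0 (h2 x).
Proof. by apply: poly_idealC; exact: poly_idealC. Qed.
Let comm2 (P Q : {poly S}) : P%:P * Q%:P - Q%:P * P%:P = (P * Q - Q * P)%:P.
Proof. by rewrite polyCB !polyCM. Qed.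
Let F2h_ideal x : ideal t2 true 1 (F2 * h2 x - h2 x * F2).
Proof. by rewrite comm2; exact: poly_idealC. Qed.
Let F2F2_ideal : ideal t2 false 2 (F2 * F2 - 1).
Proof. by rewrite -polyC1 -polyCM -polyCB; exact: poly_idealC. Qed.
Let K2_class : of_class t2 false 2 K2.
Proof. exact: curvature_class. Qed.

Let d_u_K : bar_map (@deriv {poly S}) K2 = curvature_u h2 F2 u2.
Proof.
have dM := @derivM {poly S}.
have dC c : bar_map (@deriv {poly S}) (bar_const c%:P) = 0 :> bar A _.
  by rewrite bar_derive_const /= derivC rmorph0.
have dh : bar_map (@deriv {poly S}) (bar_form h2) = 0.
  rewrite bar_derive_form; apply/funext => -[|a [|b s]] //=; exact: derivC.
have du : bar_map (@deriv {poly S}) (bar_const u2) = 1 :> bar A _.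
  by rewrite bar_derive_const /= derivX rmorph1.
rewrite /K2 curvatureE !(bar_mapD, bar_mapB, bar_mapN, bar_deriveM)//.
rewrite dh du !dC curvature_uE.
by non_commutative_ring.
Qed.

Let d_t_h2 : bar_map (@inner_deriv S) (bar_form h2) = 0.
Proof.
rewrite bar_derive_form -[RHS]bar_form0; apply: eq_bar_form => x.
by rewrite [LHS]inner_derivC derivC.
Qed.

Let d_t_K : bar_map (@inner_deriv S) K2 = curvature_t h2 D2 F2 u2.
Proof.
have dM := @inner_derivM S.
have dCE := @inner_derivC S.
have dF : bar_map (@inner_deriv S) (bar_const F2) = bar_const D2 :> bar A _.
  rewrite bar_derive_const /= dCE /F1 derivD derivM !derivC derivX.
  by rewrite add0r mul1r mulr0 addr0.
have d1 : bar_map (@inner_deriv S) 1 = 0 :> bar A _.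
  rewrite -[1]/(bar_const 1%:P : bar A _) bar_derive_const /= dCE -polyC1 derivC.
  by rewrite rmorph0.
have du : bar_map (@inner_deriv S) (bar_const u2) = 0 :> bar A _.
  rewrite bar_derive_const /= (_ : inner_deriv u2 = 0) ?rmorph0//.
  apply/polyP => i; rewrite coef_inner_deriv coefX coef0; case: eqP => _.
    by rewrite -polyC1 derivC.
  exact: deriv0.
rewrite /K2 curvatureE !(bar_mapD, bar_mapB, bar_mapN, bar_deriveM)//.
rewrite d_t_h2 du dF d1 curvature_tE.
by non_commutative_ring.
Qed.

Let D2h x : ideal t2 true 1 (D2 * h2 x - h2 x * D2).
Proof. by rewrite comm2; exact: poly_idealC. Qed.
Let F2D2 : ideal t2 false 1 (F2 * D2 + D2 * F2).
Proof. by rewrite -!polyCM -polyCD; exact: poly_idealC. Qed.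

Let tr_curv s : size s = m ->
  tr t2 (bar_d (curvature_transgression m h2 D2 F2 u2)) s =
  - tr t1 (bar_const D1 * w1 ^+ m) s.
Proof.
move=> sz_s.
have h2M x y : h2 (x * y) = h2 x * h2 y + l2 x * h2 y + h2 x * l2 y.
  by rewrite /h2 /h1P hM !polyCD !polyCM.
have l2_ideal x : ideal t2 false 0 (l2 x).
  by apply: poly_idealC; exact: poly_idealC.
have l2_central x c : l2 x * c = c * l2 x.
  apply/polyP => i; rewrite coefCM coefMC; apply/polyP => j.
  by rewrite coefCM coefMC; exact: l_central.
have u2C c : u2 * c = c * u2 by exact/esym/commr_polyX.
rewrite (curvature_transgressionP m_gt0 h2M h2_ideal l2_ideal l2_central u2C
  u2_ideal F2_ideal D2_ideal F2h_ideal F2F2_ideal D2h F2D2 sz_s).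
rewrite -/K2 -d_u_K -d_t_K.
rewrite -(bar_deriveX (@derivM {poly S})) -(bar_deriveX (@inner_derivM S)).
have deg : (m + size s <= 2 * m)%N by rewrite sz_s mul2n addnn.
have summ f : of_class t2 true (2 * m) f -> summable_at t2 (size s) f.
  move=> cf; apply: of_class_summable cf _ deg.
  by rewrite sz_s; case: odd.
have KX_class : of_class t2 false (2 * m) (K2 ^+ m) by rewrite mulnC; exact: of_classX.
have thK_class : of_class t2 true (2 * m) (bar_form h2 * K2 ^+ m).
  apply: (@of_classM _ _ _ t2 _ true false 0 (2 * m)) => //.
  by apply: of_class_le (of_class_form h2_ideal).
have DK_class : of_class t2 true (2 * m) (bar_const D2 * K2 ^+ m).
  apply: (@of_classM _ _ _ t2 _ true false 0 (2 * m)) => //.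
  by apply: of_class_le (of_class_const D2_ideal).
have thE : bar_form h2 * bar_map (@inner_deriv S) (K2 ^+ m) =
    bar_map (@inner_deriv S) (bar_form h2 * K2 ^+ m).
  rewrite bar_deriveM; last exact: inner_derivM.
  by rewrite d_t_h2 mul0r add0r.
have DE : bar_const D2 * bar_map (@deriv {poly S}) (K2 ^+ m) =
    bar_map (@deriv {poly S}) (bar_const D2 * K2 ^+ m).
  rewrite bar_deriveM; last exact: derivM.
  by rewrite bar_derive_const /= derivC rmorph0 mul0r add0r.
have vanish (e : {rmorphism {poly S} -> S}) u : e ('X * 'X - 'X) = 0 ->
    size u = m -> map_poly e ((bar_form h2 * K2 ^+ m : bar A _) u) = 0.
  move=> e0 sz_u.
  rewrite -[LHS]/(bar_map (map_poly e) (bar_form h2 * K2 ^+ m) u).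
  rewrite bar_mapM bar_mapX.
  have vth : vanishes_below 1 (bar_map (map_poly e) (bar_form h2)).
    by move=> [|//] _; exact: raddf0.
  have vK : vanishes_below 1 (bar_map (map_poly e) K2).
    move=> [|//] _; rewrite /bar_map (_ : K2 [::] = (F1 * F1 - 1)%:P); last first.
      rewrite /K2 curvatureE !(barD, barN, barM_nil) /= !(mulr0, mul0r, oppr0, addr0).
      by rewrite polyCB polyCM.
    by rewrite map_polyC /= F1F1 rmorphM /= e0 mul0r polyC0.
  by apply: (vanishes_belowM vth (vanishes_belowX vK)); rewrite sz_u.
rewrite thE DE; have -> : tr t2 (bar_map (@inner_deriv S) (bar_form h2 * K2 ^+ m)) s = 0.
  rewrite /tr /cyc big1// => k _.
  rewrite [functional _ _]poly_functional_inner_deriv ?mulr0//.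
  - by have := summ _ _ thK_class (rot k s); rewrite size_rot; apply.
  - by apply: vanish; rewrite ?size_rot// rmorphB rmorphM /= eval1X mulr1 subrr.
  - by apply: vanish; rewrite ?size_rot// rmorphB rmorphM /= eval0X mulr0 subrr.
rewrite tr_bar_map_deriv; last exact: summ.
rewrite sub0r; congr (- _); rewrite !bar_mapM !bar_mapX !bar_map_const /=.
have eC (e : {rmorphism {poly {poly S}} -> {poly S}}) : (forall c, e c%:P = c) ->
    bar_map e K2 = bar_const (F1 * F1 - 1) + bar_const (e u2) * w1
      + bar_const (e u2 - e u2 * e u2) * (bar_form h1P * bar_form h1P).
  move=> eCE; rewrite /K2 curvatureE !(bar_mapD, bar_mapB, bar_mapN, bar_mapM).
  rewrite !bar_map_const !bar_map_form w1E.
  have -> : (fun x => e (h2 x)) = h1P by apply/funext => x; exact: eCE.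
  rewrite [e F2]eCE !rmorphB !rmorphM rmorph1 bar_const_form bar_form_const.
  congr (_ + _ * _ + _).
  by apply/funext => -[|a [|b u]]; rewrite barB //= subrr.
rewrite (eC _ (@eval1C {poly S})) (eC _ (@eval0C {poly S})) /=.
rewrite [eval1 u2]eval1X [eval0 u2]eval0X [eval1 D2]eval1C [eval0 D2]eval0C.
rewrite mulr1 mulr0 subr0 subrr !rmorph0 !mul0r !addr0 rmorph1 mul1r.
have -> : tr t1 (bar_const D1 * bar_const (F1 * F1 - 1) ^+ m) s = 0.
  rewrite -rmorphXn -rmorphM /tr /cyc big1// => k _.
  have : (0 < size (rot k s))%N by rewrite size_rot sz_s.
  case: (rot k s) => // x u _.
  by rewrite functional0 mulr0.
rewrite subr0; apply: eq_cyc => u sz_u; rewrite !bar_constM w1E.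
by rewrite (bar_const_formX _ _ _ _).1 // sz_u.
Qed.

Definition transgression (s : seq A) : V :=
  tr t1 (index_transgression m H1 D1 F1) s
  - m.+1%:R * tr t2 (curvature_transgression m h2 D2 F2 u2) s.

Let index_summable : summable_at t1 m.-1 (index_transgression m H1 D1 F1).
Proof.
apply: (@of_class_summable _ _ _ _ _ false (2 * m).-1); last by move: m_gt0; clear; lia.
  exact: index_transgression_class.
by case: (m) m_gt0 => //= n _; rewrite negbK.
Qed.
Let curvature_summable :
  summable_at t2 m.-1 (curvature_transgression m h2 D2 F2 u2).
Proof.
apply: (@of_class_summable _ _ _ _ _ false (2 * m)); last by move: m_gt0; clear; lia.
  exact: curvature_transgression_class.
by case: (m) m_gt0 => //= n _; rewrite negbK.
Qed.

Lemma transgressionP s : size s = m ->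
  (functional t (G * \prod_(x <- s) (G * H x - H x * G))
   - functional t (F * \prod_(x <- s) (F * H x - H x * F))) *+ m =
  (if (1 < m)%N then hoch transgression s else 0).
Proof.
move=> sz_s; have e1 := tr_path sz_s; have e2 := tr_curv sz_s.
set lhs := _ *+ m in e1 *.
have -> : lhs = tr t1 (bar_d (index_transgression m H1 D1 F1)) s
    - m.+1%:R * tr t2 (bar_d (curvature_transgression m h2 D2 F2 u2)) s.
  by rewrite e1 e2 mulrN opprK mulr_natl subrK.
case: ifP => [m_gt1|/negbT]; last first.
    rewrite -leqNgt => m_le1; have s_gt0 : (0 < size s)%N by rewrite sz_s.
  have s_le1 : (size s <= 1)%N by rewrite sz_s.
  case: s s_gt0 s_le1 {sz_s e1 e2 lhs} => [|x [|y s]]// _ _.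
  by rewrite !tr_d1 mulr0 subr0.
rewrite !tr_d ?sz_s// /hoch !sz_s mulrDr opprD addrACA; congr (_ + _).
  rewrite /bar_diff mulr_sumr -sumrB; apply: eq_bigr => i _.
  by rewrite /transgression mulrBr mulrCA.
by rewrite /transgression mulrBr mulrCA.
Qed.

Lemma transgression_normalized s1 s2 : size (s1 ++ 1 :: s2) = m.-1 ->
  (forall k x y, transgression (s1 ++ k *: x + y :: s2) =
     k * transgression (s1 ++ x :: s2) + transgression (s1 ++ y :: s2)) /\
  transgression (s1 ++ 1 :: s2) = 0.
Proof.
move=> sz_s.
have iota1C k c : (iota k)%:P * c = c * (iota k)%:P :> {poly S}.
  by apply/polyP => i; rewrite coefCM coefMC; exact: iotaC.
have iota2C k c : (iota k)%:P%:P * c = c * (iota k)%:P%:P :> {poly {poly S}}.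
  by apply/polyP => i; rewrite coefCM coefMC; exact: iota1C.
pose norm1 := @normalized V A {poly S} (fun k => (iota k)%:P).
pose norm2 := @normalized V A {poly {poly S}} (fun k => (iota k)%:P%:P).
have normw c : norm1 (bar_comm H1 c).
  rewrite /norm1 (_ : bar_comm H1 c = bar_form (fun x => c * h1P x - h1P x * c)).
    apply: normalized_form => [k x y|]; last by rewrite /h1P h1 mulr0 mul0r subrr.
    rewrite /h1P h_linear polyCD polyCM mulrDr mulrDl mulrA -iota1C -!mulrA mulrBr.
    by rewrite opprD addrACA.
  by apply: eq_bar_form => x; exact: comm1.
have normE1 : norm1 (index_transgression m H1 D1 F1).
  apply: normalized_sum => i _; rewrite -signr_odd mulr_sign.
  have nE : norm1 (bar_const F1 * bar_comm H1 F1 ^+ i *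
      (bar_const D1 * bar_comm H1 F1 ^+ (m.-1 - i))).
    do 2!apply: (normalizedM iota1C); try exact: normalized_const.
    - by apply: (normalizedX iota1C); exact: normw.
    - by apply: (normalizedX iota1C); exact: normw.
  by case: odd => //; exact: normalizedN.
have normh : norm2 (bar_form h2).
  apply: normalized_form => [k x y|]; last by rewrite /h2 /h1P h1.
  by rewrite /h2 /h1P h_linear !polyCD !polyCM.
have normK : norm2 K2.
  rewrite /K2 curvatureE.
  have nc c : norm2 (bar_const c) := normalized_const _ c.
  have n1 : norm2 1 := nc 1.
  have nM f g : norm2 f -> norm2 g -> norm2 (f * g) by exact: normalizedM.
  have nB f g : norm2 f -> norm2 g -> norm2 (f - g) by exact: normalizedB.
  have nD f g : norm2 f -> norm2 g -> norm2 (f + g) by exact: normalizedD.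
  by apply: (nD); [apply: (nD)|]; auto 6.
have normE2 : norm2 (curvature_transgression m h2 D2 F2 u2).
  apply: normalized_sum => i _; apply: (normalizedM iota2C).
    apply: (normalized_flip iota2C); apply: (normalizedM iota2C) => //.
    by apply: (normalizedX iota2C); exact: normK.
  apply: (normalizedM iota2C); first exact: normalized_const.
  by apply: (normalizedX iota2C); exact: normK.
have iota1_ideal k : ideal t1 false 0 (iota k)%:P by exact: poly_idealC.
have iota2_ideal k : ideal t2 false 0 (iota k)%:P%:P by exact: poly_idealC.
have [lE1 oE1] := tr_normalized iota1_ideal (poly_functionalZ functionalZ)
  normE1 index_summable sz_s.
have [lE2 oE2] := tr_normalized iota2_ideal
  (poly_functionalZ (poly_functionalZ functionalZ)) normE2 curvature_summable sz_s.
rewrite /transgression; split=> [k x y|]; last by rewrite oE1 oE2 mulr0 subrr.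
by rewrite lE1 lE2 mulrDr opprD addrACA mulrBr [m.+1%:R * (k * _)]mulrCA.
Qed.
End Invariance.

Section RealNorm.
Local Open Scope classical_set_scope.
Local Open Scope ring_scope.
Local Open Scope complex_scope.
Context (R : realType).
Local Notation C := R[i].

Definition nrm (V : normedZmodType C) (x : V) : R := complex.Re `|x|.

Section NormedGroup.
Local Open Scope classical_set_scope.
Local Open Scope ring_scope.
Local Open Scope complex_scope.
Context (V : normedZmodType C).
Implicit Types x y : V.

Lemma nrmE x : `|x| = (nrm x)%:C.
Proof. by rewrite RRe_real// normr_real. Qed.
Lemma nrm_ge0 x : 0 <= nrm x.
Proof. by rewrite -ler0c -nrmE normr_ge0. Qed.
Lemma nrmD x y : nrm (x + y) <= nrm x + nrm y.
Proof. by rewrite -lecR rmorphD /= -!nrmE ler_normD. Qed.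
Lemma nrmN x : nrm (- x) = nrm x.
Proof. by rewrite /nrm normrN. Qed.
Lemma nrmB x y : nrm (x - y) <= nrm x + nrm y.
Proof. by rewrite -(nrmN y) nrmD. Qed.
Lemma nrm0 : nrm (0 : V) = 0.
Proof. by rewrite /nrm normr0. Qed.
Lemma nrm_eq0 x : nrm x = 0 -> x = 0.
Proof. by move=> x0; apply: normr0_eq0; rewrite nrmE x0. Qed.
Lemma nrm_sum I (r : seq I) (P : pred I) (F : I -> V) :
  nrm (\sum_(i <- r | P i) F i) <= \sum_(i <- r | P i) nrm (F i).
Proof.
elim/big_rec2: _ => [|i a b _ ab]; first by rewrite nrm0.
by rewrite (le_trans (nrmD _ _))// lerD2l.
Qed.
Lemma nrmBC x y : nrm (x - y) = nrm (y - x).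
Proof. by rewrite -nrmN opprB. Qed.
Lemma le_nrmP x (r : R) : (`|x| <= r%:C) = (nrm x <= r).
Proof. by rewrite nrmE lecR. Qed.
End NormedGroup.

Lemma nrmZ (V : normedModType C) (k : C) (x : V) : nrm (k *: x) = nrm k * nrm x.
Proof. by apply: complexI; rewrite rmorphM /= -!nrmE normrZ. Qed.
Lemma nrmM (k l : C) : nrm (k * l) = nrm k * nrm l.
Proof. by apply: complexI; rewrite rmorphM /= -!nrmE normrM. Qed.
Lemma nrmR (x : R) : nrm x%:C = `|x|.
Proof. by rewrite /nrm normc_def /= expr0n addr0 sqrtr_sqr. Qed.
Lemma nrmJ (z : C) : nrm (Num.conj z) = nrm z.
Proof. by rewrite /nrm norm_conjC. Qed.
Lemma nrm_sqr (z : C) : z * Num.conj z = (nrm z ^+ 2)%:C.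
Proof. by rewrite rmorphXn /= -nrmE normCK. Qed.
Lemma normr_Re_le (z : C) : `|complex.Re z| <= nrm z.
Proof. by rewrite -lecR -nrmE normc_ge_Re. Qed.
Lemma Re_le_nrm (z : C) : complex.Re z <= nrm z.
Proof. by rewrite (le_trans (ler_norm _))// normr_Re_le. Qed.
Lemma nrm_i : nrm ('i%C : C) = 1.
Proof. by rewrite /nrm normc_def /= expr0n add0r expr1n sqrtr1. Qed.
Lemma nrm_Re_Im (z : C) : nrm z <= `|complex.Re z| + `|complex.Im z|.
Proof.
rewrite {1}(complexE z) (le_trans (nrmD _ _))// nrmM !nrmR nrm_i mul1r.
by rewrite lexx.
Qed.
Lemma normr_Im_le (z : C) : `|complex.Im z| <= nrm z.
Proof. by rewrite -normrN -ReiNIm (le_trans (normr_Re_le _))// nrmM nrm_i mulr1. Qed.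
Lemma addCJ (z : C) : z + Num.conj z = (2 * complex.Re z)%:C.
Proof. by rewrite [LHS]addcJ rmorphM /= rmorph_nat. Qed.
Lemma conjR (x : R) : Num.conj (x%:C : C) = x%:C.
Proof. exact: conjc_real. Qed.
End RealNorm.

Section SemiInner.
Local Open Scope classical_set_scope.
Local Open Scope ring_scope.
Local Open Scope complex_scope.
Context (R : realType) (U : lmodType R[i]).
Local Notation C := R[i].

Record semi_inner (q : U -> U -> C) : Prop := SemiInner {
  si_lin : forall z k x y, q (k *: x + y) z = k * q x z + q y z;
  si_herm : forall x y, q y x = Num.conj (q x y);
  si_ge0 : forall x, 0 <= q x x
}.

Context (q : U -> U -> C) (qP : semi_inner q).

Lemma siDl x y z : q (x + y) z = q x z + q y z.
Proof. by rewrite -{1}[x]scale1r (si_lin qP) mul1r. Qed.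
Lemma si0l z : q 0 z = 0.
Proof. by apply: (addrI (q 0 z)); rewrite -siDl !addr0. Qed.
Lemma siZl k x z : q (k *: x) z = k * q x z.
Proof. by rewrite -[k *: x]addr0 (si_lin qP) si0l addr0. Qed.
Lemma siNl x z : q (- x) z = - q x z.
Proof. by rewrite -scaleN1r siZl mulN1r. Qed.
Lemma siBl x y z : q (x - y) z = q x z - q y z.
Proof. by rewrite siDl siNl. Qed.
Lemma si_suml I (r : seq I) (P : pred I) (F : I -> U) z :
  q (\sum_(i <- r | P i) F i) z = \sum_(i <- r | P i) q (F i) z.
Proof. by elim/big_rec2: _ => [|i a b _ <-]; rewrite ?si0l ?siDl. Qed.
Lemma siDr x y z : q z (x + y) = q z x + q z y.
Proof. by rewrite (si_herm qP) siDl rmorphD /= -!(si_herm qP). Qed.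
Lemma si0r z : q z 0 = 0.
Proof. by rewrite (si_herm qP) si0l rmorph0. Qed.
Lemma siZr k x z : q z (k *: x) = Num.conj k * q z x.
Proof. by rewrite (si_herm qP) siZl rmorphM /= -(si_herm qP). Qed.
Lemma siNr x z : q z (- x) = - q z x.
Proof. by rewrite (si_herm qP) siNl rmorphN /= -(si_herm qP). Qed.
Lemma siBr x y z : q z (x - y) = q z x - q z y.
Proof. by rewrite siDr siNr. Qed.
Lemma si_sumr I (r : seq I) (P : pred I) (F : I -> U) z :
  q z (\sum_(i <- r | P i) F i) = \sum_(i <- r | P i) q z (F i).
Proof. by elim/big_rec2: _ => [|i a b _ <-]; rewrite ?si0r ?siDr. Qed.

Definition qn x : R := complex.Re (q x x).
Lemma qnE x : q x x = (qn x)%:C.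
Proof. by rewrite RRe_real// ger0_real// (si_ge0 qP). Qed.
Lemma qn_ge0 x : 0 <= qn x.
Proof. by rewrite -ler0c -qnE (si_ge0 qP). Qed.

Lemma qn_sub (a : R) (x y : U) (b : C) :
  qn (a%:C *: x - b *: y) =
  a ^+ 2 * qn x + nrm b ^+ 2 * qn y - 2 * a * complex.Re (Num.conj b * q x y).
Proof.
have e : q (a%:C *: x - b *: y) (a%:C *: x - b *: y) = a%:C * a%:C * q x x
    + b * Num.conj b * q y y
    - a%:C * (Num.conj b * q x y + Num.conj (Num.conj b * q x y)).
  have -> : Num.conj (Num.conj b * q x y) = b * q y x.
    by rewrite rmorphM /= conjCK -(si_herm qP).
  by rewrite siBl !siBr !siZl !siZr conjR; ring.
apply: complexI; rewrite -qnE e !qnE nrm_sqr addCJ.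
by rewrite !(rmorphB, rmorphD, rmorphM, rmorphXn) /=; ring.
Qed.

Lemma si_cauchy_schwarz x y : nrm (q x y) ^+ 2 <= qn x * qn y.
Proof.
set b := q x y.
have bb : complex.Re (Num.conj b * b) = nrm b ^+ 2 by rewrite mulrC nrm_sqr.
have [y0|y_gt0] := eqVneq (qn y) 0; last first.
  have {}y_gt0 : 0 < qn y by rewrite lt_def y_gt0 qn_ge0.
  have := qn_ge0 ((qn y)%:C *: x - b *: y); rewrite qn_sub bb => h.
  have {}h : 0 <= qn y * (qn x * qn y - nrm b ^+ 2) by move: h; nra.
  by rewrite pmulr_rge0// subr_ge0 in h.
have [x0|x_gt0] := eqVneq (qn x) 0.
  have := qn_ge0 (1%:C *: x - b *: y); rewrite qn_sub bb x0 y0.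
  by nra.
have {}x_gt0 : 0 < qn x by rewrite lt_def x_gt0 qn_ge0.
have hyx : q y x = Num.conj b by rewrite (si_herm qP).
have bb' : complex.Re (Num.conj (Num.conj b) * Num.conj b) = nrm b ^+ 2.
  by rewrite conjCK nrm_sqr.
have := qn_ge0 ((qn x)%:C *: y - Num.conj b *: x); rewrite qn_sub hyx bb' nrmJ => h.
have {}h : 0 <= qn x * (qn x * qn y - nrm b ^+ 2) by move: h; nra.
by rewrite pmulr_rge0// subr_ge0 in h.
Qed.

Definition orthogonal_seq (e : nat -> U) := forall i j, i <> j -> q (e i) (e j) = 0.

Lemma si_sum_orthogonal (e : nat -> U) (c : nat -> C) N j : orthogonal_seq e ->
  q (\sum_(i < N) c i *: e i) (e j) = (if (j < N)%N then c j * q (e j) (e j) else 0).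
Proof.
move=> oe; rewrite si_suml; case: ifP => [lt_j|/negbT ge_j].
  rewrite (bigD1 (Ordinal lt_j))//= siZl big1 ?addr0// => i /eqP ne_i.
  by rewrite siZl oe ?mulr0// => e_ij; apply: ne_i; apply: val_inj.
rewrite big1// => i _; rewrite siZl oe ?mulr0// => e_ij.
by rewrite -e_ij ltn_ord in ge_j.
Qed.

Lemma qn_sum_orthogonal (e : nat -> U) (c : nat -> C) N : orthogonal_seq e ->
  qn (\sum_(i < N) c i *: e i) = \sum_(i < N) nrm (c i) ^+ 2 * qn (e i).
Proof.
move=> oe; apply: complexI; rewrite -qnE si_sumr rmorph_sum; apply: eq_bigr => i _.
rewrite siZr si_sum_orthogonal// ltn_ord qnE rmorphM /= -nrm_sqr.
by rewrite mulrCA mulrA.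
Qed.

Lemma bessel (e : nat -> U) z N : orthogonal_seq e -> (forall i, qn (e i) <= 1) ->
  \sum_(i < N) nrm (q z (e i)) ^+ 2 <= qn z.
Proof.
move=> oe e1; pose s := \sum_(i < N) q z (e i) *: e i.
have := qn_ge0 (1%:C *: z - 1 *: s); rewrite qn_sub.
have -> : q z s = (\sum_(i < N) nrm (q z (e i)) ^+ 2)%:C.
  rewrite si_sumr rmorph_sum; apply: eq_bigr => i _.
  by rewrite siZr mulrC nrm_sqr.
rewrite conjC1 mul1r /= nrmR normr1.
have : qn s <= \sum_(i < N) nrm (q z (e i)) ^+ 2.
  rewrite (qn_sum_orthogonal (fun i => q z (e i)) N oe); apply: ler_sum => i _.
  by rewrite ler_piMr// sqr_ge0.
by lra.
Qed.

Section GramSchmidt.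
Local Open Scope classical_set_scope.
Local Open Scope ring_scope.
Local Open Scope complex_scope.
Variable u : nat -> U.

Let residue (es : seq U) x := x - \sum_(e <- es) q x e *: e.
Let normalize x := if qn x == 0 then 0 else (Num.sqrt (qn x))^-1%:C *: x.
Let Fixpoint gs n := if n is p.+1 then rcons (gs p) (normalize (residue (gs p) (u p))) else [::].
Let e n := normalize (residue (gs n) (u n)).

Let gsE n : gs n = mkseq e n.
Proof. by elim: n => //= n IHn; rewrite mkseqS -IHn. Qed.
Let residueE n : residue (gs n) (u n) = u n - \sum_(i < n) q (u n) (e i) *: e i.
Proof.
rewrite /residue gsE /mkseq big_map.
by rewrite -(big_mkord xpredT (fun i => q (u n) (e i) *: e i)) /index_iota subn0.
Qed.
Let e01 n : e n = 0 \/ q (e n) (e n) = 1.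
Proof.
rewrite /e /normalize; case: eqP => [_|/eqP r_neq0]; [by left|right].
set r := residue _ _ in r_neq0 *.
have r_gt0 : 0 < qn r by rewrite lt_def r_neq0 qn_ge0.
rewrite siZl siZr conjR qnE -!rmorphM /= mulrA -invfM -expr2 sqr_sqrtr ?qn_ge0//.
by rewrite mulVf.
Qed.
Let orth n : forall i j, (i < n)%N -> (j < n)%N -> i <> j -> q (e i) (e j) = 0.
Proof.
elim: n => // n IHn i j; rewrite !ltnS.
have base k : (k < n)%N -> q (e n) (e k) = 0.
  move=> lt_k; have r_ek : q (residue (gs n) (u n)) (e k) = 0.
    rewrite residueE siBl si_suml (bigD1 (Ordinal lt_k))//= big1 => [|l /eqP ne_l].
      rewrite siZl addr0; have [->|->] := e01 k; last by rewrite mulr1 subrr.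
      by rewrite !si0r mul0r subrr.
    rewrite siZl IHn ?mulr0// => e_lk.
    by apply: ne_l; apply: val_inj.
  rewrite -[LHS]/(q (normalize (residue (gs n) (u n))) (e k)) {1}/normalize.
  by case: ifP => _; rewrite ?si0l// siZl r_ek mulr0.
rewrite leq_eqVlt => /predU1P[->|lt_i]; rewrite leq_eqVlt => /predU1P[->|lt_j] //.
- by move=> _; exact: base.
- by move=> _; rewrite (si_herm qP) base// rmorph0.
exact: IHn.
Qed.

Lemma gram_schmidt : exists2 e : nat -> U,
  (forall n, e n = 0 \/ q (e n) (e n) = 1) /\ orthogonal_seq e &
  forall n, qn (u n - \sum_(i < n.+1) q (u n) (e i) *: e i) = 0.
Proof.
have oe : orthogonal_seq e.
  move=> i j; apply: (@orth (maxn i j).+1); rewrite ltnS; [exact: leq_maxl|exact: leq_maxr].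
exists e; first by split.
move=> n; rewrite big_ord_recr /= opprD addrA -residueE.
set r := residue _ _.
have [r0|r_neq0] := eqVneq (qn r) 0.
  by rewrite {1}/e /normalize -/r r0 eqxx si0r scale0r subr0.
have r_gt0 : 0 < qn r by rewrite lt_def r_neq0 qn_ge0.
have enE : e n = (Num.sqrt (qn r))^-1%:C *: r.
  by rewrite /e /normalize -/r (negbTE r_neq0).
have q_re i : (i < n)%N -> q (e i) r = 0.
  move=> lt_i; have ne_in : i <> n by move=> e_in; rewrite e_in ltnn in lt_i.
  have /eqP := oe i n ne_in.
  rewrite enE siZr conjR mulf_eq0 => /orP[|/eqP//].
  by move=> /eqP/complexI/eqP; rewrite invr_eq0 sqrtr_eq0 leNgt r_gt0.
have q_ur : q (u n) r = (qn r)%:C.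
  have -> : u n = r + \sum_(i < n) q (u n) (e i) *: e i by rewrite /r residueE subrK.
  rewrite siDl si_suml big1 ?addr0 ?qnE// => i _.
  by rewrite siZl q_re ?mulr0.
rewrite enE siZr conjR q_ur scalerA -!rmorphM /= mulrAC -invfM -expr2.
rewrite sqr_sqrtr ?qn_ge0// mulVf// scale1r subrr.
by rewrite /qn si0l.
Qed.
End GramSchmidt.
End SemiInner.

Section Tends.
Local Open Scope classical_set_scope.
Local Open Scope ring_scope.
Local Open Scope complex_scope.
Context (R : realType).
Local Notation C := R[i].

Definition tends (V : normedZmodType C) (s : nat -> V) (l : V) :=
  forall eps : R, 0 < eps -> exists N, forall n, (N <= n)%N -> nrm (s n - l) <= eps.

Definition bounded_sums (a : nat -> R) := exists B, forall N, \sum_(i < N) a i <= B.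

Section Group.
Local Open Scope classical_set_scope.
Local Open Scope ring_scope.
Local Open Scope complex_scope.
Context (V : normedZmodType C).
Implicit Types (s t : nat -> V).

Lemma tends_cst (l : V) : tends (fun=> l) l.
Proof. by move=> eps eps0; exists 0%N => n _; rewrite subrr nrm0 ltW. Qed.
Lemma tendsD s t k l : tends s k -> tends t l -> tends (fun n => s n + t n) (k + l).
Proof.
move=> sk tl eps eps0; have e2 : 0 < eps / 2 by rewrite divr_gt0.
have [[N hN] [P hP]] := (sk _ e2, tl _ e2).
exists (maxn N P) => n; rewrite geq_max => /andP[/hN h1 /hP h2].
rewrite opprD addrACA (le_trans (nrmD _ _))//.
by rewrite [leRHS](splitr eps) lerD.
Qed.
Lemma tendsN s l : tends s l -> tends (fun n => - s n) (- l).
Proof.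
move=> sl eps /sl[N hN]; exists N => n /hN; rewrite -opprD nrmN; exact.
Qed.
Lemma tendsB s t k l : tends s k -> tends t l -> tends (fun n => s n - t n) (k - l).
Proof. by move=> sk /tendsN; exact: tendsD. Qed.
Lemma tends_sum (I : finType) (F : I -> nat -> V) (l : I -> V) :
  (forall i, tends (F i) (l i)) -> tends (fun n => \sum_i F i n) (\sum_i l i).
Proof.
move=> Fl; elim: (index_enum I) => [|i r IHr].
  by have := tends_cst 0; congr tends; [apply/funext => n|]; rewrite big_nil.
have := tendsD (Fl i) IHr; congr tends; [apply/funext => n|]; by rewrite big_cons.
Qed.
Lemma eq_tends s t l : (forall n, s n = t n) -> tends s l -> tends t l.
Proof. by move=> /funext ->. Qed.
Lemma tends_dist s t l : tends s l -> (forall eps : R, 0 < eps -> exists N, forall n,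
  (N <= n)%N -> nrm (t n - s n) <= eps) -> tends t l.
Proof.
move=> sl ts; have : tends (fun n => (t n - s n) + s n) (0 + l).
  by apply: tendsD => // eps /ts[N hN]; exists N => n /hN; rewrite subr0.
by rewrite add0r; apply: eq_tends => n; rewrite subrK.
Qed.
Lemma tends_nrm_le s l c N : tends s l -> (forall n, (N <= n)%N -> nrm (s n) <= c) ->
  nrm l <= c.
Proof.
move=> sl sc; apply/ler_addgt0Pl => eps /sl[P hP].
have := hP _ (leq_maxr N P); have := sc _ (leq_maxl N P) => h1 h2.
rewrite -[l](subKr (s (maxn N P))) (le_trans (nrmB _ _))//.
by rewrite addrC lerD.
Qed.
Lemma tends_unique s k l : tends s k -> tends s l -> k = l.
Proof.
move=> sk sl; apply/eqP; rewrite -subr_eq0; apply/eqP/nrm_eq0/le_anti.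
rewrite nrm_ge0 andbT; apply: (tends_nrm_le (N := 0) (tendsB sk sl)) => n _.
by rewrite subrr nrm0.
Qed.
Lemma tends_cauchy s l : tends s l -> forall eps : R, 0 < eps ->
  exists N, forall n p, (N <= n)%N -> (N <= p)%N -> nrm (s n - s p) <= eps.
Proof.
move=> sl eps eps0; have e2 : 0 < eps / 2 by rewrite divr_gt0.
have [N hN] := sl _ e2; exists N => n p /hN h1 /hN h2.
rewrite -(subrKA l) (le_trans (nrmD _ _))// [leRHS](splitr eps) lerD//.
by rewrite nrmBC.
Qed.
End Group.

Lemma tendsP (V : normedModType C) (s : nat -> V) (l : V) :
  tends s l <-> s @ \oo --> l.
Proof.
split=> [sl|/cvgrPdist_le sl eps eps0].
  apply/cvgrPdist_le => eps eps0.
  have epsE : eps = (complex.Re eps)%:C by rewrite RRe_real// gtr0_real.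
  have [|N hN] := sl (complex.Re eps); first by rewrite -ltcR -epsE.
  exists N => // n /= /hN; rewrite epsE le_nrmP nrmBC; exact.
have [|N _ hN] := sl eps%:C; first by rewrite ltcR.
by exists N => n le_n; rewrite nrmBC -le_nrmP; exact: hN.
Qed.

Lemma tendsZl (V : normedModType C) (k : C) (s : nat -> V) l :
  tends s l -> tends (fun n => k *: s n) (k *: l).
Proof.
move=> sl eps eps0.
have k1 : 0 < nrm k + 1 by rewrite ltr_wpDl// nrm_ge0.
have [|N hN] := sl (eps / (nrm k + 1)); first by rewrite divr_gt0.
exists N => n /hN h; rewrite -scalerBr nrmZ.
rewrite (le_trans (ler_wpM2l (nrm_ge0 k) h))// mulrA ler_pdivrMr//.
by have := nrm_ge0 k; nra.
Qed.

Lemma bounded_sums_tail (a : nat -> R) : (forall n, 0 <= a n) -> bounded_sums a ->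
  forall eps : R, 0 < eps -> exists N, forall p, \sum_(N <= i < p) a i <= eps.
Proof.
move=> a_ge0 [B aB] eps eps0; pose A := [set \sum_(i < N) a i | N in [set: nat]].
have supA : has_sup A by split; [exists (\sum_(i < 0) a i), 0%N|exists B => _ [N _ <-]].
have [_ [N _ <-] hN] := sup_adherent eps0 supA.
exists N => p; have [le_Np|lt_pN] := leqP N p; last by rewrite big_geq ?ltW// ltnW.
have : \sum_(i < p) a i <= sup A by apply: ub_le_sup; [exact: supA.2|exists p].
rewrite -(big_mkord xpredT a) (big_cat_nat (n := N))//= big_mkord.
by move: hN; lra.
Qed.
Lemma bounded_sums_to0 (a : nat -> R) : (forall n, 0 <= a n) -> bounded_sums a ->
  forall eps : R, 0 < eps -> exists N, forall n, (N <= n)%N -> a n <= eps.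
Proof.
move=> a_ge0 aB eps eps0; have [N hN] := bounded_sums_tail a_ge0 aB eps0.
exists N => n le_n; apply: le_trans (hN n.+1).
by rewrite big_nat_recr//= lerDr sumr_ge0.
Qed.

Lemma abs_summable_tends (c : nat -> C) : bounded_sums (fun n => nrm (c n)) ->
  exists l, tends (fun N => \sum_(i < N) c i) l.
Proof.
move=> cB; have real_case (a : nat -> R) : bounded_sums (fun n => `|a n|) ->
    exists l, tends (fun N => (\sum_(i < N) a i)%:C : C) l%:C.
  move=> aB; pose A := fun N => \sum_(i < N) `|a i|.
  pose S := fun N => \sum_(i < N) a i.
  have cvg_of (s : nat -> R) B : (forall n, s n <= s n.+1) -> (forall n, s n <= B) ->
      exists l, tends (fun n => (s n)%:C : C) l%:C.
    move=> inc sB; have : cvgn s.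
      apply: nondecreasing_is_cvgn; first exact/nondecreasing_seqP.
      by exists B => _ [n _ <-].
    move=> /cvg_ex[l /cvgrPdist_le sl]; exists l => eps /sl[N _ hN].
    by exists N => n /hN; rewrite -rmorphB /= nrmR distrC.
  have [B AB] := aB.
  have [l1 h1] : exists l, tends (fun n => (A n)%:C : C) l%:C.
    by apply: (cvg_of _ B) => // n; rewrite /A big_ord_recr /= lerDl.
  have [l2 h2] : exists l, tends (fun n => (A n + S n)%:C : C) l%:C.
    apply: (cvg_of _ (B + B)) => n.
      rewrite /A /S !big_ord_recr /= addrACA lerDl.
      by have := ler_norm (- a n); rewrite normrN; lra.
    rewrite lerD// ?AB// (le_trans _ (AB n))//.
    by apply: ler_sum => i _; exact: ler_norm.
  exists (l2 - l1); have := tendsB h2 h1; rewrite -rmorphB /=.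
  by apply: eq_tends => n; rewrite -rmorphB /= addrAC subrr add0r.
have [B cB'] := cB.
have [|l1 h1] := real_case (fun i => complex.Re (c i)).
  exists B => N; apply: le_trans (cB' N).
  by apply: ler_sum => i _; exact: normr_Re_le.
have [|l2 h2] := real_case (fun i => complex.Im (c i)).
  exists B => N; apply: le_trans (cB' N).
  by apply: ler_sum => i _; exact: normr_Im_le.
exists (l1%:C + 'i%C * l2%:C); have := tendsD h1 (@tendsZl C^o 'i%C _ _ h2).
apply: eq_tends => N; rewrite !rmorph_sum /= scaler_sumr -big_split.
by apply: eq_bigr => i _; rewrite [RHS]complexE.
Qed.
End Tends.

Section Hilbert.
Local Open Scope classical_set_scope.
Local Open Scope ring_scope.
Local Open Scope complex_scope.
Context (R : realType) (H : separableHilbertType R).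
Local Notation C := R[i].
Local Notation L := (bounded_operator H).
Local Notation ip := (fun x y : H => inner x y).
Implicit Types (x y z : H) (X Y Z : L).

Lemma inner_semi_inner : semi_inner ip.
Proof.
split=> [z k x y|x y|x].
- by rewrite linearDl linearZl_LR.
- by rewrite hermC expr0 mul1r.
- by rewrite inner_normE exprn_ge0.
Qed.
Local Notation iP := inner_semi_inner.

Lemma qn_inner x : qn ip x = nrm x ^+ 2.
Proof. by rewrite /qn inner_normE nrmE -rmorphXn. Qed.

Lemma operatorZ X (k : C) x : X (k *: x) = k *: X x.
Proof. exact: linearZ. Qed.
Lemma operator_sum X N (x : 'I_N -> H) : X (\sum_(i < N) x i) = \sum_(i < N) X (x i).
Proof. exact: linear_sum. Qed.

Lemma nrm_le_sqr (x : H) r : 0 <= r -> nrm x ^+ 2 <= r ^+ 2 -> nrm x <= r.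
Proof. by move=> r0; rewrite ler_sqr ?nnegrE ?nrm_ge0. Qed.

Lemma cauchy_schwarz x y : nrm (inner x y) <= nrm x * nrm y.
Proof.
rewrite -ler_sqr ?nnegrE ?mulr_ge0 ?nrm_ge0// exprMn.
by have := si_cauchy_schwarz iP x y; rewrite !qn_inner.
Qed.

Lemma operator_bound X : exists2 M : R, 0 <= M & forall x, nrm (X x) <= M * nrm x.
Proof.
have [M XM] := operator_bounded X; exists `|complex.Re M| => // x.
have := XM x; rewrite !nrmE => h.
have [x0|x_gt0] := leP (nrm x) 0.
  have -> : x = 0 by apply: nrm_eq0; apply: le_anti; rewrite x0 nrm_ge0.
  by rewrite linear0 nrm0 mulr0.
have : 0 <= M * (nrm x)%:C by rewrite (le_trans _ h)// ler0c nrm_ge0.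
have xc : 0 < (nrm x)%:C :> C by rewrite ltcR.
rewrite (pmulr_lge0 _ xc) => M0.
rewrite -[M]RRe_real ?ger0_real// -rmorphM /= lecR in h.
by rewrite (le_trans h)// ler_wpM2r ?nrm_ge0// ler_norm.
Qed.

Lemma cauchy_tends (s : nat -> H) : (forall eps : R, 0 < eps ->
    exists N, forall n p, (N <= n)%N -> (N <= p)%N -> nrm (s n - s p) <= eps) ->
  exists l, tends s l.
Proof.
move=> sC; suff : cvgn s by move=> /cvg_ex[l /tendsP sl]; exists l.
apply/cauchy_cvgP/cauchyP => eps eps0.
have epsE : eps = (complex.Re eps)%:C by rewrite RRe_real// gtr0_real.
have Re0 : 0 < complex.Re eps by rewrite -ltcR -epsE.
have [|N hN] := sC (complex.Re eps / 2); first by rewrite divr_gt0.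
exists (s N), N => // n /= hn; rewrite -ball_normE /ball_ /=.
rewrite epsE nrmE ltcR (le_lt_trans (hN _ _ (leqnn N) hn))//.
by rewrite ltr_pdivrMr// ltr_pMr// ltr1n.
Qed.

Lemma tends_operator X (s : nat -> H) l : tends s l -> tends (fun n => X (s n)) (X l).
Proof.
move=> sl eps eps0; have [M M0 XM] := operator_bound X.
have M1 : 0 < M + 1 by rewrite ltr_wpDl.
have [|N hN] := sl (eps / (M + 1)); first by rewrite divr_gt0.
exists N => n /hN h; rewrite -linearB (le_trans (XM _))//.
by rewrite (le_trans (ler_wpM2l M0 h))// mulrA ler_pdivrMr//; nra.
Qed.

Lemma tends_innerl y (s : nat -> H) l :
  tends s l -> tends (fun n => inner (s n) y : C) (inner l y).
Proof.
move=> sl eps eps0; have y1 : 0 < nrm y + 1 by rewrite ltr_wpDl ?nrm_ge0.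
have [|N hN] := sl (eps / (nrm y + 1)); first by rewrite divr_gt0.
exists N => n /hN h; rewrite -(siBl iP) (le_trans (cauchy_schwarz _ _))//.
rewrite (le_trans (ler_wpM2r (nrm_ge0 y) h))// mulrAC ler_pdivrMr//.
by have := nrm_ge0 y; nra.
Qed.

Lemma tends_innerr y (s : nat -> H) l :
  tends s l -> tends (fun n => inner y (s n) : C) (inner y l).
Proof.
move=> /(tends_innerl y) sl eps /sl[N hN]; exists N => n /hN.
by rewrite -nrmJ rmorphB /= -!(si_herm iP).
Qed.

(** * bases *)
Definition expansion (e : nat -> H) x N : H := \sum_(i < N) inner x (e i) *: e i.

Lemma basis_orthogonal e : orthonormal_basis e -> orthogonal_seq ip e.
Proof. by case=> _ oe _ i j; exact: oe. Qed.
Lemma basis_le1 (e : nat -> H) i : (e i = 0 \/ inner (e i) (e i) = 1) -> qn ip (e i) <= 1.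
Proof. by rewrite /qn /=; case=> ->; rewrite ?(si0l iP)//= ler01. Qed.

Lemma orthogonal_tail_sqr (e : nat -> H) (c : nat -> C) N p :
  orthogonal_seq ip e -> (forall i, qn ip (e i) <= 1) -> (N <= p)%N ->
  nrm (\sum_(i < p) c i *: e i - \sum_(i < N) c i *: e i) ^+ 2 <=
  \sum_(N <= i < p) nrm (c i) ^+ 2.
Proof.
move=> oe e1 le_Np; rewrite -qn_inner.
pose d i := if (N <= i)%N then c i else 0.
have -> : \sum_(i < p) c i *: e i - \sum_(i < N) c i *: e i = \sum_(i < p) d i *: e i.
  rewrite -!(big_mkord xpredT (fun i => c i *: e i)).
  rewrite -(big_mkord xpredT (fun i => d i *: e i)).
  rewrite (big_cat_nat (n := N))//= [in RHS](big_cat_nat (n := N))//= addrAC subrr add0r.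
  rewrite [X in _ = X + _]big_nat [X in _ = X + _]big1 => [|i lt_i].
    by rewrite add0r big_nat [RHS]big_nat; apply: eq_bigr => i; rewrite /d => /andP[-> _].
  by rewrite /d leqNgt (andP lt_i).2 scale0r.
rewrite (qn_sum_orthogonal iP)// -(big_mkord xpredT (fun i => nrm (d i) ^+ 2 * qn ip (e i))).
rewrite (big_cat_nat (n := N))//=.
rewrite [X in X + _]big_nat [X in X + _]big1 => [|i lt_i]; last first.
  by rewrite /d leqNgt (andP lt_i).2 /= nrm0 expr0n mul0r.
rewrite add0r big_nat [leRHS]big_nat; apply: ler_sum => i; rewrite /d => /andP[-> _].
by rewrite ler_piMr// sqr_ge0.
Qed.

Lemma square_summable_tends (e : nat -> H) (c : nat -> C) :
  orthogonal_seq ip e -> (forall i, qn ip (e i) <= 1) ->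
  bounded_sums (fun i => nrm (c i) ^+ 2) ->
  exists l, tends (fun N => \sum_(i < N) c i *: e i) l.
Proof.
move=> oe e1 bs; apply: cauchy_tends => eps eps0.
have eps2 : 0 < eps / 2 by rewrite divr_gt0.
have [N hN] := bounded_sums_tail (fun n => sqr_ge0 _) bs (exprn_gt0 2 eps2).
pose S n := \sum_(i < n) c i *: e i.
have half p : (N <= p)%N -> nrm (S p - S N) <= eps / 2.
  move=> le_Np; apply: nrm_le_sqr; first exact: ltW.
  exact: le_trans (orthogonal_tail_sqr _ oe e1 le_Np) (hN p).
exists N => n p hn hp; rewrite -(subrKA (S N)) (le_trans (nrmD _ _))//.
by rewrite [leRHS](splitr eps) lerD ?half// nrmBC half.
Qed.

Lemma expansion_tends e x : orthonormal_basis e -> tends (expansion e x) x.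
Proof.
move=> be; have oe := basis_orthogonal be; have [e01 _ etot] := be.
have e1 i := basis_le1 (e01 i).
have [l hl] : exists l, tends (expansion e x) l.
  apply: (square_summable_tends (c := fun i => inner x (e i))) => //.
  by exists (qn ip x) => N; apply: (bessel iP).
suff xl : x = l by rewrite {2}xl.
apply: subr0_eq; apply: etot => n; rewrite (siBl iP).
apply/eqP; rewrite subr_eq0; apply/eqP.
apply: (@tends_unique _ C (fun N => inner (expansion e x N) (e n))); last exact: tends_innerl.
move=> eps eps0; exists n.+1 => N hN; rewrite /expansion.
rewrite (si_sum_orthogonal iP (fun i => inner x (e i)))// hN.
have [->|->] := e01 n; last by rewrite mulr1 subrr nrm0 ltW.
by rewrite !(si0r iP) mulr0 subrr nrm0 ltW.
Qed.

Lemma parseval e x y : orthonormal_basis e ->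
  tends (fun N => \sum_(i < N) inner x (e i) * Num.conj (inner y (e i)) : C) (inner x y).
Proof.
move=> be; have := tends_innerl y (expansion_tends x be); apply: eq_tends => N.
by rewrite (si_suml iP); apply: eq_bigr => i _; rewrite (siZl iP) -(si_herm iP).
Qed.

Lemma dense_orthonormal_basis (u : nat -> H) :
  (forall x, (forall n, inner x (u n) = 0) -> x = 0) ->
  exists2 e, orthonormal_basis e & forall n x,
    (forall i, (i <= n)%N -> inner x (e i) = 0) -> inner x (u n) = 0.
Proof.
move=> u_total; have [e [e01 oe] spans] := gram_schmidt iP u.
have eu n x : (forall i, (i <= n)%N -> inner x (e i) = 0) -> inner x (u n) = 0.
  move=> xe; have /eqP := spans n; rewrite qn_inner expf_eq0 /= => /eqP/nrm_eq0/subr0_eq ->.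
  rewrite (si_sumr iP) big1// => i _; rewrite (siZr iP) xe ?mulr0//.
  by have := ltn_ord i; rewrite ltnS.
exists e => //; split=> // x xe; apply: u_total => n; exact: eu.
Qed.

Lemma chosen_basisP : orthonormal_basis (chosen_basis H).
Proof.
suff : exists e : nat -> H, orthonormal_basis e by move=> [e he]; exact: (xgetI _ he).
have [D cD dD] := @separable R H.
have [u uD] : exists u : nat -> H, forall x, D x -> exists n, u n = x.
  have /countable_injP[f f_inj] := cD; exists (fun n => xget 0 [set x | D x /\ f x = n]).
  move=> x Dx; exists (f x); have [Dg fg] : D (xget 0 [set y | D y /\ f y = f x]) /\
      f (xget 0 [set y | D y /\ f y = f x]) = f x by exact: (@xgetI _ 0 [set y | D y /\ f y = f x] x).
  by apply: f_inj; rewrite ?inE.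
have [|e be _] := @dense_orthonormal_basis u; last by exists e.
move=> x xu; apply: nrm_eq0; apply: le_anti; rewrite nrm_ge0 andbT.
apply/ler_addgt0Pl => eps eps0; rewrite addr0.
have epsC : 0 < eps%:C :> C by rewrite ltcR.
have [||y [xy /uD[n uny]]] := dD (ball x (eps%:C)).
- by exists x; apply: ballxx.
- exact: ball_open.
have [x0|x_gt0] := leP (nrm x) 0; first by rewrite (le_trans x0)// ltW.
rewrite -(ler_pM2l x_gt0) -expr2 -qn_inner.
have -> : qn ip x = complex.Re (inner x (x - y)).
  by rewrite (siBr iP) -uny xu subr0.
rewrite (le_trans (Re_le_nrm _))// (le_trans (cauchy_schwarz _ _))//.
rewrite ler_wpM2l ?nrm_ge0//; move: xy.
by rewrite -ball_normE /ball_ /= nrmE ltcR => /ltW.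
Qed.

Lemma inner_extr y z : (forall x, inner x y = inner x z) -> y = z.
Proof.
move=> yz; apply: subr0_eq; apply: nrm_eq0; apply/eqP; rewrite -sqrf_eq0 -qn_inner.
by rewrite /qn (siBr iP) yz subrr.
Qed.

Lemma adjoint_exists X : exists Y, adjoint_of X Y.
Proof.
have be := chosen_basisP; set e := chosen_basis H in be *.
have oe := basis_orthogonal be; have [e01 _ etot] := be.
have e1 i := basis_le1 (e01 i); have [M M0 XM] := operator_bound X.
have [z hz] : {z : H -> H & forall y,
    tends (fun N => \sum_(i < N) inner y (X (e i)) *: e i) (z y)}.
  apply: (@choice _ _ (fun y w => tends (fun N => \sum_(i < N) inner y (X (e i)) *: e i) w)).
  move=> y; pose c i := inner y (X (e i)).
  apply: (square_summable_tends (c := c)) => //.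
  exists ((M * nrm y) ^+ 2) => N; set S := \sum_(i < N) _.
  have S0 : 0 <= S by apply: sumr_ge0 => i _; exact: sqr_ge0.
  pose s := \sum_(i < N) c i *: e i.
  have sS : nrm s ^+ 2 <= S.
    rewrite -qn_inner (qn_sum_orthogonal iP)//; apply: ler_sum => i _.
    by rewrite ler_piMr// sqr_ge0.
  have SE : S%:C = inner y (X s) :> C.
    rewrite linear_sum (si_sumr iP) rmorph_sum; apply: eq_bigr => i _.
    by rewrite linearZ /= (siZr iP) -/(c i) mulrC nrm_sqr.
  have : nrm (S%:C : C) <= nrm y * (M * nrm s).
    by rewrite SE (le_trans (cauchy_schwarz _ _))// ler_wpM2l ?nrm_ge0.
  rewrite nrmR ger0_norm// => SM.
  have h : S ^+ 2 <= (M * nrm y) ^+ 2 * S.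
    rewrite (le_trans (_ : _ <= (M * nrm y * nrm s) ^+ 2))//.
      by rewrite ler_sqr ?nnegrE ?mulr_ge0 ?nrm_ge0// (le_trans SM)// mulrCA mulrA.
    by rewrite exprMn ler_wpM2l ?sqr_ge0.
  have [->|S_neq0] := eqVneq S 0; first exact: sqr_ge0.
  by rewrite -(ler_pM2r (_ : 0 < S)) -?expr2// lt_def S_neq0.
have adj x y : inner (X x) y = inner x (z y).
  apply: (@tends_unique _ C (fun N => inner (X (expansion e x N)) y)).
    by apply: tends_innerl; apply: tends_operator; exact: expansion_tends.
  have := tends_innerr x (hz y); apply: eq_tends => N.
  rewrite /expansion (si_sumr iP) (operator_sum X) (si_suml iP); apply: eq_bigr => i _.
  by rewrite operatorZ (siZl iP) (siZr iP) -(si_herm iP) mulrC.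
have zl : linear z.
  move=> k y y'; apply: inner_extr => x.
  by rewrite -adj !(siDr iP) !(siZr iP) !adj.
have zb : exists M : C, forall y, `|z y| <= M * `|y|.
  exists M%:C => y; rewrite !nrmE -rmorphM /= lecR.
  have [->|z_neq0] := eqVneq (nrm (z y)) 0; first by rewrite mulr_ge0 ?nrm_ge0.
  rewrite -(ler_pM2l (_ : 0 < nrm (z y))) ?lt_def ?z_neq0 ?nrm_ge0//.
  rewrite -expr2 -qn_inner /qn -adj (le_trans (Re_le_nrm _))//.
  rewrite (le_trans (cauchy_schwarz _ _))// mulrA [nrm (z y) * M]mulrC.
  by rewrite ler_wpM2r ?nrm_ge0.
by exists (BoundedOperator zl zb).
Qed.
End Hilbert.

Section SmallOperators.
Local Open Scope classical_set_scope.
Local Open Scope ring_scope.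
Local Open Scope complex_scope.
Context (R : realType) (H : separableHilbertType R) (m : nat).
Hypothesis m_gt0 : (0 < m)%N.
Local Notation C := R[i].
Local Notation L := (bounded_operator H).
Local Notation ip := (fun x y : H => inner x y).
Local Notation iP := (@inner_semi_inner R H).
Implicit Types (x y z : H) (X Y Z : L).

Definition orthogonal_below (w : nat -> seq H) n x :=
  forall j v, (j < n)%N -> v \in w j -> inner x v = 0.

Definition dominates (b : nat -> R) (w : nat -> seq H) k X :=
  exists2 M : R, 0 <= M & forall n x, orthogonal_below w n x -> nrm (X x) <= M * b n ^+ k * nrm x.

Definition summable_scale (b : nat -> R) :=
  (forall n, 0 <= b n) /\ bounded_sums (fun n => b n ^+ m).

Definition small k X := exists c w b,
  [/\ forall j, (size (w j) <= c)%N, summable_scale b & dominates b w k X].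

Lemma summable_scaleD b1 b2 : summable_scale b1 -> summable_scale b2 ->
  summable_scale (fun n => b1 n + b2 n).
Proof.
move=> [p1 [B1 h1]] [p2 [B2 h2]]; split=> [n|]; first by rewrite addr_ge0.
exists (2 ^+ m * (B1 + B2)) => N.
rewrite (le_trans (_ : _ <= \sum_(i < N) 2 ^+ m * (b1 i ^+ m + b2 i ^+ m)))//.
  apply: ler_sum => i _; have [le12|/ltW le21] := leP (b1 i) (b2 i).
    rewrite (le_trans (_ : _ <= (2 * b2 i) ^+ m))//.
      by rewrite lerXn2r ?nnegrE ?addr_ge0 ?mulr_ge0// mulr_natl mulr2n lerD2r.
    by rewrite exprMn ler_wpM2l ?exprn_ge0// lerDr exprn_ge0.
  rewrite (le_trans (_ : _ <= (2 * b1 i) ^+ m))//.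
    by rewrite lerXn2r ?nnegrE ?addr_ge0 ?mulr_ge0// mulr_natl mulr2n lerD2l.
  by rewrite exprMn ler_wpM2l ?exprn_ge0// lerDl exprn_ge0.
by rewrite -mulr_sumr ler_wpM2l ?exprn_ge0// big_split lerD.
Qed.

Lemma summable_scale_le b : summable_scale b -> exists2 B : R, 0 <= B & forall n, b n <= B.
Proof.
move=> [b0 [S hS]]; have S0 : 0 <= S by have := hS 0%N; rewrite big_ord0.
exists (1 + S) => [|n]; first by rewrite addr_ge0.
have [b1|b1] := leP (b n) 1; first by rewrite (le_trans b1)// lerDl.
rewrite (le_trans (_ : _ <= b n ^+ m))//; first by rewrite -{1}[b n]expr1 ler_weXn2l// ltW.
rewrite (le_trans (_ : _ <= S)) ?lerDr//; apply: le_trans (hS n.+1).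
by rewrite big_ord_recr /= lerDr sumr_ge0// => i _; rewrite exprn_ge0.
Qed.

Lemma dominates_widen (b1 b2 : nat -> R) (w1 w2 : nat -> seq H) k X :
  (forall n, 0 <= b1 n) -> (forall n, b1 n <= b2 n) ->
  (forall j v, v \in w1 j -> v \in w2 j) -> dominates b1 w1 k X -> dominates b2 w2 k X.
Proof.
move=> b1_ge0 b12 w12 [M M0 hX]; exists M => // n x xw.
rewrite (le_trans (hX n x _))//; first by move=> j v lt_jn /w12; exact: xw.
by rewrite ler_wpM2r ?nrm_ge0// ler_wpM2l// lerXn2r ?nnegrE// (le_trans (b1_ge0 n)).
Qed.

Lemma scale_merge c1 c2 w1 w2 b1 b2 :
  (forall j, (size (w1 j) <= c1)%N) -> summable_scale b1 ->
  (forall j, (size (w2 j) <= c2)%N) -> summable_scale b2 -> exists c w b,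
  [/\ forall j, (size (w j) <= c)%N, summable_scale b &
   forall k X, dominates b1 w1 k X \/ dominates b2 w2 k X -> dominates b w k X].
Proof.
move=> s1 p1 s2 p2; exists (c1 + c2)%N, (fun j => w1 j ++ w2 j), (fun n => b1 n + b2 n).
split=> [j||k X [] h].
- by rewrite size_cat leq_add.
- exact: summable_scaleD.
- apply: dominates_widen h; [exact: p1.1|by move=> n; rewrite lerDl p2.1|].
  by move=> j v; rewrite mem_cat => ->.
- apply: dominates_widen h; [exact: p2.1|by move=> n; rewrite lerDr p1.1|].
  by move=> j v; rewrite mem_cat orbC => ->.
Qed.

Lemma small_pair k l X Y : small k X -> small l Y -> exists c w b,
  [/\ forall j, (size (w j) <= c)%N, summable_scale b, dominates b w k X & dominates b w l Y].
Proof.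
move=> [c1 [w1 [b1 [s1 p1 h1]]]] [c2 [w2 [b2 [s2 p2 h2]]]].
have [c [w [b [s p h]]]] := scale_merge s1 p1 s2 p2.
by exists c, w, b; split=> //; apply: h; [left|right].
Qed.

Lemma smallB k X Y : small k X -> small k Y -> small k (X - Y).
Proof.
move=> /small_pair /[apply] -[c [w [b [wc sb [M M0 hX] [N N0 hY]]]]].
exists c, w, b; split=> //; exists (M + N) => [|n x xw]; first by rewrite addr_ge0.
by rewrite (le_trans (nrmB (X x) (Y x)))// !mulrDl lerD ?hX ?hY.
Qed.

Lemma small_all X : small 0 X.
Proof.
have [M M0 XM] := operator_bound X; exists 0%N, (fun=> [::]), (fun=> 0); split=> //.
  split=> //; exists 0 => N; rewrite big1// => i _.
  by rewrite expr0n; case: (m) m_gt0.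
by exists M => // n x _; rewrite mulr1.
Qed.

Lemma small_le k l X : (k <= l)%N -> small l X -> small k X.
Proof.
move=> le_kl [c [w [b [wc sb [M M0 hX]]]]]; have [B B0 hB] := summable_scale_le sb.
exists c, w, b; split=> //; exists (M * B ^+ (l - k)); first by rewrite mulr_ge0// exprn_ge0.
move=> n x /hX /le_trans -> //; rewrite ler_wpM2r ?nrm_ge0// -mulrA ler_wpM2l//.
rewrite -{1}(subnK le_kl) exprD ler_wpM2r ?exprn_ge0 ?sb.1//.
by rewrite lerXn2r ?nnegrE// sb.1.
Qed.

Lemma smallM k l X Y : small k X -> small l Y -> small (k + l) (X * Y).
Proof.
move=> /small_pair /[apply] -[c [w [b [wc sb [M M0 hX] [N N0 hY]]]]].
have [Z XZ] := adjoint_exists Y.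
exists (c + c)%N, (fun j => w j ++ map Z (w j)), b; split=> //.
  by move=> j; rewrite size_cat size_map leq_add.
exists (M * N) => [|n x xw]; first by rewrite mulr_ge0.
rewrite (le_trans (hX n (Y x) _))//.
  by move=> j v lt_jn v_w; rewrite XZ; apply: (xw j) => //; rewrite mem_cat map_f ?orbT.
rewrite (le_trans (ler_wpM2l _ (hY n x _)))//; first by rewrite mulr_ge0 ?exprn_ge0 ?sb.1.
  by move=> j v lt_jn v_w; apply: (xw j) => //; rewrite mem_cat v_w.
by rewrite exprD; lra.
Qed.

Lemma small_adjoint k X Y : adjoint_of X Y -> small k X -> small k Y.
Proof.
move=> XY [c [w [b [wc sb [M M0 hX]]]]].
exists c, (fun j => map X (w j)), b; split=> //; first by move=> j; rewrite size_map.
exists M => // n x xw; have Yx : orthogonal_below w n (Y x).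
  move=> j v lt_jn v_w; rewrite (si_herm iP) -XY -(si_herm iP).
  by apply: (xw j) => //; exact: map_f.
have := hX n (Y x) Yx => h.
have [->|Y_neq0] := eqVneq (nrm (Y x)) 0; first by rewrite !mulr_ge0 ?nrm_ge0 ?exprn_ge0 ?sb.1.
rewrite -(ler_pM2l (_ : 0 < nrm (Y x))) ?lt_def ?Y_neq0 ?nrm_ge0//.
rewrite -expr2 -qn_inner /qn -XY (le_trans (Re_le_nrm _))//.
rewrite (le_trans (cauchy_schwarz _ _))// mulrA ler_wpM2r ?nrm_ge0//.
by rewrite [leRHS]mulrC.
Qed.
End SmallOperators.

Section BesselDefect.
Local Open Scope classical_set_scope.
Local Open Scope ring_scope.
Local Open Scope complex_scope.
Context (R : realType) (U : lmodType R[i]) (q : U -> U -> R[i]).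
Hypothesis qP : semi_inner q.
Variables (g : nat -> U).
Hypotheses (og : orthogonal_seq q g) (g1 : forall i, qn q (g i) <= 1).

Definition bessel_defect N x y := q x y - \sum_(i < N) q x (g i) * q (g i) y.

Lemma bessel_defectE N x :
  bessel_defect N x x = (qn q x - \sum_(i < N) nrm (q x (g i)) ^+ 2)%:C.
Proof.
rewrite /bessel_defect rmorphB rmorph_sum /= -(qnE qP); congr (_ - _).
by apply: eq_bigr => i _; rewrite -nrm_sqr -(si_herm qP).
Qed.

Lemma semi_inner_bessel_defect N : semi_inner (bessel_defect N).
Proof.
split=> [z k x y|x y|x].
- rewrite /bessel_defect (si_lin qP).
  have -> : \sum_(i < N) q (k *: x + y) (g i) * q (g i) z =
      k * \sum_(i < N) q x (g i) * q (g i) z + \sum_(i < N) q y (g i) * q (g i) z.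
    rewrite mulr_sumr -big_split; apply: eq_bigr => i _.
    by rewrite (si_lin qP) mulrDl mulrA.
  by rewrite mulrBr opprD addrACA.
- rewrite /bessel_defect rmorphB rmorph_sum /= -(si_herm qP); congr (_ - _).
  by apply: eq_bigr => i _; rewrite rmorphM /= -!(si_herm qP) mulrC.
- by rewrite bessel_defectE ler0c subr_ge0 bessel.
Qed.

Lemma bessel_defect_le N x y : (forall z, bessel_defect N y z = 0) ->
  qn q x <= \sum_(i < N) nrm (q x (g i)) ^+ 2 + qn q (x - y).
Proof.
move=> y0; have dP := semi_inner_bessel_defect N.
have y0' z : bessel_defect N z y = 0 by rewrite (si_herm dP) y0 rmorph0.
rewrite -lerBlDl.
have -> : qn q x - \sum_(i < N) nrm (q x (g i)) ^+ 2 =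
    qn q (x - y) - \sum_(i < N) nrm (q (x - y) (g i)) ^+ 2.
  apply: complexI; rewrite -!bessel_defectE.
  by rewrite (siBl dP) !(siBr dP) !y0 !y0' !subr0.
by rewrite lerBlDl lerDr sumr_ge0// => i _; exact: sqr_ge0.
Qed.
End BesselDefect.

Lemma gram_schmidt_defect (R : realType) (U : lmodType R[i]) (q : U -> U -> R[i])
    (u g : nat -> U) : semi_inner q -> orthogonal_seq q g ->
  (forall n, qn q (u n - \sum_(i < n.+1) q (u n) (g i) *: g i) = 0) ->
  forall N n z, (n < N)%N -> bessel_defect q g N (u n) z = 0.
Proof.
move=> qP og spans N n z lt_nN.
have uE y : q (u n) y = \sum_(i < n.+1) q (u n) (g i) * q (g i) y.
  have := si_cauchy_schwarz qP (u n - \sum_(i < n.+1) q (u n) (g i) *: g i) y.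
  rewrite spans mul0r real_exprn_even_le0 ?num_real//= => /eqP/nrm_eq0.
  rewrite (siBl qP) => /subr0_eq ->; rewrite (si_suml qP).
  by apply: eq_bigr => i _; rewrite (siZl qP).
rewrite /bessel_defect {1}uE -!(big_mkord xpredT (fun i => q (u n) (g i) * q (g i) z)).
rewrite [X in _ - X](big_cat_nat (n := n.+1))//= opprD addrA subrr add0r.
rewrite big_nat big1 ?oppr0// => j /andP[lt_nj _].
rewrite uE big1 ?mul0r// => i _.
by rewrite og ?mulr0// => e_ij; move: lt_nj; rewrite -e_ij ltnNge -ltnS ltn_ord.
Qed.

Section PositiveOperators.
Local Open Scope classical_set_scope.
Local Open Scope ring_scope.
Local Open Scope complex_scope.
Context (R : realType) (H : separableHilbertType R).
Local Notation C := R[i].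
Local Notation L := (bounded_operator H).
Local Notation ip := (fun x y : H => inner x y).
Local Notation iP := (@inner_semi_inner R H).
Implicit Types (x y z : H) (X Y Z : L).

Definition form X x y := inner (X x) y.

Lemma positive_form X : positive_operator X -> semi_inner (form X).
Proof.
move=> X0; have lin z k x y : form X (k *: x + y) z = k * form X x z + form X y z.
  by rewrite /form linearP (si_lin iP).
have addr x y z : form X z (x + y) = form X z x + form X z y by rewrite /form (siDr iP).
have real x : complex.Im (form X x x) = 0 by rewrite -[form X x x]RRe_real ?ger0_real// X0.
split=> // x y.
have h1 := real (1 *: x + y); have h2 := real ('i%C *: x + y).
move: h1 h2; rewrite !lin !addr /form !(siZr iP) -/(form X x x) -/(form X x y)
  -/(form X y x) -/(form X y y).
have := real x; have := real y.
case: (form X x x) (form X x y) (form X y x) (form X y y) => [a a'] [b b'] [c c'] [d d'].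
rewrite /Num.conj /= => -> ->; simpc => /= h1 h2.
by congr Complex; lra.
Qed.

Lemma expr_operator X k x : (X ^+ k.+1) x = X ((X ^+ k) x).
Proof. by rewrite exprS. Qed.

Lemma expr_selfadjoint X k : selfadjoint X -> selfadjoint (X ^+ k).
Proof.
move=> sX; elim: k => [//|k IHk] x y; rewrite [in LHS]exprS exprSr /=.
by rewrite -[LHS]/(inner (X ((X ^+ k) x)) y) sX IHk.
Qed.

Lemma positive_selfadjoint X : positive_operator X -> selfadjoint X.
Proof. by move=> /positive_form fP x y; rewrite [RHS](si_herm iP); exact: (si_herm fP). Qed.

Lemma expr_positive X k : positive_operator X -> positive_operator (X ^+ k).
Proof.
move=> X0; have sX := positive_selfadjoint X0; elim/ltn_ind: k => -[|[|k]] IHk x.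
- exact: si_ge0 iP x.
- exact: X0.
- rewrite exprS exprSr -[X in 0 <= X]/(inner (X ((X ^+ k) (X x))) x) sX; exact: IHk.
Qed.

(** Jensen *)
Lemma expr_form_ge X k x : positive_operator X -> nrm x <= 1 ->
  qn (form X) x ^+ k.+1 <= qn (form (X ^+ k.+1)) x.
Proof.
move=> X0 x1; pose mu j := qn (form (X ^+ j)) x.
have sX := positive_selfadjoint X0.
have fP j := positive_form (expr_positive j X0).
have mu0 j : 0 <= mu j := qn_ge0 (fP j) x.
have mu_0 : mu 0%N <= 1 by rewrite /mu [qn _ _]qn_inner expr_le1 ?nrm_ge0.
have logconvex j : mu j.+1 ^+ 2 <= mu j * mu j.+2.
  have := si_cauchy_schwarz (fP j) x (X x).
  have -> : form (X ^+ j) x (X x) = form (X ^+ j.+1) x x.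
    by rewrite /form exprS -[in RHS]/(inner (X ((X ^+ j) x)) x) sX.
  have -> : qn (form (X ^+ j)) (X x) = mu j.+2.
    by rewrite /mu /qn /form exprS exprSr -[in RHS]/(inner (X ((X ^+ j) (X x))) x) sX.
  by rewrite (qnE (fP j.+1)) nrmR ger0_norm ?qn_ge0.
have step j : mu 1%N * mu j <= mu j.+1.
  elim: j => [|j IHj]; first by rewrite ler_piMr.
  have [->|mu_gt0] := eqVneq (mu j.+1) 0; first by rewrite mulr0 mu0.
  have {}mu_gt0 : 0 < mu j.+1 by rewrite lt_def mu_gt0 mu0.
  have muj_gt0 : 0 < mu j.
    rewrite lt_def mu0 andbT; apply/eqP => muj; have := logconvex j.
    by rewrite muj mul0r leNgt exprn_gt0.
  rewrite -(ler_pM2l muj_gt0) (le_trans _ (logconvex j))// expr2 mulrA.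
  by rewrite ler_pM2r// mulrC.
have e1 : qn (form X) x = mu 1%N by [].
rewrite e1 -/(mu k.+1); elim: k => [|k IHk]; first by rewrite expr1.
by rewrite exprS (le_trans _ (step _))// ler_wpM2l.
Qed.
End PositiveOperators.

Section SchattenSmall.
Local Open Scope classical_set_scope.
Local Open Scope ring_scope.
Local Open Scope complex_scope.
Context (R : realType) (H : separableHilbertType R).
Local Notation C := R[i].
Local Notation L := (bounded_operator H).
Local Notation ip := (fun x y : H => inner x y).
Local Notation iP := (@inner_semi_inner R H).
Implicit Types (x y z : H) (X Y Z : L).

Lemma qn_form_bound X : exists2 M : R, 0 <= M & forall z, qn (form X) z <= M * nrm z ^+ 2.
Proof.
have [M M0 XM] := operator_bound X; exists M => // z.
rewrite (le_trans (Re_le_nrm _))// (le_trans (cauchy_schwarz _ _))//.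
by rewrite expr2 mulrA ler_wpM2r ?nrm_ge0.
Qed.

Lemma tends_defect X e x : positive_operator X -> orthonormal_basis e ->
  tends (fun N => (qn (form X) (x - expansion e x N))%:C : C) 0.
Proof.
move=> X0 be eps eps0; have [M M0 hM] := qn_form_bound X.
have M1 : 0 < M + 1 by rewrite ltr_wpDl.
have eps1 : 0 < Num.min 1 (eps / (M + 1)) by rewrite lt_min ltr01 divr_gt0.
have [N hN] := expansion_tends x be eps1.
exists N => n /hN; rewrite le_min => /andP[z1 z2].
rewrite subr0 nrmR ger0_norm ?(qn_ge0 (positive_form X0))// (le_trans (hM _))//.
move: z1 z2; rewrite nrmBC ler_pdivlMr//.
have := nrm_ge0 (x - expansion e x n); move: (nrm _) => r; nra.
Qed.

Lemma sum_form_le X e (x : nat -> H) B : positive_operator X -> orthonormal_basis e ->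
  (forall N, \sum_(i < N) qn (form X) (e i) <= B) ->
  orthogonal_seq ip x -> (forall i, qn ip (x i) <= 1) ->
  forall K, \sum_(k < K) qn (form X) (x k) <= B.
Proof.
move=> X0 be eB ox x1 K; have fP := positive_form X0.
have sX := positive_selfadjoint X0.
have [g [g01 og] spans] := gram_schmidt fP e.
have g1 i : qn (form X) (g i) <= 1.
  by rewrite /qn; have [->|->] := g01 i; rewrite ?(si0l fP)//= ler01.
have Xg_le N : \sum_(l < N) nrm (X (g l)) ^+ 2 <= B.
  have normE n (s : 'I_n -> R) : (forall i, 0 <= s i) ->
      nrm (\sum_i (s i)%:C : C) = \sum_i s i.
    by move=> s0; rewrite -rmorph_sum nrmR ger0_norm// sumr_ge0.
  rewrite -normE; last by move=> i; exact: sqr_ge0.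
  have /(tends_nrm_le (N := 0)) : tends (fun n => \sum_(l < N) \sum_(i < n)
      inner (X (g l)) (e i) * Num.conj (inner (X (g l)) (e i)) : C)
      (\sum_(l < N) (nrm (X (g l)) ^+ 2)%:C).
    apply: tends_sum => l; have := parseval (X (g l)) (X (g l)) be.
    by rewrite inner_normE nrmE -rmorphXn.
  apply=> n _; under eq_bigr do under eq_bigr do rewrite nrm_sqr.
  rewrite exchange_big /=; under eq_bigr do rewrite -rmorph_sum.
  rewrite normE; last by move=> i; apply: sumr_ge0 => j _; exact: sqr_ge0.
  apply: le_trans (eB n); apply: ler_sum => i _.
  apply: le_trans (bessel fP (e i) N og g1); apply: ler_sum => j _.
  by rewrite -[in leRHS]nrmJ -(si_herm fP).
have approx N : \sum_(k < K) qn (form X) (x k) <=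
    B + \sum_(k < K) qn (form X) (x k - expansion e (x k) N).
  apply: le_trans (lerD (Xg_le N) (lexx _)).
  rewrite (le_trans (ler_sum (G := fun k : 'I_K =>
      \sum_(l < N) nrm (form X (x k) (g l)) ^+ 2 +
      qn (form X) (x k - expansion e (x k) N)) _ _))//.
    move=> k _; apply: (bessel_defect_le fP og g1) => z.
    rewrite (si_suml (semi_inner_bessel_defect fP og g1 N)) big1// => i _.
    rewrite (siZl (semi_inner_bessel_defect fP og g1 N)).
    by rewrite (gram_schmidt_defect fP og spans) ?mulr0.
  rewrite big_split lerD2r exchange_big; apply: ler_sum => l _.
  rewrite -qn_inner; apply: le_trans (bessel iP (X (g l)) K ox x1).
  by apply: ler_sum => k _; rewrite /form sX -[in leRHS]nrmJ -(si_herm iP).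
apply/ler_addgt0Pr => eps eps0.
have [N hN] : exists N, \sum_(k < K) qn (form X) (x k - expansion e (x k) N) <= eps.
  have := tends_sum (fun k : 'I_K => tends_defect (x k) X0 be).
  move=> /(_ eps eps0)[N /(_ N (leqnn N))].
  rewrite [X in _ - X]big1// subr0 -rmorph_sum nrmR => h; exists N.
  exact: le_trans (ler_norm _) h.
by rewrite (le_trans (approx N))// lerD2l.
Qed.

Lemma trace_seriesE X N :
  trace_series X N = \sum_(i < N) inner (X (chosen_basis H i)) (chosen_basis H i).
Proof. by rewrite /trace_series /series /= big_mkord. Qed.

Lemma trace_series_bounded X : positive_operator X -> cvgn (trace_series X) ->
  exists B : R, forall N, \sum_(i < N) qn (form X) (chosen_basis H i) <= B.
Proof.
move=> X0 /cvg_ex[l /(@tendsP R C^o) /(_ 1 ltr01)[N hN]].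
have fP := positive_form X0.
exists (nrm l + 1) => n.
rewrite (le_trans (_ : _ <= \sum_(i < maxn N n) qn (form X) (chosen_basis H i)))//.
  rewrite -!(big_mkord xpredT (fun i => qn (form X) (chosen_basis H i))).
  rewrite [leRHS](big_cat_nat (n := n)) ?leq_maxr//= lerDl.
  by apply: sumr_ge0 => i _; exact: (qn_ge0 fP).
have E : trace_series X (maxn N n) = (\sum_(i < maxn N n) qn (form X) (chosen_basis H i))%:C.
  by rewrite trace_seriesE rmorph_sum; apply: eq_bigr => i _; exact: (qnE fP).
have := hN _ (leq_maxl N n); rewrite E => h.
rewrite -lerBlDl (le_trans _ h)//.
have := nrmD ((\sum_(i < maxn N n) qn (form X) (chosen_basis H i))%:C - l : C) l.
rewrite subrK nrmR => h2; rewrite lerBlDr (le_trans _ h2)// ler_norm//.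
Qed.

Lemma near_maximizer X (l : seq H) : positive_operator X ->
  exists x, [/\ nrm x <= 1, forall v, v \in l -> inner x v = 0 &
    forall y, nrm y <= 1 -> (forall v, v \in l -> inner y v = 0) ->
      qn (form X) y <= 2 * qn (form X) x].
Proof.
move=> X0; have fP := positive_form X0; have [M M0 hM] := qn_form_bound X.
pose S := [set qn (form X) y | y in [set y | nrm y <= 1 /\ forall v, v \in l -> inner y v = 0]].
have S0 : S 0.
  by exists 0; [split=> [|v _]; rewrite ?nrm0 ?(si0l iP)|rewrite /qn (si0l fP)].
have supS : has_sup S.
  split; [by exists 0|exists M => _ [y [y1 _] <-]].
  rewrite (le_trans (hM y))// ler_piMr// expr_le1 ?nrm_ge0//.
have ubS y : nrm y <= 1 -> (forall v, v \in l -> inner y v = 0) -> qn (form X) y <= sup S.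
  by move=> y1 yl; apply: ub_le_sup; [exact: supS.2|exists y].
have [sup0|sup_gt0] := leP (sup S) 0.
  exists 0; split=> [|v _|y y1 yl]; rewrite ?nrm0 ?(si0l iP)//.
  by rewrite /qn (si0l fP) mulr0 (le_trans (ubS y y1 yl)).
have [_ [x [x1 xl] <-] hx] := sup_adherent (divr_gt0 sup_gt0 (ltr0Sn R 1)) supS.
exists x; split=> // y y1 yl; rewrite (le_trans (ubS y y1 yl))//.
by move: hx; lra.
Qed.

Lemma greedy_sequence X : positive_operator X -> exists x : nat -> H,
  [/\ orthogonal_seq ip x, forall n, nrm (x n) <= 1 &
   forall n y, nrm y <= 1 -> (forall j, (j < n)%N -> inner y (x j) = 0) ->
      qn (form X) y <= 2 * qn (form X) (x n)].
Proof.
move=> X0; have [pick pickP] := choice (fun l => near_maximizer l X0).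
pose fix xs n := if n is p.+1 then rcons (xs p) (pick (xs p)) else [::].
pose x n := pick (xs n).
have xsE n : xs n = mkseq x n by elim: n => //= n IHn; rewrite mkseqS -IHn.
have mem n v : v \in xs n -> exists2 j, (j < n)%N & v = x j.
  by rewrite xsE => /mapP[j]; rewrite mem_iota => lt_j ->; exists j.
have orth i j : (j < i)%N -> inner (x i) (x j) = 0.
  move=> lt_ji; have [_ h _] := pickP (xs i); apply: h.
  by rewrite xsE; apply: map_f; rewrite mem_iota.
exists x; split.
- move=> i j /eqP; rewrite neq_ltn => /orP[] lt_ij; last exact: orth.
  by rewrite (si_herm iP) orth// rmorph0.
- by move=> n; have [] := pickP (xs n).
- move=> n y y1 yx; have [_ _] := pickP (xs n); apply=> // v /mem[j lt_jn ->].
  exact: yx.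
Qed.

Lemma schatten_small m X : (0 < m)%N -> schatten m X -> small m 1 X.
Proof.
move=> m_gt0 [P [P0 [Y XY PP]] cP]; have fP := positive_form P0.
have sP := positive_selfadjoint P0.
have [x [ox x1 xmax]] := greedy_sequence P0.
have [B hB] := trace_series_bounded (expr_positive m P0) cP.
have xB := sum_form_le (expr_positive m P0) (@chosen_basisP R H) hB ox.
have qx1 i : qn ip (x i) <= 1 by rewrite qn_inner expr_le1 ?nrm_ge0.
have b0 n : 0 <= 2 * qn (form P) (x n) by rewrite mulr_ge0// qn_ge0.
have hmax n y : (forall j, (j < n)%N -> inner y (x j) = 0) ->
    qn (form P) y <= 2 * qn (form P) (x n) * nrm y ^+ 2.
  move=> yx; have [y0|y_neq0] := eqVneq (nrm y) 0.
    by rewrite (nrm_eq0 y0) /qn (si0l fP) nrm0 expr0n mulr0.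
  have y_gt0 : 0 < nrm y by rewrite lt_def y_neq0 nrm_ge0.
  pose u := (nrm y)^-1%:C *: y.
  have : qn (form P) u <= 2 * qn (form P) (x n).
    apply: xmax => [|j lt_j]; last by rewrite (siZl iP) yx// mulr0.
    by rewrite nrmZ nrmR gtr0_norm ?invr_gt0// mulVf.
  have -> : qn (form P) u = (nrm y)^-1 ^+ 2 * qn (form P) y.
    apply: complexI; rewrite -(qnE fP) (siZl fP) (siZr fP) conjR (qnE fP) rmorphM.
    by rewrite rmorphXn /= mulrA.
  by rewrite exprVn mulrC ler_pdivrMr// exprn_gt0.
exists 2%N, (fun j => [:: x j; P (x j)]), (fun n => 2 * qn (form P) (x n)); split=> //.
  split=> //; exists (2 ^+ m * B) => N.
  rewrite (le_trans _ (ler_wpM2l _ (xB qx1 N))) ?exprn_ge0// mulr_sumr.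
  apply: ler_sum => i _; rewrite exprMn ler_wpM2l ?exprn_ge0//.
  by case: (m) m_gt0 => // k _; exact: expr_form_ge.
exists 1 => // n z zw; rewrite mul1r expr1.
have nX : nrm (X z) = nrm (P z).
  apply/eqP; rewrite -(@eqrXn2 _ 2) ?nrm_ge0// -!qn_inner /qn XY sP.
  by rewrite -[Y (X z)]/((Y * X) z) -PP.
have zx j : (j < n)%N -> inner z (x j) = 0 by move=> lt_j; apply: (zw j) => //; rewrite mem_head.
have Pzx j : (j < n)%N -> inner (P z) (x j) = 0.
  by move=> lt_j; rewrite sP; apply: (zw j) => //; rewrite !inE eqxx orbT.
rewrite nX; have := si_cauchy_schwarz fP z (P z).
have -> : form P z (P z) = (nrm (P z) ^+ 2)%:C by rewrite /form -qn_inner -(qnE iP).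
rewrite nrmR ger0_norm ?sqr_ge0// => h.
have {}h : (nrm (P z) ^+ 2) ^+ 2 <=
    (2 * qn (form P) (x n) * nrm z * nrm (P z)) ^+ 2.
  rewrite (le_trans h)// (le_trans (ler_pM _ _ (hmax n z zx) (hmax n (P z) Pzx)))//.
  - exact: qn_ge0.
  - exact: qn_ge0.
  - by rewrite !exprMn le_eqVlt; apply/orP; left; apply/eqP; ring.
have [->|Pz] := eqVneq (nrm (P z)) 0; first by rewrite mulr_ge0 ?nrm_ge0.
have Pz_gt0 : 0 < nrm (P z) by rewrite lt_def Pz nrm_ge0.
move: h; rewrite ler_sqr ?nnegrE ?sqr_ge0 ?mulr_ge0 ?nrm_ge0 ?qn_ge0//.
by rewrite expr2 ler_pM2r ?qn_ge0.
Qed.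
End SchattenSmall.

Section Trace.
Local Open Scope classical_set_scope.
Local Open Scope ring_scope.
Local Open Scope complex_scope.
Context (R : realType) (H : separableHilbertType R).
Local Notation C := R[i].
Local Notation L := (bounded_operator H).
Local Notation ip := (fun x y : H => inner x y).
Local Notation iP := (@inner_semi_inner R H).
Implicit Types (x y z : H) (X Y Z : L).

Lemma nrm_expansion e x N : orthonormal_basis e -> nrm (expansion e x N) <= nrm x.
Proof.
move=> be; have oe := basis_orthogonal be; have [e01 _ _] := be.
have e1 i := basis_le1 (e01 i).
apply: nrm_le_sqr; first exact: nrm_ge0.
rewrite -!qn_inner; apply: le_trans (bessel iP x N oe e1).
rewrite (qn_sum_orthogonal iP (fun i => inner x (e i)))//; apply: ler_sum => i _.
by rewrite ler_piMr// sqr_ge0.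
Qed.

Lemma trace_change_basis (e v : nat -> H) X Y Y' :
  orthonormal_basis e -> orthonormal_basis v -> adjoint_of Y Y' ->
  bounded_sums (fun n => nrm (X (v n)) * nrm (Y' (v n))) ->
  exists2 l : C, tends (fun N => \sum_(n < N) inner (X (v n)) (Y' (v n))) l &
    tends (fun N => \sum_(i < N) inner (X (Y (e i))) (e i)) l.
Proof.
move=> be bv YY' aB; have [X' XX'] := adjoint_exists X.
set a := (fun n => nrm (X (v n)) * nrm (Y' (v n))) in aB *.
have a0 n : 0 <= a n by rewrite mulr_ge0 ?nrm_ge0.
have [|l hl] := @abs_summable_tends R (fun n => inner (X (v n)) (Y' (v n))).
  case: aB => B aB; exists B => N; apply: le_trans (aB N).
  by apply: ler_sum => i _; exact: cauchy_schwarz.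
exists l => // eps eps0; have eps3 : 0 < eps / 3 by rewrite divr_gt0.
pose t N n := inner (expansion e (X (v n)) N) (Y' (v n)).
pose S N := \sum_(i < N) inner (X (Y (e i))) (e i).
have tn N n : nrm (t N n) <= a n.
  by rewrite (le_trans (cauchy_schwarz _ _))// ler_wpM2r ?nrm_ge0// nrm_expansion.
have tS N : tends (fun p => \sum_(n < p) t N n : C) (S N).
  have := tends_sum (fun i : 'I_N => parseval (Y (e i)) (X' (e i)) bv).
  rewrite (_ : \sum_(i < N) inner (Y (e i)) (X' (e i)) = S N); last first.
    by apply: eq_bigr => i _; rewrite XX'.
  apply: eq_tends => p; rewrite exchange_big; apply: eq_bigr => n _.
  rewrite /t (si_suml iP); apply: eq_bigr => i _.
  by rewrite (siZl iP) YY' -(si_herm iP) XX' mulrC.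
have [N0 hN0] := bounded_sums_tail a0 aB eps3.
have tail (s : nat -> C) p : (forall n, nrm (s n) <= a n) -> (N0 <= p)%N ->
    nrm (\sum_(n < p) s n - \sum_(n < N0) s n) <= eps / 3.
  move=> sa le_p; apply: le_trans (hN0 p).
  rewrite -!(big_mkord xpredT s) (big_cat_nat (n := N0))//= addrAC subrr add0r.
  by rewrite (le_trans (nrm_sum _ _ _))// ler_sum.
have close N : nrm (S N - \sum_(n < N0) t N n) <= eps / 3.
  apply: (tends_nrm_le (N := N0) (tendsB (tS N) (tends_cst _))) => p le_p.
  exact: tail.
have close_l : nrm (l - \sum_(n < N0) inner (X (v n)) (Y' (v n))) <= eps / 3.
  apply: (tends_nrm_le (N := N0) (tendsB hl (tends_cst _))) => p le_p.
  by apply: (tail (fun n => inner (X (v n)) (Y' (v n)))) => // n; exact: cauchy_schwarz.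
have := tends_sum (fun n : 'I_N0 => tends_innerl (Y' (v n)) (expansion_tends (X (v n)) be)).
move=> /(_ _ eps3)[N1 hN1]; exists N1 => N /hN1 h.
rewrite -/(S N); move: h close_l (close N) => /=.
set A := \sum_(n < N0) t N n; set B := \sum_(n < N0) inner _ _.
move=> h close_l closeN; have -> : S N - l = (S N - A) + ((A - B) - (l - B)) by ring.
have -> : eps = eps / 3 + (eps / 3 + eps / 3) by field.
by rewrite (le_trans (nrmD _ _))// lerD// (le_trans (nrmB _ _))// lerD.
Qed.

Lemma bounded_sums_stretch (a : nat -> R) d : (forall n, 0 <= a n) -> bounded_sums a ->
  bounded_sums (fun n => a (n %/ d.+1)%N).
Proof.
move=> a0 [B aB]; exists (B *+ d.+1) => N.
have stretch K : \sum_(0 <= n < (K * d.+1)%N) a (n %/ d.+1)%N = (\sum_(i < K) a i) *+ d.+1.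
  elim: K => [|K IHK]; first by rewrite mul0n big_geq// big_ord0 mul0rn.
  rewrite (big_cat_nat (n := (K * d.+1)%N))//=; last by rewrite leq_mul2r leqnSn orbT.
  rewrite IHK big_ord_recr mulrnDl /=; congr (_ + _).
  rewrite (eq_big_nat _ _ (F2 := fun=> a K)) => [|n /andP[n1 n2]]; last first.
    by congr a; apply/eqP; rewrite eqn_leq leq_divRL// n1 andbT -ltnS ltn_divLR.
  by rewrite sumr_const_nat mulSn addnK.
have le_N : (N <= N * d.+1)%N by rewrite leq_pmulr.
rewrite (le_trans _ (_ : (\sum_(i < N) a i) *+ d.+1 <= _))//; last by rewrite lerMn2r aB.
rewrite -stretch -(big_mkord xpredT (fun n => a (n %/ d.+1)%N)).
by rewrite [leRHS](big_cat_nat (n := N))//= lerDl sumr_ge0.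
Qed.

Lemma adapted_basis c (w : nat -> seq H) : (forall j, (size (w j) <= c)%N) ->
  exists2 v, orthonormal_basis v & forall n, orthogonal_below w (n %/ c.+1)%N (v n).
Proof.
move=> wc; have [e01 oe etot] := @chosen_basisP R H.
pose u n := nth 0 (chosen_basis H (n %/ c.+1)%N :: w (n %/ c.+1)%N) (n %% c.+1)%N.
have uE j k : (k <= c)%N -> u (j * c.+1 + k)%N = nth 0 (chosen_basis H j :: w j) k.
  by move=> le_k; rewrite /u divnMDl// modnMDl divn_small ?modn_small// addn0.
have [|v bv vu] := @dense_orthonormal_basis R H u.
  by move=> x xu; apply: etot => j; have := xu (j * c.+1 + 0)%N; rewrite uE.
exists v => // n j y lt_j /(nthP 0)[k lt_k <-].
have le_k : (k.+1 <= c)%N by apply: leq_trans (wc j).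
have := uE j k.+1 le_k => /= <-; apply: vu => i le_i; have [_ ov _] := bv.
apply: ov => e_ni; move: le_i; rewrite -e_ni leqNgt => /negP; apply.
move: lt_j; rewrite leq_divRL// mulSn addnC; apply: leq_trans.
by rewrite ltn_add2l ltnS.
Qed.

Lemma nrm_basis (v : nat -> H) n : orthonormal_basis v -> nrm (v n) <= 1.
Proof.
move=> [v01 _ _]; apply: nrm_le_sqr; first exact: ler01.
by rewrite expr1n -qn_inner basis_le1.
Qed.

Lemma traceE X l : tends (trace_series X) l -> trace X = l.
Proof. by move=> /(@tendsP R C^o) h; apply: (@cvg_lim C^o) h; exact: norm_hausdorff. Qed.

Variables (m : nat) (m_gt0 : (0 < m)%N).

Lemma dominated_products c (w : nat -> seq H) b v i j X Y : summable_scale m b ->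
  orthonormal_basis v -> (forall n, orthogonal_below w (n %/ c.+1)%N (v n)) ->
  (i + j)%N = m -> dominates b w i X -> dominates b w j Y ->
  bounded_sums (fun n => nrm (X (v n)) * nrm (Y (v n))).
Proof.
move=> [b0 bm] bv vw ijm [M M0 hX] [N N0 hY].
have bm0 n : 0 <= b n ^+ m by rewrite exprn_ge0.
have [B hB] := bounded_sums_stretch c bm0 bm; exists (M * N * B) => K.
rewrite (le_trans _ (ler_wpM2l (mulr_ge0 M0 N0) (hB K)))// mulr_sumr.
apply: ler_sum => n _; rewrite -ijm exprD mulrACA.
rewrite ler_pM ?nrm_ge0//.
- by rewrite (le_trans (hX _ _ (vw n)))// ler_piMr ?nrm_basis// mulr_ge0 ?exprn_ge0.
- by rewrite (le_trans (hY _ _ (vw n)))// ler_piMr ?nrm_basis// mulr_ge0 ?exprn_ge0.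
Qed.

Lemma small_trace_commute i j X Y : small m i X -> small m j Y -> (i + j)%N = m ->
  exists2 l, tends (trace_series (X * Y)) l & tends (trace_series (Y * X)) l.
Proof.
move=> sX sY ijm; have [X' XX'] := adjoint_exists X; have [Y' YY'] := adjoint_exists Y.
have [c1 [w1 [b1 [s1 p1 hX hY]]]] := small_pair sX sY.
have [c2 [w2 [b2 [s2 p2 hX' hY']]]] :=
  small_pair (small_adjoint XX' sX) (small_adjoint YY' sY).
have [c [w [b [s p h]]]] := scale_merge s1 p1 s2 p2.
have [v bv vw] := adapted_basis s.
have := dominated_products p bv vw ijm (h _ _ (or_introl hX)) (h _ _ (or_intror hY')).
move=> /(trace_change_basis (@chosen_basisP R H) bv YY')[l hl1 hl2].
have jim : (j + i)%N = m by rewrite addnC.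
have dYX := dominated_products p bv vw jim (h _ _ (or_introl hY)) (h _ _ (or_intror hX')).
have [l1 hl3 hl4] := trace_change_basis (@chosen_basisP R H) bv XX' dYX.
have [l2 hl5 hl6] := trace_change_basis bv bv XX' dYX.
have l12 : l2 = l1 by exact: tends_unique hl5 hl3.
have ll2 : l = l2.
  apply: tends_unique hl1 _; apply: eq_tends hl6 => N; apply: eq_bigr => n _.
  by rewrite YY'.
exists l; first by apply: eq_tends hl2 => N; rewrite trace_seriesE.
by rewrite ll2 l12; apply: eq_tends hl4 => N; rewrite trace_seriesE.
Qed.

Lemma small_trace_cvg X : small m m X -> tends (trace_series X) (trace X).
Proof.
move=> sX; have [l hl _] := small_trace_commute sX (small_all m_gt0 1) (addn0 m).
by rewrite mulr1 in hl; rewrite (traceE hl).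
Qed.

Lemma traceC i j X Y : small m i X -> small m j Y -> (m <= i + j)%N ->
  trace (X * Y) = trace (Y * X).
Proof.
move=> sX sY le_m; have le_i : (minn i m <= i)%N by rewrite geq_minl.
have le_j : (m - minn i m <= j)%N by lia.
have e_m : (minn i m + (m - minn i m))%N = m by lia.
have [l h1 h2] := small_trace_commute (small_le m_gt0 le_i sX) (small_le m_gt0 le_j sY) e_m.
by rewrite (traceE h1) (traceE h2).
Qed.

Lemma traceB X Y : small m m X -> small m m Y -> trace (X - Y) = trace X - trace Y.
Proof.
move=> /small_trace_cvg hX /small_trace_cvg hY; apply: traceE.
apply: eq_tends (tendsB hX hY) => N; rewrite !trace_seriesE -sumrB.
by apply: eq_bigr => i _; rewrite -(siBl iP).
Qed.

Lemma traceZ k X : small m m X -> trace (k *: X) = k * trace X.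
Proof.
move=> /small_trace_cvg hX; apply: traceE.
have := @tendsZl R C^o k _ _ hX; apply: eq_tends => N; rewrite !trace_seriesE.
by rewrite scaler_sumr; apply: eq_bigr => i _; exact: (esym (siZl iP _ _ _)).
Qed.
End Trace.

Section OperatorTrace.
Local Open Scope classical_set_scope.
Local Open Scope ring_scope.
Local Open Scope complex_scope.
Context (R : realType) (H : separableHilbertType R) (m : nat) (m_gt0 : (0 < m)%N).
Local Notation C := R[i].
Local Notation L := (bounded_operator H).
Variable gamma : L.
Hypothesis gamma_even : ~~ odd m -> gamma = 1.
Hypothesis gamma_odd : odd m -> gamma * gamma = 1.
Implicit Types (X Y Z : L) (p q : bool) (d e : nat).

Definition scalar_operator (k : C) : L := k *: (1 : L).

Definition graded p X := gamma * X = (-1) ^+ p * (X * gamma).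

Definition small_graded p d X := small m d X /\ (odd m -> graded p X).

Definition graded_trace X : C := trace (gamma ^+ m * X).

Let gradedM p q X Y : graded p X -> graded q Y -> graded (p (+) q) (X * Y).
Proof.
rewrite /graded !mulr_sign => gX gY; rewrite mulrA gX.
have -> : (if p then - (X * gamma) else X * gamma) * Y = (if p then - 1 else 1) * (X * (gamma * Y)).
  by case: (p); rewrite ?mulN1r ?mulNr ?mul1r mulrA.
by rewrite gY; case: (p) (q) => -[]; rewrite /= ?mulrN ?mul1r ?mulN1r ?opprK mulrA.
Qed.

Let ideal_subr p d X Y : small_graded p d X -> small_graded p d Y -> small_graded p d (X - Y).
Proof.
move=> [sX gX] [sY gY]; split=> [|om]; first exact: smallB.
by rewrite /graded mulrBr gX// gY// mulrBl mulrBr.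
Qed.
Let ideal_mulr p q d e X Y : small_graded p d X -> small_graded q e Y ->
  small_graded (p (+) q) (d + e) (X * Y).
Proof.
move=> [sX gX] [sY gY]; split=> [|om]; first exact: smallM.
by apply: gradedM; [exact: gX|exact: gY].
Qed.
Let ideal_ler p d e X : (d <= e)%N -> small_graded p e X -> small_graded p d X.
Proof. by move=> le_de [sX gX]; split=> //; apply: small_le sX. Qed.
Let small1 : small_graded false 0 1.
Proof. by split=> [|_]; [exact: small_all|rewrite /graded mul1r mulr1 mul1r]. Qed.
Let small0 p d : small_graded p d 0.
Proof.
split=> [|_]; last by rewrite /graded mulr0 mul0r mulr0.
exists 0%N, (fun=> [::]), (fun=> 0); split=> //.
  by split=> //; exists 0 => N; rewrite big1// => i _; rewrite expr0n; case: (m) m_gt0.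
by exists 0 => // n x _; rewrite nrm0 !mul0r.
Qed.
Let gammaX : gamma ^+ m = if odd m then gamma else 1.
Proof.
case: ifPn => om; last by rewrite gamma_even// expr1n.
rewrite -[m in LHS]odd_double_half om addSn exprS -mul2n exprM.
by rewrite expr2 gamma_odd// expr1n mulr1.
Qed.
Let gammaM d X : small m d X -> small m d (gamma ^+ m * X).
Proof. by move=> sX; have := smallM (small_all m_gt0 (gamma ^+ m)) sX; rewrite add0n. Qed.
Let functional_subr X Y : small_graded (~~ odd m) m X -> small_graded (~~ odd m) m Y ->
  graded_trace (X - Y) = graded_trace X - graded_trace Y.
Proof. by move=> [sX _] [sY _]; rewrite /graded_trace mulrBr (traceB m_gt0)//; exact: gammaM. Qed.

Let trace_sign p X : small m m X -> trace ((-1) ^+ p * X) = (-1) ^+ p * trace X.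
Proof.
move=> sX; rewrite !mulr_sign; case: p => //.
by rewrite -scaleN1r (traceZ m_gt0)// mulN1r.
Qed.

Let functional_cyclic p q d e X Y : p (+) q = ~~ odd m -> (m <= d + e)%N ->
  small_graded p d X -> small_graded q e Y ->
  graded_trace (X * Y) = (-1) ^+ (p && q) * graded_trace (Y * X).
Proof.
move=> pq le_m [sX gX] [sY gY]; rewrite /graded_trace gammaX.
case: ifPn pq => om pq; last first.
  have -> : p && q = false by case: (p) (q) pq => -[].
  by rewrite !mul1r (traceC m_gt0 sX sY).
have <- : p = q by apply/eqP; rewrite -negb_add pq.
have sgY : small m e (gamma * Y) by have := smallM (small_all m_gt0 gamma) sY; rewrite add0n.
rewrite andbb mulrA gX// -!mulrA trace_sign; last first.
  by apply: small_le le_m _ => //; exact: smallM.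
by rewrite (traceC m_gt0 sX sgY)// mulrA.
Qed.

Definition operator_trace : summable_trace L C m :=
  SummableTrace ideal_subr ideal_mulr ideal_ler small0 small1 functional_subr functional_cyclic.

Lemma graded_traceZ k X : small_graded (~~ odd m) m X ->
  graded_trace (scalar_operator k * X) = k * graded_trace X.
Proof.
move=> [sX _]; rewrite /graded_trace.
have -> : gamma ^+ m * (scalar_operator k * X) = k *: (gamma ^+ m * X).
  by apply: operatorP => x; exact: operatorZ.
by rewrite (traceZ m_gt0)//; exact: gammaM.
Qed.

Lemma scalar_operatorC k X : scalar_operator k * X = X * scalar_operator k.
Proof. by apply: operatorP => x; symmetry; exact: operatorZ. Qed.

Lemma small_graded_scalar k : small_graded false 0 (scalar_operator k).
Proof.
split=> [|_]; first exact: small_all.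
by rewrite /graded -scalar_operatorC mul1r.
Qed.
End OperatorTrace.

Section ListCochains.
Context (K : fieldType) (B : algType K).
Implicit Types (f : seq B -> K) (s : seq B).

Definition entries n (a : 'I_n.+1 -> B) : seq B := mkseq (fun i => a (inord i)) n.+1.

Arguments entries n a : simpl never.

Lemma size_entries n (a : 'I_n.+1 -> B) : size (entries a) = n.+1.
Proof. exact: size_mkseq. Qed.

Lemma nth_entries n (a : 'I_n.+1 -> B) i : (i < n.+1)%N -> nth 0 (entries a) i = a (inord i).
Proof. exact: nth_mkseq. Qed.

Lemma eq_entries n (a b : 'I_n.+1 -> B) : a =1 b -> entries a = entries b.
Proof. by move=> ab; apply: eq_map => i; exact: ab. Qed.

Lemma big_entries T (idx : T) (op : T -> T -> T) n (a : 'I_n.+1 -> B) (F : B -> T) :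
  \big[op/idx]_(x <- entries a) F x = \big[op/idx]_(i < n.+1) F (a i).
Proof.
rewrite /entries /mkseq big_map; have -> : iota 0 n.+1 = index_iota 0 n.+1.
  by rewrite /index_iota subn0.
by rewrite big_mkord; apply: eq_bigr => i _; rewrite inord_val.
Qed.

Lemma nth_merge_seq i s j : (i.+1 < size s)%N -> nth 0 (merge_seq i s) j =
  if (j < i)%N then nth 0 s j
  else if j == i then nth 0 s j * nth 0 s j.+1 else nth 0 s j.+1.
Proof.
elim: i s j => [|i IHi] [|x [|y s]] [|j] //= lt_i.
by rewrite IHi.
Qed.

Lemma entries_merge_at n i (a : 'I_n.+2 -> B) : (i < n.+1)%N ->
  entries (merge_at i a) = merge_seq i (entries a).
Proof.
move=> lt_i; have sz : (i.+1 < size (entries a))%N by rewrite size_entries.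
apply: (@eq_from_nth _ 0); first by rewrite size_merge// !size_entries.
move=> j; rewrite size_entries => lt_j.
have lt_j1 : (j < n.+2)%N by apply: leq_trans lt_j _.
by rewrite nth_merge_seq// !nth_entries// /merge_at !inordK.
Qed.

Lemma entries_merge_cyclic n (a : 'I_n.+2 -> B) :
  entries (merge_cyclic a) = merge_ends (entries a).
Proof.
have sz : (1 < size (entries a))%N by rewrite size_entries.
apply: (@eq_from_nth _ 0); first by rewrite size_merge_ends// !size_entries.
move=> j; rewrite size_entries => lt_j; rewrite /merge_ends.
have -> : rotr 1 (entries a) = a ord_max :: mkseq (fun i => a (inord i)) n.+1.
  rewrite {1}/entries mkseqS rotr1_rcons; congr (a _ :: _).
  by apply: val_inj; rewrite /= inordK.
rewrite nth_entries// /merge_cyclic; case: j lt_j => [|j] lt_j /=.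
  rewrite (_ : inord 0 = ord0) ?eqxx; last by apply: val_inj; rewrite /= inordK.
  by congr (_ * a _); apply: val_inj; rewrite /= inordK.
rewrite ifN; last by rewrite -val_eqE /= inordK.
by have := nth_mkseq 0 (fun i => a (inord i)) lt_j => /= ->; rewrite inordK.
Qed.

Lemma hochschild_entries n f (a : 'I_n.+2 -> B) :
  hochschild (fun b : 'I_n.+1 -> B => f (entries b)) a = hoch f (entries a).
Proof.
rewrite /hochschild /hoch /bar_diff size_entries /= entries_merge_cyclic.
by congr (_ + _); apply: eq_bigr => i _; rewrite entries_merge_at.
Qed.

Lemma entries_slot n (a : 'I_n.+1 -> B) (i : 'I_n.+1) x :
  entries (fun j => if j == i then x else a j) =
  take i (entries a) ++ x :: drop i.+1 (entries a).
Proof.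
have sz_take : size (take i (entries a)) = i.
  by rewrite size_takel// size_entries ltnW.
apply: (@eq_from_nth _ 0) => [|j].
  by rewrite size_cat sz_take size_entries -cat1s size_cat size_drop size_entries addnA addn1 subnKC.
rewrite size_entries => lt_j; rewrite nth_entries// nth_cat sz_take.
rewrite -(nth_entries a lt_j); move: (entries a) sz_take => e _; rewrite -val_eqE /= inordK//.
have [lt_ji|lt_ij|->] := ltngtP j i.
- by rewrite nth_take.
- case: j lt_j lt_ij => // j lt_j lt_ij.
  by rewrite subSn// -[RHS]/(nth 0 (drop i.+1 e) (j - i)) nth_drop addSn subnKC.
- by rewrite subnn.
Qed.

Lemma entries_insert1_first n (a : 'I_n.+1 -> B) :
  entries (insert1_first a) = 1 :: entries a.
Proof.
apply: (@eq_from_nth _ 0) => [|j]; first by rewrite size_entries -[RHS]/((size (entries a)).+1) size_entries.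
rewrite size_entries => lt_j; rewrite nth_entries// /insert1_first.
case: unliftP => [k /(congr1 val)|/(congr1 val)]; rewrite /= inordK// => ->.
  by rewrite /bump leq0n add1n /= nth_entries// inord_val.
by [].
Qed.

Lemma entries_insert1_last n (a : 'I_n.+1 -> B) :
  entries (insert1_last a) = entries a ++ [:: 1].
Proof.
apply: (@eq_from_nth _ 0) => [|j]; first by rewrite size_cat !size_entries addn1.
rewrite size_entries => lt_j; rewrite nth_entries// /insert1_last nth_cat size_entries.
case: unliftP => [k /(congr1 val)|/(congr1 val)]; rewrite /= inordK// => ->.
  have lt_k : (k < n.+1)%N := ltn_ord k.
  have -> : bump n.+1 k = k by move: lt_k; rewrite /bump ltnNge => /negbTE ->.
  by rewrite lt_k nth_entries// inord_val.
by rewrite ltnn subnn.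
Qed.

Definition normalized_on n f := forall s1 s2, size (s1 ++ 1 :: s2) = n ->
  (forall k x y, f (s1 ++ k *: x + y :: s2) =
     k * f (s1 ++ x :: s2) + f (s1 ++ y :: s2)) /\
  f (s1 ++ 1 :: s2) = 0.

Definition concentrated n f : graded_cochain B :=
  fun p a => if p == n then f (entries a) else 0.

Lemma connes_normalized n f (a : 'I_n.+1 -> B) : normalized_on n.+2 f ->
  connes (fun b : 'I_n.+2 -> B => f (entries b)) a = 0.
Proof.
move=> nf; rewrite /connes big1// => j _; rewrite /connes_B0.
rewrite entries_insert1_first entries_insert1_last.
have [|_ ->] := nf [::] (entries (rotate j a)).
  by rewrite -[LHS]/((size (entries (rotate j a))).+1) size_entries.
have [|_ ->] := nf (entries (rotate j a)) [::]; first by rewrite size_cat size_entries addn1.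
by rewrite mulr0 subrr mulr0.
Qed.

Lemma hoch_eq0 f s : (forall u, f u = 0) -> hoch f s = 0.
Proof.
by move=> f0; rewrite /hoch /bar_diff f0 mulr0 addr0 big1// => i _; rewrite f0 mulr0.
Qed.

Lemma coboundary_concentrated n f : normalized_on n.+1 f ->
  coboundary (concentrated n f) = concentrated n.+1 (hoch f).
Proof.
move=> nf; apply: graded_cochainP => p a; rewrite /coboundary.
have -> : connes (@concentrated n f p.+1) a = 0.
  rewrite /concentrated; case: eqP => [def_n|_]; last first.
    apply: (@connes_normalized p (fun=> 0) a) => s1 s2 _.
    by split=> // k x y; rewrite mulr0 addr0.
  by apply: connes_normalized; rewrite def_n.
rewrite addr0; case: p a => [|p] a; first by [].
rewrite /concentrated eqSS; case: eqP => [_|_]; first exact: hochschild_entries.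
by rewrite [LHS](hochschild_entries (fun=> 0)) hoch_eq0.
Qed.
End ListCochains.

Lemma concentrated_reduced (K : fieldType) (A : nonUnitalAlgType K) n
    (f : seq (unitalization A) -> K) : normalized_on n.+1 f ->
  reduced_cochain n (concentrated n f).
Proof.
move=> nf; split; first split.
- move=> p a i k x y; rewrite /concentrated; case: eqP => [def_p|_]; last by rewrite mulr0 addr0.
  rewrite !entries_slot; have [|lf _] := nf (take i (entries a)) (drop i.+1 (entries a)).
    by rewrite -entries_slot size_entries def_p.
  exact: lf.
- by move=> p ne; apply/funext => a; rewrite /concentrated; case: eqP => // def_p; rewrite def_p leqnn eqxx in ne.
- apply: graded_cochainP => p a; rewrite /restrict_scalars /concentrated; case: eqP => // def_p.
  have scalar0 (b : 'I_p.+1 -> unitalization A) (k : K) : b (inord 0) = k *: 1 -> f (entries b) = 0.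
    move=> b0; pose s := [seq b (inord i) | i <- iota 1 p].
    have -> : entries b = k *: 1 :: s by rewrite -b0.
    have [|lf f1] := nf [::] s; first by rewrite /= size_map size_iota def_p.
    have f0 : f (0 :: s) = 0.
      by have := lf 1 0 0; rewrite /= scaler0 addr0 mul1r -[X in X = _]addr0 => /addrI <-.
    by have := lf k 1 0; rewrite /= addr0 f1 f0 mulr0 addr0.
  exact: (scalar0 _ (a (inord 0))).
Qed.

Section Module.
Context (R : realType) (A : nonUnitalAlgType R[i]) (H : separableHilbertType R) (m : nat).
Hypothesis m_gt0 : (0 < m)%N.
Local Notation C := R[i].
Local Notation L := (bounded_operator H).
Local Notation tA := (unitalization A).

Section One.
Variable F : fredholm_module A H m.
Local Notation gamma := (fm_grading F).

Lemma grading_even : ~~ odd m -> gamma = 1.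
Proof. by move=> om; apply: fm_grading_odd; case: (m) m_gt0 om => //= k _; rewrite negbK. Qed.
Let odd_pred : odd m -> ~~ odd m.-1.
Proof. by case: (m) m_gt0. Qed.
Lemma grading_odd : odd m -> gamma * gamma = 1.
Proof. by move=> /odd_pred/(fm_grading_even F)[_ <- _ _]; rewrite expr2. Qed.

Definition module_trace := operator_trace m_gt0 grading_even grading_odd.
Definition rep (x : tA) : L := fm_rep F (algebra_part x).
Definition scalar_rep (x : tA) : L := scalar_operator H (scalar_part x).
Local Notation ideal := (ideal module_trace).

Lemma sym_ideal : ideal true 0 (fm_sym F).
Proof.
split=> [|/odd_pred/(fm_grading_even F)[_ _ gF _]]; first exact: small_all.
by rewrite /graded gF expr1 mulN1r.
Qed.
Lemma rep_ideal x : ideal false 0 (rep x).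
Proof.
split=> [|/odd_pred/(fm_grading_even F)[_ _ _ gr]]; first exact: small_all.
by rewrite /graded gr expr0 mul1r.
Qed.
Lemma scalar_ideal x : ideal false 0 (scalar_rep x).
Proof. exact: small_graded_scalar. Qed.
Lemma unital_rep_ideal x : ideal false 0 (unital_rep F x).
Proof. exact: (idealD (rep_ideal x) (scalar_ideal x)). Qed.
Lemma commutator_rep x :
  fm_sym F * unital_rep F x - unital_rep F x * fm_sym F = commutator (fm_sym F) (rep x).
Proof.
rewrite /unital_rep mulrDr mulrDl scalar_operatorC opprD addrACA subrr addr0.
by [].
Qed.
Lemma commutator_rep_ideal x : ideal true 1 (commutator (fm_sym F) (rep x)).
Proof.
have [_ gFx] := idealB (idealM sym_ideal (rep_ideal x)) (idealM (rep_ideal x) sym_ideal).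
by split=> //; apply: schatten_small => //; exact: fm_summable.
Qed.
Lemma scalar_operatorE k X : scalar_operator H k * X = k *: X.
Proof. exact: operatorP. Qed.
Lemma rep_linear k x y : rep (k *: x + y) = scalar_operator H k * rep x + rep y.
Proof. by rewrite scalar_operatorE -linearP. Qed.
Lemma rep1 : rep 1 = 0.
Proof. exact: linear0. Qed.
Lemma scalar_repM x y : scalar_rep (x * y) = scalar_rep x * scalar_rep y.
Proof. by rewrite scalar_operatorE; apply: operatorP => z; exact: (esym (scalerA _ _ z)). Qed.
Lemma repM x y : rep (x * y) = rep x * rep y + scalar_rep x * rep y + rep x * scalar_rep y.
Proof. by rewrite -[rep x * scalar_rep y]scalar_operatorC !scalar_operatorE -!linearZ -fm_repM -!linearD. Qed.
Lemma unital_repM x y : unital_rep F (x * y) = unital_rep F x * unital_rep F y.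
Proof.
have -> : unital_rep F (x * y) = rep (x * y) + scalar_rep (x * y) by [].
by rewrite repM scalar_repM [in RHS]mulrDl !mulrDr addrACA -!addrA.
Qed.

Lemma sym_sqr : fm_sym F * fm_sym F = 1.
Proof. by rewrite -expr2 fm_symK. Qed.

Definition index_form : bar tA L :=
  bar_const (fm_sym F) * bar_comm (unital_rep F) (fm_sym F) ^+ m.

Lemma index_form_summable : summable_at module_trace m index_form.
Proof.
have wF : of_class module_trace false 2 (bar_comm (unital_rep F) (fm_sym F)).
  apply: (@of_class_form _ _ _ module_trace _ true 1) => x.
  by rewrite commutator_rep; exact: commutator_rep_ideal.
have := of_classM (of_class_const sym_ideal) (of_classX m wF) => /of_class_summable; apply.
  by [].
by rewrite add0n muln2 addnn.
Qed.

Definition index_list (s : seq tA) : C :=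
  (2 * m%:R)^-1 * tr module_trace index_form s.

Lemma index_list_product s : size s = m ->
  index_list s = 2^-1 * functional module_trace
    (fm_sym F * \prod_(x <- s) (fm_sym F * unital_rep F x - unital_rep F x * fm_sym F)).
Proof.
move=> sz_s; rewrite /index_list tr_index//.
- rewrite -[functional _ _ *+ m]mulr_natl mulrA invfM mulfVK//.
  by rewrite pnatr_eq0 -lt0n.
- exact: sym_ideal.
- by move=> x; rewrite commutator_rep; exact: commutator_rep_ideal.
- exact: sym_sqr.
Qed.

Lemma index_cochain_list : index_cochain F = concentrated m.-1 index_list.
Proof.
apply: graded_cochainP => n a; rewrite /index_cochain /concentrated; case: eqP => // def_n.
rewrite index_list_product; last by rewrite size_entries def_n prednK.
rewrite /= /graded_trace mulrA; congr (_ * trace (_ * _)).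
by rewrite big_entries.
Qed.

Lemma index_normalized : normalized_on m.-1.+1 index_list.
Proof.
rewrite prednK// => s1 s2 sz_s.
have iotaC := @scalar_operatorC R H.
have cH : bar_comm (unital_rep F) (fm_sym F) = bar_form (fun x => commutator (fm_sym F) (rep x)).
  by apply: eq_bar_form => x; exact: commutator_rep.
have nf : normalized (scalar_operator H) index_form.
  apply: (normalizedM iotaC); first exact: normalized_const.
  apply: (normalizedX iotaC); rewrite cH; apply: normalized_form => [k x y|].
    by rewrite rep_linear /commutator mulrDr mulrDl mulrA -iotaC -!mulrA mulrBr opprD addrACA.
  by rewrite rep1 /commutator mulr0 mul0r subrr.
have [lf f1] := tr_normalized (t := module_trace) (@small_graded_scalar _ _ _ m_gt0 _)
  (@graded_traceZ _ _ _ m_gt0 _) nf index_form_summable sz_s.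
rewrite /index_list; split=> [k x y|]; last by rewrite f1 mulr0.
by rewrite lf mulrDr mulrCA.
Qed.

Lemma index_cocycle : index_cochain F \in cocycle m.-1.
Proof.
apply/asboolP; rewrite index_cochain_list; split.
  exact: (concentrated_reduced index_normalized).
rewrite (coboundary_concentrated index_normalized) prednK//.
apply: graded_cochainP => n a; rewrite /concentrated; case: eqP => // def_n.
rewrite [RHS](_ : _ = 0)//; 
have sz_s : size (entries a) = m.+1 by rewrite size_entries def_n.
have -> : hoch index_list (entries a) = (2 * m%:R)^-1 * hoch (tr module_trace index_form) (entries a).
  rewrite /hoch /bar_diff mulrDr mulr_sumr; congr (_ + _); last by rewrite /index_list mulrCA.
  by apply: eq_bigr => i _; rewrite /index_list mulrCA.
rewrite -tr_d ?sz_s//; last exact: index_form_summable.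
rewrite /index_form tr_index_cocycle ?mulr0//.
- exact: unital_repM.
- exact: unital_rep_ideal.
- exact: sym_ideal.
- by move=> x; rewrite commutator_rep; exact: commutator_rep_ideal.
- exact: sym_sqr.
Qed.
End One.


Section Two.
Variables F G : fredholm_module A H m.
Hypothesis same_rep : fm_rep F =1 fm_rep G.
Hypothesis same_grading : ~~ odd m.-1 -> fm_grading F = fm_grading G.
Hypothesis difference : schatten m (fm_sym G - fm_sym F).
Local Notation ideal := (ideal (module_trace F)).

Lemma grading_eq : fm_grading F = fm_grading G.
Proof.
have [om|om] := boolP (odd m.-1); first by rewrite !fm_grading_odd.
exact: same_grading.
Qed.
Lemma unital_rep_eq x : unital_rep F x = unital_rep G x.
Proof. by rewrite /unital_rep same_rep. Qed.
Lemma difference_ideal : ideal true 1 (fm_sym G - fm_sym F).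
Proof.
split=> [|om]; first exact: schatten_small.
have [_ gF] := sym_ideal F; have [_ gG] := sym_ideal G.
have {}gG : graded (fm_grading F) true (fm_sym G) by rewrite grading_eq; exact: gG.
by rewrite /graded mulrBr gF// gG// mulrBl mulrBr.
Qed.
Lemma index_list_product' s : size s = m ->
  index_list G s = 2^-1 * functional (module_trace F)
    (fm_sym G * \prod_(x <- s) (fm_sym G * unital_rep F x - unital_rep F x * fm_sym G)).
Proof.
move=> sz_s; rewrite index_list_product//; congr (_ * _).
rewrite /= /graded_trace grading_eq; congr (trace (_ * (_ * _))).
by apply: eq_bigr => x _; rewrite unital_rep_eq.
Qed.

Lemma transgression_exists : exists2 phi : seq tA -> C, normalized_on m.-1 phi &
  forall s, size s = m -> index_list G s - index_list F s =
    if (1 < m)%N then hoch phi s else 0.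
Proof.
have [L0|L_neq0] := eqVneq (1 : L) 0.
  have trace0 (X Y : L) : trace X = trace Y.
    by rewrite -[X]mul1r -[Y]mul1r L0 !mul0r.
  exists (fun=> 0) => [s1 s2 _|s sz_s]; first by split=> // k x y; rewrite mulr0 addr0.
  have fE X : functional (module_trace F) X = 0 by rewrite -(functional0 (module_trace F)); exact: trace0.
  by rewrite hoch_eq0// if_same index_list_product'// index_list_product// !fE subrr.
pose S : nzRingType := HB.pack L (GRing.PzSemiRing_isNonZero.Build L L_neq0).
pose t : summable_trace S C m := module_trace F.
pose phi := @transgression C tA S m t (rep F) scalar_rep (fm_sym F) (fm_sym G).
have sr_central x c : scalar_rep x * c = c * scalar_rep x := scalar_operatorC _ _.
exists (fun s => (2 * m%:R)^-1 * phi s) => [s1 s2 sz_s|s sz_s].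
  have [lphi phi1] := @transgression_normalized C tA S m t (scalar_operator H) (rep F) scalar_rep
    (fm_sym F) (fm_sym G) m_gt0 (@scalar_operatorC R H)
    (@small_graded_scalar _ _ _ m_gt0 _) (@graded_traceZ _ _ _ m_gt0 _) (rep_linear F)
    (rep1 F) sr_central (rep_ideal F) (sym_ideal F) (commutator_rep_ideal F)
    (sym_sqr F) (sym_sqr G) difference_ideal s1 s2 sz_s.
  split=> [k x y|]; rewrite /phi; last by rewrite phi1 mulr0.
  by rewrite lphi mulrDr mulrCA.
have := @transgressionP C tA S m t (rep F) scalar_rep (fm_sym F) (fm_sym G) m_gt0
  (repM F) (@scalar_repM) sr_central (rep_ideal F) (scalar_ideal F) (sym_ideal F)
  (commutator_rep_ideal F) (sym_sqr F) (sym_sqr G) difference_ideal s sz_s.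
rewrite -/phi index_list_product' ?index_list_product//.
set fG := functional _ _; set fF := functional _ _ => e.
have {e} e : (fG - fF) *+ m = if (1 < m)%N then hoch phi s else 0 by exact: e.
transitivity ((2 * m%:R)^-1 * ((fG - fF) *+ m)).
  rewrite -[(fG - fF) *+ m]mulr_natl mulrA invfM mulfVK ?mulrBr//.
  by rewrite pnatr_eq0 -lt0n.
rewrite e; case: ifP => _; last by rewrite mulr0.
rewrite /hoch /bar_diff mulrDr mulr_sumr; congr (_ + _); last by rewrite mulrCA.
by apply: eq_bigr => i _; rewrite mulrCA.
Qed.
End Two.
End Module.

Theorem theorem1p1 (R : realType) (m : nat) (m_ge1 : (1 <= m)%N)
    (A : nonUnitalAlgType R[i]) (H : separableHilbertType R)
    (F G : fredholm_module A H m)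
    (same_rep : fm_rep F =1 fm_rep G)
    (same_grading : ~~ odd m.-1 -> fm_grading F = fm_grading G)
    (difference : schatten m (fm_sym G - fm_sym F)) :
  exists (cF : index_cochain F \in cocycle m.-1)
         (cG : index_cochain G \in cocycle m.-1),
    chern_character cF = chern_character cG.
Proof.
have cF := index_cocycle m_ge1 F; have cG := index_cocycle m_ge1 G; exists cF, cG.
have [phi nphi hphi] := transgression_exists m_ge1 same_rep same_grading difference.
apply/esym/eqP; rewrite /chern_character /cohomology_class -Quotient.idealrBE.
apply/asboolP; case: m m_ge1 F G same_rep same_grading difference cF cG phi nphi hphi => // n.
move=> n_gt0 {}F {}G srep sgr diff cF cG phi nphi hphi.
have coeff s : size s = n.+1 -> index_list n_gt0 G s - index_list n_gt0 F s =
  if (0 < n)%N then hoch phi s else 0 by exact: hphi.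
have diffE : index_cochain G - index_cochain F =
    concentrated n (fun s => if (0 < n)%N then hoch phi s else 0).
  rewrite !(index_cochain_list n_gt0); apply: graded_cochainP => p a.
  rewrite [LHS](_ : _ = concentrated n (index_list n_gt0 G) a - concentrated n (index_list n_gt0 F) a)//.
  rewrite /concentrated; case: eqP => [def_p|_]; last by rewrite subr0.
  by rewrite coeff// size_entries def_p.
case: n {n_gt0} F G {srep sgr diff hphi coeff} cF cG nphi diffE => [|p] F G cF cG nphi diffE /=.
  apply: val_inj; rewrite /= [LHS]diffE; apply: graded_cochainP => p a.
  by rewrite /concentrated if_same.
exists (concentrated p phi); first exact: concentrated_reduced.
by rewrite coboundary_concentrated// [RHS]diffE.
Qed.
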